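(* Let $n$ be a positive integer. Let $p$ be a prime number. Let $(M,\omega)$ be a $2n$-dimensional $p$-adic analytic symplectic manifold and let $m\in M$. Then there exist local $p$-adic analytic coordinates $(x_1,y_1,\ldots,x_n,y_n)$ around $m$ such that $\omega=\sum_{i=1}^n\mathrm{d}x_i\wedge\mathrm{d}y_i$.
   Context: A function between open subsets of $(\mathbb{Q}_p)^{\ell_1}$ and $(\mathbb{Q}_p)^{\ell_2}$ is $p$-adic analytic if its domain is a union of balls on each of which it is given by a convergent $p$-adic power series. An $\ell$-dimensional $p$-adic analytic manifold is a Hausdorff topological space with an atlas of charts (homeomorphisms from open subsets onto open subsets of $(\mathbb{Q}_p)^\ell$) whose changes of charts are bi-analytic. Differential forms, the wedge product and the differential $\mathrm{d}$ are defined as in the real case, using $p$-adic analytic functions. A $2n$-dimensional $p$-adic analytic symplectic manifold is a pair $(M,\omega)$ where $M$ is a $2n$-dimensional $p$-adic analytic manifold and $\omega$ is a closed non-degenerate $p$-adic analytic $2$-form on $M$: $\mathrm{d}\omega=0$, and for all $m\in M$ and $0\neq u\in\mathrm{T}_mM$ there is $v\in\mathrm{T}_mM$ with $\omega(u,v)\neq 0$. Local $p$-adic analytic coordinates around $m$ are given by a bi-analytic map from an open neighborhood of $m$ onto an open subset of $(\mathbb{Q}_p)^{2n}$; the equality for $\omega$ holds on that neighborhood. *)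

(* Defs.v *)
From HB Require Import structures.
From mathcomp Require Import all_boot all_order all_algebra.
From mathcomp Require Import generic_quotient ring_quotient finmap perm.
From mathcomp Require Import boolp classical_sets functions topology.
From mathcomp Require Import summability.
From mathcomp Require Import ring lra zify.

Set Implicit Arguments.
Unset Strict Implicit.
Unset Printing Implicit Defensive.

Import Order.TTheory GRing.Theory Num.Theory.

Local Open Scope classical_set_scope.
Local Open Scope quotient_scope.
Local Open Scope ring_scope.

Definition padic_abs (p : nat) (x : rat) : rat :=
  if x == 0 then 0 else p%:Q ^ ((logn p `|denq x|)%:Z - (logn p `|numq x|)%:Z).

Section PadicAbs.
Variables (p : nat) (p_pr : prime p).

Let p_gt0 : 0 < p%:Q :> rat.
Proof. by rewrite ltr0n prime_gt0. Qed.

Let p_neq0 : p%:Q != 0 :> rat.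
Proof. by rewrite gt_eqF. Qed.

Lemma padic_abs0 : padic_abs p 0 = 0.
Proof. by rewrite /padic_abs eqxx. Qed.

Lemma padic_abs_ge0 x : 0 <= padic_abs p x.
Proof. by rewrite /padic_abs; case: eqP => // _; rewrite exprz_ge0 // ltW. Qed.

Lemma padic_abs_eq0 x : (padic_abs p x == 0) = (x == 0).
Proof.
rewrite /padic_abs; case: (x == 0); first by rewrite eqxx.
by apply/negbTE; rewrite expfz_neq0.
Qed.

Lemma padic_abs_frac (a b : int) : a != 0 -> b != 0 ->
  padic_abs p (a%:~R / b%:~R) = p%:Q ^ ((logn p `|b|)%:Z - (logn p `|a|)%:Z).
Proof.
move=> a0 b0; set x := a%:~R / b%:~R.
have x0 : x != 0 by rewrite mulf_neq0 ?invr_eq0 ?intr_eq0.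
rewrite /padic_abs (negbTE x0); congr (_ ^ _).
have : numq x * b = a * denq x.
  apply/eqP; rewrite -(eqr_int rat) !intrM -[X in _ == _ * X]divr1.
  have -> : (numq x)%:~R = x * (denq x)%:~R :> rat.
    by rewrite -[in X in X * _](divq_num_den x) divfK // intr_eq0 denq_eq0.
  by rewrite divr1 /x mulrAC divfK ?intr_eq0.
move/(congr1 (fun z : int => logn p `|z|%N)); rewrite !abszM !lognM ?absz_gt0 ?denq_eq0 ?numq_eq0 //.
by move: (logn _ _) (logn _ _) (logn _ _) (logn _ _) => *; lia.
Qed.

Lemma padic_absM (x y : rat) : padic_abs p (x * y) = padic_abs p x * padic_abs p y.
Proof.
have [->|x0] := eqVneq x 0; first by rewrite !(mul0r, padic_abs0).
have [->|y0] := eqVneq y 0; first by rewrite !(mulr0, padic_abs0).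
rewrite -[x in LHS]divq_num_den -[y in LHS]divq_num_den mulf_div -!intrM.
rewrite padic_abs_frac ?mulf_neq0 ?numq_eq0 ?denq_eq0 //.
rewrite /padic_abs (negbTE x0) (negbTE y0) -expfzDr //; congr (_ ^ _).
by rewrite !abszM !lognM ?absz_gt0 ?denq_eq0 ?numq_eq0 //; lia.
Qed.

Lemma padic_abs1 : padic_abs p 1 = 1.
Proof. by rewrite /padic_abs oner_eq0 (numq_int 1) (denq_int 1) subrr expr0z. Qed.

Lemma padic_absV (x : rat) : padic_abs p x^-1 = (padic_abs p x)^-1.
Proof.
have [->|x0] := eqVneq x 0; first by rewrite !(padic_abs0, invr0).
have ax0 : padic_abs p x != 0 by rewrite padic_abs_eq0.
by apply: (mulfI ax0); rewrite -padic_absM !divff // padic_abs1.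
Qed.

Lemma padic_absN (x : rat) : padic_abs p (- x) = padic_abs p x.
Proof. by rewrite /padic_abs oppr_eq0 numqN denqN abszN. Qed.

Lemma padic_absB (x y : rat) : padic_abs p (x - y) = padic_abs p (y - x).
Proof. by rewrite -padic_absN opprB. Qed.

Lemma padic_absD (x y : rat) :
  padic_abs p (x + y) <= Num.max (padic_abs p x) (padic_abs p y).
Proof.
have [->|x0] := eqVneq x 0; first by rewrite add0r le_max lexx orbT.
have [->|y0] := eqVneq y 0; first by rewrite addr0 le_max lexx.
have [->|xy0] := eqVneq (x + y) 0; first by rewrite padic_abs0 le_max padic_abs_ge0.
pose a := numq x * denq y; pose b := numq y * denq x; pose d := denq x * denq y.
have d0 : d != 0 by rewrite mulf_neq0 ?denq_eq0.
have a0 : a != 0 by rewrite mulf_neq0 ?numq_eq0 ?denq_eq0.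
have b0 : b != 0 by rewrite mulf_neq0 ?numq_eq0 ?denq_eq0.
have dx : (denq x)%:~R != 0 :> rat by rewrite intr_eq0 denq_eq0.
have dy : (denq y)%:~R != 0 :> rat by rewrite intr_eq0 denq_eq0.
have xE : x = a%:~R / d%:~R.
  by rewrite !intrM -mulf_div divff // mulr1 divq_num_den.
have yE : y = b%:~R / d%:~R.
  by rewrite !intrM [X in _ / X]mulrC -mulf_div divff // mulr1 divq_num_den.
have xyE : x + y = (a + b)%:~R / d%:~R by rewrite intrD mulrDl -xE -yE.
have ab0 : a + b != 0.
  by apply: contra_neq xy0 => ab0; rewrite xyE ab0 mul0r.
rewrite xyE padic_abs_frac // xE yE !padic_abs_frac //.
have p1 : 1 < p%:Q :> rat by rewrite ltr1n prime_gt1.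
rewrite le_max !ler_eXz2l // !lerD2l !lerN2 !lez_nat.
suff : (minn (logn p `|a|%N) (logn p `|b|%N) <= logn p `|(a + b)%R|)%N.
  by rewrite geq_min.
rewrite -pfactor_dvdn ?absz_gt0 //; set k := minn _ _.
change (((p ^ k)%N%:Z %| a + b)%Z); apply: rpredD;
  by rewrite dvdzE /= pfactor_dvdn ?absz_gt0 // geq_min leqnn ?orbT.
Qed.

Lemma padic_absD_lt (x y e : rat) :
  padic_abs p x < e -> padic_abs p y < e -> padic_abs p (x + y) < e.
Proof. by move=> xe ye; apply: le_lt_trans (padic_absD x y) _; rewrite gt_max xe. Qed.

End PadicAbs.

(* The field of p-adic numbers is built as the completion of rat for the p-adic
   absolute value: Cauchy sequences modulo null sequences. Since the p-adic
   absolute value takes only rational values, so does the norm, and rat is a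
   sufficient set of radii for the metric. *)
Definition padic_cauchy (p : nat) (p_pr : prime p) : pred (nat -> rat) :=
  fun u => `[< forall e : rat, 0 < e -> exists N, forall m n,
                 (N <= m)%N -> (N <= n)%N -> padic_abs p (u m - u n) < e >].

Section PadicCauchy.
Variables (p : nat) (p_pr : prime p).

Lemma padic_cauchy_ultra (u : nat -> rat) (e : rat) : padic_cauchy p_pr u -> 0 < e ->
  exists N, forall n, (N <= n)%N -> padic_abs p (u n - u N) < e.
Proof. by move=> /asboolP cu e0; have [N hN] := cu e e0; exists N => n Nn; exact: hN. Qed.

Lemma padic_cauchy_bounded (u : nat -> rat) : padic_cauchy p_pr u ->
  exists B : rat, 0 < B /\ forall n, padic_abs p (u n) < B.
Proof.
move=> /padic_cauchy_ultra -/(_ 1 ltr01)[N hN].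
pose B := 1 + padic_abs p (u N) + \sum_(i < N) padic_abs p (u i).
have s0 (k : nat) : 0 <= \sum_(i < k) padic_abs p (u i).
  by rewrite sumr_ge0 // => i _; exact: padic_abs_ge0.
have B0 : 0 < B.
  by rewrite /B -addrA ltr_pwDl // addr_ge0 // padic_abs_ge0.
exists B; split=> // n; have [Nn|nN] := leqP N n.
  rewrite -(subrK (u N) (u n)); apply: padic_absD_lt => //.
    apply: lt_le_trans (hN _ Nn) _.
    by rewrite /B -addrA lerDl addr_ge0 // padic_abs_ge0.
  rewrite /B -addrA addrCA; apply: ltr_pwDr; last by [].
  by rewrite ltr_pwDl.
rewrite /B (bigD1 (Ordinal nN)) //= addrCA ltrDl -addrA ltr_pwDl //.
by rewrite addr_ge0 ?padic_abs_ge0 // sumr_ge0 // => i _; exact: padic_abs_ge0.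
Qed.

Lemma padic_cauchy_subring : subring_closed (padic_cauchy p_pr).
Proof.
split.
- apply/asboolP => e e0; exists 0%N => m n _ _.
  by rewrite [_ - _]subrr padic_abs0.
- move=> u v /asboolP cu /asboolP cv; apply/asboolP => e e0.
  have [N hN] := cu e e0; have [N' hN'] := cv e e0.
  exists (maxn N N') => m n; rewrite !geq_max => /andP[Nm N'm] /andP[Nn N'n].
  rewrite (_ : _ - _ = (u m - u n) + (v n - v m)); last first.
    by rewrite !fctE; ring.
  by apply: padic_absD_lt; [|exact: hN|exact: hN'].
- move=> u v cu cv; apply/asboolP => e e0.
  have [B [B0 hB]] := padic_cauchy_bounded cu.
  have [C [C0 hC]] := padic_cauchy_bounded cv.
  move/asboolP : cu => /(_ (e / C))[|N hN]; first by rewrite divr_gt0.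
  move/asboolP : cv => /(_ (e / B))[|N' hN']; first by rewrite divr_gt0.
  exists (maxn N N') => m n; rewrite !geq_max => /andP[Nm N'm] /andP[Nn N'n].
  rewrite (_ : _ - _ = (u m - u n) * v m + u n * (v m - v n)); last first.
    by rewrite !fctE; ring.
  apply: padic_absD_lt => //; rewrite padic_absM //.
    rewrite -(divfK (lt0r_neq0 C0) e); apply: ltr_pM; rewrite ?padic_abs_ge0 //.
    exact: hN.
  rewrite mulrC -(divfK (lt0r_neq0 B0) e); apply: ltr_pM; rewrite ?padic_abs_ge0 //.
  exact: hN'.
Qed.

HB.instance Definition _ :=
  GRing.isSubringClosed.Build (nat -> rat) (padic_cauchy p_pr) padic_cauchy_subring.

End PadicCauchy.

Record padic_seq (p : nat) (p_pr : prime p) := PadicSeq {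
  padic_seq_val :> nat -> rat;
  padic_seqP : padic_seq_val \in padic_cauchy p_pr }.

HB.instance Definition _ p p_pr := [isSub for @padic_seq_val p p_pr].
HB.instance Definition _ p p_pr := [Choice of @padic_seq p p_pr by <:].
HB.instance Definition _ p p_pr :=
  [SubChoice_isSubComNzRing of @padic_seq p p_pr by <:].

Definition padic_null (p : nat) (p_pr : prime p) : pred (padic_seq p_pr) :=
  fun u => `[< forall e : rat, 0 < e ->
                 exists N, forall n, (N <= n)%N -> padic_abs p (u n) < e >].
Arguments padic_null {p} p_pr _.

Section PadicNull.
Variables (p : nat) (p_pr : prime p).
Implicit Types u v : padic_seq p_pr.

Lemma padic_seq_abs_stable u : u \notin padic_null p_pr ->
  exists r, 0 < r /\ exists N, forall n, (N <= n)%N -> padic_abs p (u n) = r.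
Proof.
move=> /asboolPn/existsNP[e /not_implyP[e0 /forallNP hu]].
have [N hN] := @padic_cauchy_ultra p p_pr u e (padic_seqP u) e0.
have /existsNP[m /not_implyP[Nm /negP]] := hu N; rewrite -leNgt => em.
have uNe : e <= padic_abs p (u N).
  rewrite leNgt; apply/negP => uN; move: em; rewrite leNgt => /negP; apply.
  by rewrite -(subrK (u N) (u m)); apply: padic_absD_lt => //; exact: hN.
exists (padic_abs p (u N)); split; first exact: lt_le_trans uNe.
exists N => n Nn; have ne := lt_le_trans (hN _ Nn) uNe.
apply/eqP; rewrite eq_le; apply/andP; split.
  rewrite -[u n in leLHS](subrK (u N)); apply: le_trans (padic_absD _ _ _) _ => //.
  by rewrite ge_max lexx andbT ltW.
rewrite leNgt; apply/negP => un.
have : padic_abs p (u N) < padic_abs p (u N).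
  rewrite -[u N in ltLHS](subrK (u n)); apply: padic_absD_lt => //.
  by rewrite padic_absB.
by rewrite ltxx.
Qed.

Lemma padic_null_ideal : idealr_closed (padic_null p_pr).
Proof.
split.
- by apply/asboolP => e e0; exists 0%N => n _; rewrite [_ n]/(0 : rat) padic_abs0.
- apply/asboolPn => /(_ 1 ltr01)[N /(_ N (leqnn N))].
  by rewrite [_ N]/(1 : rat) padic_abs1 ltxx.
- move=> a u v /asboolP nu /asboolP nv; apply/asboolP => e e0.
  have [B [B0 hB]] := @padic_cauchy_bounded p p_pr a (padic_seqP a).
  have [N hN] := nu (e / B) (divr_gt0 e0 B0).
  have [N' hN'] := nv e e0.
  exists (maxn N N') => n; rewrite geq_max => /andP[Nn N'n].
  rewrite (_ : (_ n) = a n * u n + v n) //.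
  apply: padic_absD_lt => //; last exact: hN'.
  rewrite padic_absM // mulrC -(divfK (lt0r_neq0 B0) e).
  by apply: ltr_pM; rewrite ?padic_abs_ge0 //; exact: hN.
Qed.

HB.instance Definition _ := isIdealr.Build (padic_seq p_pr) (padic_null p_pr) padic_null_ideal.

Lemma padic_null_inv u : u \notin padic_null p_pr ->
  exists v, v * u - 1 \in padic_null p_pr.
Proof.
move=> /padic_seq_abs_stable[r [r0 [N hN]]].
have u0 n : (N <= n)%N -> u n != 0.
  by move=> /hN un; rewrite -(padic_abs_eq0 p_pr) un gt_eqF.
have cv : (fun n => (u n)^-1) \in padic_cauchy p_pr.
  apply/asboolP => e e0; have := padic_seqP u.
  move/asboolP => /(_ (e * r ^+ 2))[|N' hN']; first by rewrite mulr_gt0 // exprn_gt0.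
  exists (maxn N N') => m n; rewrite !geq_max => /andP[Nm N'm] /andP[Nn N'n].
  have -> : (u m)^-1 - (u n)^-1 = (u n - u m) * (u m * u n)^-1.
    by field; rewrite !u0.
  rewrite padic_absM // padic_absV // padic_absM // !hN // -expr2.
  by rewrite ltr_pdivrMr ?exprn_gt0 //; exact: hN'.
exists (PadicSeq cv); apply/asboolP => e e0; exists N => n Nn.
rewrite (_ : (_ n) = (u n)^-1 * u n - 1) // mulVf ?u0 // subrr padic_abs0.
Qed.

End PadicNull.

Definition padic_ideal (p : nat) (p_pr : prime p) : idealr (padic_seq p_pr) :=
  Idealr.clone (padic_seq p_pr) (padic_null p_pr) _.

Definition padic (p : nat) (p_pr : prime p) : Type :=
  {ideal_quot (padic_ideal p_pr)}.

HB.instance Definition _ p p_pr := GRing.ComNzRing.on (@padic p p_pr).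
HB.instance Definition _ p p_pr := EqQuotient.on (@padic p p_pr).

Section PadicField.
Variables (p : nat) (p_pr : prime p).

Lemma padic_pi0 : \pi_(padic p_pr) 0 = 0.
Proof. exact: pi_zeror. Qed.

Lemma padic_pi1 : \pi_(padic p_pr) 1 = 1.
Proof. exact: pi_oner. Qed.

Lemma padic_piN (u : padic_seq p_pr) : \pi_(padic p_pr) (- u) = - \pi u.
Proof. exact: pi_oppr. Qed.

Lemma padic_piD (u v : padic_seq p_pr) :
  \pi_(padic p_pr) (u + v) = \pi u + \pi v.
Proof. exact: pi_addr. Qed.

Lemma padic_piM (u v : padic_seq p_pr) :
  \pi_(padic p_pr) (u * v) = \pi u * \pi v.
Proof. exact: pi_mulr. Qed.

Definition padic_inv (x : padic p_pr) : padic p_pr :=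
  if x == 0 then 0 else xget 0 [set y | y * x = 1].

Lemma padic_mulVx (x : padic p_pr) : x != 0 -> padic_inv x * x = 1.
Proof.
move=> x0; rewrite /padic_inv (negbTE x0).
apply: (@xgetPex _ _ [set y | y * x = 1]) => /=.
have /padic_null_inv[v hv] : repr x \notin padic_null p_pr.
  apply: contra x0 => nx; rewrite -[x]reprK -padic_pi0.
  by rewrite -Quotient.idealrBE subr0.
exists (\pi v); apply/eqP.
rewrite -[x]reprK -padic_piM -padic_pi1.
by rewrite -Quotient.idealrBE.
Qed.

Lemma padic_inv0 : padic_inv 0 = 0.
Proof. by rewrite /padic_inv eqxx. Qed.

HB.instance Definition _ :=
  GRing.ComNzRing_isField.Build (padic p_pr) padic_mulVx padic_inv0.

End PadicField.

Lemma ultra_limit_aux (a b c ra rb rc m : rat) :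
  (forall e, a < e -> b < e -> c < e) -> ra <= m -> rb <= m -> m < rc ->
  `|a - ra| < (rc - m) / 2 -> `|b - rb| < (rc - m) / 2 ->
  `|c - rc| < (rc - m) / 2 -> False.
Proof.
move=> abc ram rbm mrc; rewrite !ltr_norml.
move=> /andP[h1 h1'] /andP[h2 h2'] /andP[h3 h3'].
by have := abc (m + (rc - m) / 2) ltac:(lra) ltac:(lra); lra.
Qed.

Section PadicNorm.
Variables (p : nat) (p_pr : prime p).
Implicit Types (u v : padic_seq p_pr) (x y : padic p_pr).

Definition padic_abs_lim u (r : rat) := forall e : rat, 0 < e ->
  exists N, forall n, (N <= n)%N -> `|padic_abs p (u n) - r| < e.

Lemma padic_abs_lim_null u : u \in padic_null p_pr -> padic_abs_lim u 0.
Proof.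
move=> /asboolP nu e /nu[N hN]; exists N => n /hN; rewrite subr0 ger0_norm //.
exact: padic_abs_ge0.
Qed.

Lemma padic_abs_lim_stable u r :
  (exists N, forall n, (N <= n)%N -> padic_abs p (u n) = r) -> padic_abs_lim u r.
Proof. by move=> [N hN] e e0; exists N => n /hN ->; rewrite subrr normr0. Qed.

Lemma padic_abs_lim_ex u : exists r, padic_abs_lim u r.
Proof.
have [nu|/padic_seq_abs_stable[r [_ hr]]] := boolP (u \in padic_null p_pr).
  by exists 0; exact: padic_abs_lim_null.
by exists r; exact: padic_abs_lim_stable.
Qed.

Lemma padic_abs_lim_unique u r s : padic_abs_lim u r -> padic_abs_lim u s -> r = s.
Proof.
move=> ur us; apply/eqP; rewrite -subr_eq0 -normr_le0 leNgt; apply/negP => rs0.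
have rs2 : 0 < `|r - s| / 2 by rewrite divr_gt0.
have [N hN] := ur _ rs2; have [N' hN'] := us _ rs2.
have h1 := hN _ (leq_maxl N N'); have h2 := hN' _ (leq_maxr N N').
move: h1 h2; set a := padic_abs _ _ => h1 h2.
have : `|r - s| <= `|a - r| + `|a - s|.
  by rewrite (distrC a r) (_ : r - s = (r - a) + (a - s)) ?ler_normD //; ring.
by lra.
Qed.

Lemma padic_abs_lim_eqv u v r :
  u - v \in padic_null p_pr -> padic_abs_lim v r -> padic_abs_lim u r.
Proof.
move=> uv vr; have [nv|] := boolP (v \in padic_null p_pr).
  have -> : r = 0 by apply: padic_abs_lim_unique vr _; exact: padic_abs_lim_null.
  apply: padic_abs_lim_null; rewrite -(subrK v u).
  exact: (@rpredD _ (padic_ideal p_pr)).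
move=> /padic_seq_abs_stable[s [s0 [N hN]]].
have -> : r = s.
  by apply: padic_abs_lim_unique vr _; apply: padic_abs_lim_stable; exists N.
apply: padic_abs_lim_stable.
move/asboolP : uv => /(_ _ s0)[N' hN']; exists (maxn N N') => n.
rewrite geq_max => /andP[Nn N'n]; have {}hN' : padic_abs p (u n - v n) < s := hN' _ N'n.
apply/eqP; rewrite eq_le; apply/andP; split.
  rewrite -(subrK (v n) (u n)); apply: le_trans (padic_absD _ _ _) _ => //.
  by rewrite hN // ge_max lexx andbT ltW.
rewrite leNgt; apply/negP => un.
have : padic_abs p (v n) < s.
  rewrite -(subrK (u n) (v n)); apply: padic_absD_lt => //.
  by rewrite padic_absB.
by rewrite hN // ltxx.
Qed.

(* All sequences representing x have the same limit of absolute values. *)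
Definition padic_norm x : rat := xget 0 (padic_abs_lim (repr x)).

Lemma padic_normP u r : padic_abs_lim u r -> padic_norm (\pi u) = r.
Proof.
move=> ur; apply: (@padic_abs_lim_unique u) => //.
apply: (@padic_abs_lim_eqv _ (repr (\pi_(padic p_pr) u))).
  by rewrite (Quotient.idealrBE (padic_ideal p_pr)) reprK.
exact: (xgetPex 0 (padic_abs_lim_ex (repr (\pi_(padic p_pr) u)))).
Qed.

Lemma padic_norm_lim u : padic_abs_lim u (padic_norm (\pi u)).
Proof. by have [r ur] := padic_abs_lim_ex u; rewrite (padic_normP ur). Qed.

Lemma padic_norm_ge0 x : 0 <= padic_norm x.
Proof.
rewrite -[x]reprK leNgt; apply/negP => n0.
have d0 : 0 < - padic_norm (\pi_(padic p_pr) (repr x)) by rewrite oppr_gt0.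
have [N hN] := @padic_norm_lim (repr x) _ d0.
have := hN N (leqnn N); rewrite ltr_norml => /andP[_].
by rewrite -ltrBrDr subrr ltNge padic_abs_ge0.
Qed.

Lemma padic_norm0 : padic_norm 0 = 0.
Proof.
rewrite -padic_pi0; apply/padic_normP/padic_abs_lim_null.
exact: (@rpred0 _ (padic_ideal p_pr)).
Qed.

Lemma padic_normN x : padic_norm (- x) = padic_norm x.
Proof.
rewrite -[x]reprK -padic_piN; apply: padic_normP => e.
move=> /(@padic_norm_lim (repr x))[N hN]; exists N => n /hN.
by rewrite (_ : (- repr x) n = - repr x n) // padic_absN.
Qed.

Lemma padic_normD_lt x y e :
  padic_norm x < e -> padic_norm y < e -> padic_norm (x + y) < e.
Proof.
rewrite -[x]reprK -[y]reprK -padic_piD.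
set u := repr x; set v := repr y => xe ye.
pose m := Num.max (padic_norm (\pi u)) (padic_norm (\pi v)).
have me : m < e by rewrite gt_max xe.
apply: le_lt_trans me; rewrite leNgt; apply/negP => ml.
pose d := (padic_norm (\pi_(padic p_pr) (u + v)) - m) / 2.
have d0 : 0 < d by rewrite divr_gt0 ?subr_gt0.
have [N1 h1] := @padic_norm_lim (u) _ d0.
have [N2 h2] := @padic_norm_lim (v) _ d0.
have [N3 h3] := @padic_norm_lim (u + v) _ d0.
pose n := maxn N1 (maxn N2 N3).
have {}h1 := h1 n (leq_maxl _ _).
have {}h2 : `|padic_abs p (v n) - padic_norm (\pi v)| < d.
  by apply: h2; rewrite /n !leq_max leqnn orbT.
have {}h3 : `|padic_abs p (u n + v n) - padic_norm (\pi_(padic p_pr) (u + v))| < d.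
  by apply: h3; rewrite /n !leq_max leqnn !orbT.
have um : padic_norm (\pi u) <= m by rewrite le_max lexx.
have vm : padic_norm (\pi v) <= m by rewrite le_max lexx orbT.
exact: (ultra_limit_aux (fun e => @padic_absD_lt p p_pr (u n) (v n) e) um vm ml h1 h2 h3).
Qed.

End PadicNorm.

Section PadicTopology.
Variables (p : nat) (p_pr : prime p).
Local Notation Qp := (padic p_pr).

HB.instance Definition _ := isPointed.Build Qp 0.
HB.instance Definition _ :=
  hasNbhs.Build Qp (nbhs_ball_ (ball_ (@padic_norm p p_pr))).

Let padic_ball_center (x : Qp) (e : rat) :
  0 < e -> ball_ (@padic_norm p p_pr) x e x.
Proof. by move=> e0; rewrite /ball_ /= subrr padic_norm0. Qed.

Let padic_ball_sym (x y : Qp) (e : rat) :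
  ball_ (@padic_norm p p_pr) x e y -> ball_ (@padic_norm p p_pr) y e x.
Proof. by rewrite /ball_ /= -[y - x]opprB padic_normN. Qed.

Let padic_ball_triangle (x y z : Qp) (e1 e2 : rat) :
  ball_ (@padic_norm p p_pr) x e1 y -> ball_ (@padic_norm p p_pr) y e2 z ->
  ball_ (@padic_norm p p_pr) x (e1 + e2) z.
Proof.
rewrite /ball_ /= => xy yz.
have pos (t : Qp) (e : rat) : padic_norm t < e -> 0 < e.
  by move=> te; apply: le_lt_trans te; exact: padic_norm_ge0.
have e1_gt0 := pos _ _ xy; have e2_gt0 := pos _ _ yz.
rewrite (_ : x - z = (x - y) + (y - z)); last by rewrite addrA subrK.
apply: padic_normD_lt.
  by rewrite (lt_trans xy) // ltrDl.
by rewrite (lt_trans yz) // ltrDr.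
Qed.

Let padic_nbhsE :
  @nbhs Qp Qp = nbhs_ (entourage_ (ball_ (@padic_norm p p_pr))).
Proof.
rewrite funeq2E => x A; rewrite propeqE; split.
  move=> [e e0 xeA]; exists [set xy | ball_ (@padic_norm p p_pr) xy.1 e xy.2].
    by exists e.
  by move=> y /xsectionP; exact: xeA.
move=> [E [e e0 eE] EA]; exists e => // y xy; apply: EA; apply/xsectionP.
exact: eE.
Qed.

HB.instance Definition _ := Nbhs_isPseudoMetric.Build rat Qp
  padic_nbhsE padic_ball_center padic_ball_sym padic_ball_triangle erefl.

End PadicTopology.

Section Analytic.
Variables (p : nat) (p_pr : prime p).
Local Notation Qp := (padic p_pr).

Definition monomial l (k : {ffun 'I_l -> nat}) (z : 'rV[Qp]_l) : Qp :=
  \prod_(i < l) z 0 i ^+ k i.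

(* The sum is unconditional: the limit is along the finite sets of exponents. *)
Definition power_series_sum l (a : {ffun 'I_l -> nat} -> Qp)
    (z : 'rV[Qp]_l) (s : Qp) : Prop :=
  partial_sum (fun k => a k * monomial k z) @ totally --> s.

(* Balls of 'rV[Qp]_l are those of the sup norm. *)
Definition analytic l l' (U : set 'rV[Qp]_l) (f : 'rV[Qp]_l -> 'rV[Qp]_l') :=
  forall x, U x -> exists (x0 : 'rV[Qp]_l) (r : rat),
    [/\ ball x0 r x, ball x0 r `<=` U &
        forall j, exists a, forall y, ball x0 r y ->
          power_series_sum a (y - x0) (f y 0 j)].

Definition dirderiv l (f : 'rV[Qp]_l -> Qp) (x v : 'rV[Qp]_l) : Qp :=
  lim ((fun h : Qp => h^-1 * (f (x + h *: v) - f x)) @ (0 : Qp)^').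

(* Acts on row vectors: the differential of f at x is v |-> v *m jacobian f x. *)
Definition jacobian l l' (f : 'rV[Qp]_l -> 'rV[Qp]_l') (x : 'rV[Qp]_l) :
    'M[Qp]_(l, l') :=
  \matrix_(i, j) dirderiv (fun y => f y 0 j) x (delta_mx 0 i).

End Analytic.

(* The values of chart_map off chart_dom, and of chart_inv off its image, are
   irrelevant. *)
Record chart (p : nat) (p_pr : prime p) (M : topologicalType) (l : nat) := Chart {
  chart_dom : set M;
  chart_map :> M -> 'rV[padic p_pr]_l;
  chart_inv : 'rV[padic p_pr]_l -> M;
  open_chart_dom : open chart_dom;
  open_chart_cod : open (chart_map @` chart_dom);
  chart_mapK : forall m, chart_dom m -> chart_inv (chart_map m) = m;
  chart_map_continuous : {within chart_dom, continuous chart_map};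
  chart_inv_continuous : {within chart_map @` chart_dom, continuous chart_inv} }.

Section Chart.
Variables (p : nat) (p_pr : prime p) (M : topologicalType) (l : nat).
Implicit Types c : chart p_pr M l.

Definition chart_cod c : set 'rV[padic p_pr]_l := c @` chart_dom c.

Definition transition c c' : 'rV[padic p_pr]_l -> 'rV[padic p_pr]_l :=
  c' \o chart_inv c.

Definition analytic_change c c' : Prop :=
  analytic (c @` (chart_dom c `&` chart_dom c')) (transition c c').

End Chart.

Record analytic_manifold (p : nat) (p_pr : prime p) (l : nat) := AnalyticManifold {
  manifold_carrier :> topologicalType;
  atlas : set (chart p_pr manifold_carrier l);
  manifold_hausdorff : hausdorff_space manifold_carrier;
  atlas_cover : forall m, exists c, atlas c /\ chart_dom c m;
  atlas_compatible : forall c c', atlas c -> atlas c' -> analytic_change c c' }.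

Section Manifold.
Variables (p : nat) (p_pr : prime p) (l : nat) (M : analytic_manifold p_pr l).
Local Notation Qp := (padic p_pr).
Local Notation E := 'rV[Qp]_l.
Implicit Types (c : chart p_pr M l) (m : M).

Definition chart_around m c : Prop := @atlas _ _ _ M c /\ chart_dom c m.

Definition chart_at m : chart p_pr M l := sval (cid (atlas_cover m)).

(* c is bi-analytic between the manifold and an open subset of affine space. *)
Definition local_coordinates c : Prop :=
  forall c', @atlas _ _ _ M c' -> analytic_change c c' /\ analytic_change c' c.

(* A tangent vector at m is the family of its coordinates in the charts of the
   atlas around m (and 0 for the other charts). *)
Definition tangent_family m : pred (chart p_pr M l -> E) :=
  fun u => `[< (forall c, ~ chart_around m c -> u c = 0) /\
               (forall c c', chart_around m c -> chart_around m c' ->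
                  u c' = u c *m jacobian (transition c c') (c m)) >].

Lemma tangent_family_submod m : submod_closed (tangent_family m).
Proof.
split=> [|a u v /asboolP[u0 uJ] /asboolP[v0 vJ]]; apply/asboolP; split.
- by [].
- by move=> c c' _ _; exact/esym/mul0mx.
- move=> c hc; change (a *: u c + v c = 0).
  by rewrite u0 // v0 // scaler0 addr0.
- move=> c c' hc hc'.
  change (a *: u c' + v c' = (a *: u c + v c) *m jacobian (transition c c') (c m)).
  rewrite (uJ c c') // (vJ c c') //.
  by rewrite mulmxDl scalemxAl.
Qed.

HB.instance Definition _ m :=
  GRing.isSubmodClosed.Build Qp (chart p_pr M l -> E) (tangent_family m)
    (tangent_family_submod m).

Record tangent_space m := TangentVector {
  tangent_coord :> chart p_pr M l -> E;
  tangent_coordP : tangent_coord \in tangent_family m }.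

HB.instance Definition _ m := [isSub for @tangent_coord m].
HB.instance Definition _ m := [Choice of tangent_space m by <:].
HB.instance Definition _ m := [SubChoice_isSubLmodule of tangent_space m by <:].

(* A k-form is given by its local expressions in the charts of the atlas;
   omega c x v is meaningful for c in the atlas and x in chart_cod c only. *)
Definition form_family (k : nat) : Type :=
  chart p_pr M l -> E -> ('I_k -> E) -> Qp.

Definition multilinear k (f : ('I_k -> E) -> Qp) : Prop :=
  forall (v : 'I_k -> E) (i : 'I_k) (a : Qp) (x y : E),
    f [eta v with i |-> a *: x + y] =
    a * f [eta v with i |-> x] + f [eta v with i |-> y].

Definition alternating k (f : ('I_k -> E) -> Qp) : Prop :=
  forall (v : 'I_k -> E) i j, i != j -> v i = v j -> f v = 0.

Definition differential_form k (omega : form_family k) : Prop :=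
  [/\ forall c x, atlas c -> chart_cod c x ->
        multilinear (omega c x) /\ alternating (omega c x),
      forall c v, atlas c ->
        analytic (chart_cod c) (fun x => \row_(_ < 1) omega c x v) &
      forall m c c' v, chart_around m c -> chart_around m c' ->
        omega c (c m) v =
        omega c' (c' m) (fun i => v i *m jacobian (transition c c') (c m))].

(* Independent of the chart around m for a differential form. *)
Definition form_at k (omega : form_family k) m (u : 'I_k -> tangent_space m) :
    Qp :=
  let c := chart_at m in omega c (c m) (fun i => u i c).

Definition eq_form_on k (U : set M) (omega eta : form_family k) : Prop :=
  forall m c v, U m -> chart_around m c -> omega c (c m) v = eta c (c m) v.

Definition form_of_fun (f : M -> Qp) : form_family 0 :=
  fun c x _ => f (chart_inv c x).

(* d omega (v_0, ..., v_k) =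
   \sum_i (-1)^i D_{v_i} (omega (v_0, ..., omit v_i, ..., v_k)) in a chart,
   for constant vectors v_i. *)
Definition form_diff k (omega : form_family k) : form_family k.+1 :=
  fun c x v => \sum_(i < k.+1)
    (-1) ^+ i * dirderiv (fun y => omega c y (v \o lift i)) x (v i).

(* Normalized so that (a /\ b)(u, v) = a u * b v - a v * b u on 1-forms. *)
Definition wedge k k' (omega : form_family k) (eta : form_family k') :
    form_family (k + k') :=
  fun c x v => (k`! * k'`!)%:R^-1 * \sum_(s : 'S_(k + k')) (-1) ^+ s *
    (omega c x (v \o s \o @lshift k k') * eta c x (v \o s \o @rshift k k')).

Definition dcoord (c : chart p_pr M l) (j : 'I_l) : form_family 1 :=
  form_diff (form_of_fun (fun q : M => c q 0 j)).

Definition closed_form k (omega : form_family k) : Prop :=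
  eq_form_on setT (form_diff omega) 0.

Definition nondegenerate (omega : form_family 2) : Prop :=
  forall m (u : tangent_space m), u != 0 ->
    exists v : tangent_space m, form_at omega (tnth [tuple u; v]) != 0.

Definition symplectic_form (omega : form_family 2) : Prop :=
  [/\ differential_form omega, closed_form omega & nondegenerate omega].

End Manifold.

Arguments atlas {p p_pr l} _ _.

(* Coordinates are ordered as (x_1, y_1, ..., x_n, y_n). *)
Lemma x_index_subproof n (i : 'I_n) : (2 * i < 2 * n)%N.
Proof. by rewrite ltn_pmul2l. Qed.

Lemma y_index_subproof n (i : 'I_n) : ((2 * i).+1 < 2 * n)%N.
Proof. by have := ltn_ord i; lia. Qed.

Definition x_index n (i : 'I_n) : 'I_(2 * n) := Ordinal (x_index_subproof i).
Definition y_index n (i : 'I_n) : 'I_(2 * n) := Ordinal (y_index_subproof i).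

(* Main.v *)
(* Moser's method. In a chart centred at m and rescaled by a power of p, the
   coefficients of omega are restricted power series on the closed unit ball and
   omega = Om - p^2 beta, with Om constant, beta small and closed; by the Poincare
   lemma beta = d gamma. On the (1 + l)-dimensional space of pairs (s, z), the
   closed form (Om + (s - p^2) beta) + gamma /\ ds has in its kernel a field
   D = d/ds + Y, with Y analytic because Om + (s - p^2) beta is inverted by a
   Neumann series. The flow of D at time p^2 is given by the exponential series
   exp(p^2 D), which converges since |p^2n / n!| <= 2^-n; it preserves the closed
   form, and hence carries the restriction Om to s = p^2 into the restriction
   Om - p^2 beta to s = 0. The flow is close to the identity, so it is inverted by
   successive approximation; a symplectic basis for Om ends the proof. *)
Require Import Defs.
From mathcomp Require Import all_boot all_order all_algebra.
From mathcomp Require Import finmap perm.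
From mathcomp Require Import boolp classical_sets functions topology.
From mathcomp Require Import summability.
From mathcomp Require Import ring lra zify.

Set Implicit Arguments.
Unset Strict Implicit.
Unset Printing Implicit Defensive.

Import Order.TTheory GRing.Theory Num.Theory.

Local Open Scope classical_set_scope.
Local Open Scope quotient_scope.
Local Open Scope ring_scope.

(** * The p-adic absolute value *)

(** A p-adic function with zero derivative need not be locally constant, so it is not enough to
    differentiate the pulled-back form along the flow. Identities are instead proved on power
    series: [tate] records a Gauss norm bound on the closed unit ball, and the invariance of the
    form becomes a recursion between the terms of the exponential series. Differentiation multiplies
    coefficients by integers, of norm at most 1, so it does not increase Gauss norms, and iterating
    a vector field needs no smaller ball. Because of the denominators n!, only small times are
    available: the path of forms has length p^2 instead of 1, and beta is the deviation from Om
    divided by -p^2. The square is for p = 2, where exp(p D) need not converge. The variable s turns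
    the time-dependent field of Moser's method into an autonomous one, whose flow is the exponential
    of a derivation. The Poincare lemma also creates denominators, paid for by evaluating at p z.
    All these rescalings of the chart are free: an opposite scaling of the target coordinates
    cancels their effect on omega. *)

Section PadicNormTheory.
Variables (p : nat) (p_pr : prime p).
Local Notation Qp := (padic p_pr).
Local Notation N := (@padic_norm p p_pr).
Implicit Types x y : Qp.

Lemma padic_norm_eq0 x : N x = 0 -> x = 0.
Proof.
rewrite -[x]reprK => x0; rewrite -padic_pi0; apply/eqP.
rewrite -Quotient.idealrBE subr0; apply/asboolP => e e0.
have [K hK] := @padic_norm_lim p p_pr (repr x) e e0.
exists K => n /hK; rewrite x0 subr0 ger0_norm //; exact: padic_abs_ge0.
Qed.

Lemma padic_norm_gt0 x : x != 0 -> 0 < N x.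
Proof.
move=> x0; rewrite lt_neqAle padic_norm_ge0 andbT eq_sym.
by apply: contra x0 => /eqP/padic_norm_eq0 ->.
Qed.

Lemma padic_normD x y (e : rat) : N x <= e -> N y <= e -> N (x + y) <= e.
Proof.
move=> xe ye; rewrite leNgt; apply/negP => h.
by have := padic_normD_lt (le_lt_trans xe h) (le_lt_trans ye h); rewrite ltxx.
Qed.

Lemma padic_normB x y (e : rat) : N x <= e -> N y <= e -> N (x - y) <= e.
Proof. by move=> xe ye; apply: padic_normD; rewrite ?padic_normN. Qed.

Lemma padic_normC x y : N (x - y) = N (y - x).
Proof. by rewrite -padic_normN opprB. Qed.

Lemma padic_norm_sum (I : Type) (r : seq I) (P : pred I) (F : I -> Qp) (e : rat) :
  0 <= e -> (forall i, P i -> N (F i) <= e) -> N (\sum_(i <- r | P i) F i) <= e.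
Proof.
move=> e0 h; elim/big_ind: _ => //; first by rewrite padic_norm0.
by move=> x y; exact: padic_normD.
Qed.

(** Along a non-null representative the absolute values are eventually constant, so the norm is the
    absolute value of late terms and multiplicativity comes from [rat]; a null factor makes the
    product null by the ideal property. *)
Lemma padic_normM x y : N (x * y) = N x * N y.
Proof.
rewrite -[x]reprK -[y]reprK -padic_piM; apply: padic_normP.
have [nx|sx] := boolP (repr x \in padic_null p_pr).
  rewrite (padic_normP (padic_abs_lim_null nx)) mul0r.
  apply: padic_abs_lim_null; rewrite mulrC.
  by have [_ _ /(_ (repr y) _ 0 nx)] := padic_null_ideal p_pr; rewrite addr0; apply;
     have [] := padic_null_ideal p_pr.
have [ny|sy] := boolP (repr y \in padic_null p_pr).
  rewrite (padic_normP (padic_abs_lim_null ny)) mulr0.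
  apply: padic_abs_lim_null.
  by have [_ _ /(_ (repr x) _ 0 ny)] := padic_null_ideal p_pr; rewrite addr0; apply;
     have [] := padic_null_ideal p_pr.
have [r [_ [K hK]]] := padic_seq_abs_stable sx.
have [s [_ [L hL]]] := padic_seq_abs_stable sy.
rewrite (@padic_normP _ _ (repr x) r); last by apply: padic_abs_lim_stable; exists K.
rewrite (@padic_normP _ _ (repr y) s); last by apply: padic_abs_lim_stable; exists L.
apply: padic_abs_lim_stable; exists (maxn K L) => n; rewrite geq_max => /andP[Kn Ln].
by change (padic_abs p (repr x n * repr y n) = r * s); rewrite padic_absM // hK // hL.
Qed.

Lemma padic_normM_le x y (a b : rat) : N x <= a -> N y <= b -> N (x * y) <= a * b.
Proof. by move=> xa yb; rewrite padic_normM ler_pM ?padic_norm_ge0. Qed.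

Lemma padic_cst_cauchy (q : rat) : (fun _ : nat => q) \in padic_cauchy p_pr.
Proof. by apply/asboolP => e e0; exists 0%N => m n _ _; rewrite subrr padic_abs0. Qed.

Definition padic_cst (q : rat) : padic_seq p_pr := PadicSeq (padic_cst_cauchy q).

Lemma padic_norm_nat n : N n%:R = padic_abs p n%:R.
Proof.
have -> : n%:R = \pi_(padic p_pr) (n%:R : padic_seq p_pr).
  elim: n => [|n ih]; first by rewrite padic_pi0.
  by rewrite -!(natr1 n) padic_piD padic_pi1 ih.
apply: padic_normP; apply: padic_abs_lim_stable; exists 0%N => k _; congr padic_abs.
elim: n => // n ih.
by rewrite -!(natr1 n) -ih.
Qed.

Lemma padic_norm1 : N 1 = 1.
Proof. by rewrite -[1]/(1%:R) padic_norm_nat padic_abs1. Qed.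

Lemma padic_normX x n : N (x ^+ n) = N x ^+ n.
Proof. by elim: n => [|n ih]; rewrite ?padic_norm1 // !exprS padic_normM ih. Qed.

Lemma padic_normV x : N x^-1 = (N x)^-1.
Proof.
have [->|x0] := eqVneq x 0; first by rewrite invr0 !padic_norm0 invr0.
have nx := lt0r_neq0 (padic_norm_gt0 x0).
by apply: (mulfI nx); rewrite -padic_normM !divff // padic_norm1.
Qed.

Lemma padic_norm_natE n : (0 < n)%N -> N n%:R = (p%:R ^+ logn p n)^-1.
Proof.
move=> n0; rewrite padic_norm_nat; have nn0 : n%:Z != 0 by case: n n0.
have := @padic_abs_frac p p_pr n%:Z 1 nn0 isT; rewrite divr1 absz1 logn1 sub0r => ->.
by rewrite exprnN.
Qed.

Lemma padic_norm_nat_le1 n : N n%:R <= 1.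
Proof.
case: n => [|n]; first by rewrite padic_norm0.
rewrite padic_norm_natE // invf_le1 ?exprn_gt0 ?ltr0n ?prime_gt0 //.
by rewrite exprn_ege1 // ler1n prime_gt0.
Qed.

Lemma padic_nat_neq0 n : (0 < n)%N -> (n%:R : Qp) != 0.
Proof.
move=> n0; apply/eqP => h; have := padic_norm_natE n0; rewrite h padic_norm0.
move/esym/eqP; rewrite invr_eq0 expf_eq0 pnatr_eq0 => /andP[_ /eqP p0].
by have := prime_gt0 p_pr; rewrite p0.
Qed.

(** The [p]-part of [n.+1] divides it, hence is at most [n.+1]. Inverses of integers thus grow at
    most linearly, which a geometric factor can absorb. *)
Lemma padic_norm_natV_le n : N (n.+1%:R)^-1 <= n.+1%:R.
Proof.
rewrite padic_normV padic_norm_natE // invrK -natrX ler_nat.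
by apply: dvdn_leq => //; exact: pfactor_dvdnn.
Qed.

Lemma padic_norm_p : N p%:R = p%:R^-1.
Proof. by rewrite padic_norm_natE ?prime_gt0 // logn_prime // eqxx expr1. Qed.

Lemma padic_p_neq0 : (p%:R : Qp) != 0.
Proof. exact/padic_nat_neq0/prime_gt0. Qed.

Lemma padic_norm_p_le : N p%:R <= 2^-1.
Proof.
by rewrite padic_norm_p lef_pV2 ?posrE ?ltr0n ?prime_gt0 // ler_nat prime_gt1.
Qed.

Lemma padic_norm_pX_le n : N (p%:R ^+ n) <= 2^-1 ^+ n.
Proof.
by rewrite padic_normX lerXn2r ?nnegrE ?padic_norm_ge0 ?invr_ge0 // padic_norm_p_le.
Qed.

Lemma padic_norm_pX_le1 n : N (p%:R ^+ n) <= 1.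
Proof. by rewrite -natrX padic_norm_nat_le1. Qed.

Lemma half_expr_small (e : rat) : 0 < e -> exists n, 2^-1 ^+ n < e.
Proof.
move=> e0.
have [k hk] : exists k : nat, e^-1 < k%:R.
  exists (Num.truncn e^-1).+1; exact: truncnS_gt.
exists k; rewrite exprVn -[e]invrK ltf_pV2 ?posrE ?invr_gt0 ?exprn_gt0 //.
by apply: lt_le_trans hk _; rewrite -natrX ler_nat ltnW // ltn_expl.
Qed.

Lemma padic_pX_small (e : rat) : 0 < e ->
  exists n, forall m, (n <= m)%N -> N (p%:R ^+ m) < e.
Proof.
move=> /half_expr_small[n hn]; exists n => m nm; apply: le_lt_trans hn.
apply: le_trans (padic_norm_pX_le _) _.
by rewrite ler_wiXn2l // invf_le1.
Qed.

(** Legendre's formula, with the powers of [p] replaced by those of 2. *)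
Lemma logn_fact_le n : (logn p n`! <= n)%N.
Proof.
rewrite logn_fact //; have h2 := prime_gt1 p_pr.
(* Keeping the remainder [n %/ 2 ^ m] makes the bound inductive: twice the next remainder is at most
   the present one. *)
suff H m : (\sum_(1 <= k < m.+1) n %/ p ^ k + n %/ 2 ^ m <= n)%N.
  by apply: leq_trans (H n); exact: leq_addr.
elim: m => [|m ih]; first by rewrite big_geq // divn1.
rewrite big_nat_recr //=; apply: leq_trans ih; rewrite -addnA leq_add2l.
have h : (n %/ p ^ m.+1 <= n %/ 2 ^ m.+1)%N.
  by rewrite leq_div2l ?expn_gt0 // leq_exp2r.
apply: leq_trans (leq_add h (leqnn _)) _.
rewrite addnn expnSr divnMA -muln2; exact: leq_trunc_div.
Qed.

(** One of the two factors [p ^ n] absorbs the factorial, whose valuation is at most [n]; the other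
    one leaves the geometric decay. *)
Lemma padic_norm_exp_coef n : N ((p%:R ^+ 2) ^+ n / n`!%:R) <= 2^-1 ^+ n.
Proof.
rewrite padic_normM padic_normV padic_norm_natE ?fact_gt0 // invrK.
rewrite !padic_normX padic_norm_p exprAC expr2 -mulrA -[leRHS]mulr1.
have p0 : 0 < p%:R :> rat by rewrite ltr0n prime_gt0.
have q0 : 0 <= p%:R^-1 ^+ n :> rat by rewrite exprn_ge0 // invr_ge0 ltW.
have r0 : 0 <= p%:R ^+ logn p n`! :> rat by rewrite exprn_ge0 // ltW.
apply: ler_pM; [exact: q0|exact: mulr_ge0| |].
  apply: lerXn2r; rewrite ?nnegrE ?invr_ge0 ?(ltW p0) //.
  by rewrite lef_pV2 ?posrE // ler_nat prime_gt1.
rewrite exprVn mulrC ler_pdivrMr ?exprn_gt0 // mul1r ler_weXn2l //.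
  by rewrite ler1n prime_gt0.
exact: logn_fact_le.
Qed.

Lemma padic_ballE x (e : rat) y : ball x e y = (N (x - y) < e) :> Prop.
Proof. by []. Qed.

(** A point common to the balls of radius [N (x - y)] around [x] and [y] contradicts the strong
    triangle inequality. This makes the limit in [dirderiv] unique. *)
Lemma padic_hausdorff : hausdorff_space Qp.
Proof.
move=> x y xy; apply/eqP; rewrite -subr_eq0; apply/negPn/negP => d0.
have e0 := padic_norm_gt0 d0.
have [z []] := xy (ball x (N (x - y))) (ball y (N (x - y)))
  (nbhsx_ballx x _ e0) (nbhsx_ballx y _ e0).
rewrite !padic_ballE => xz yz.
have : N ((x - z) + (z - y)) < N (x - y).
  by apply: padic_normD_lt => //; rewrite padic_normC.
by rewrite addrA subrK ltxx.
Qed.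

Lemma padic_approx (u : padic_seq p_pr) (e : rat) : 0 < e ->
  exists q, N (\pi_(padic p_pr) u - \pi_(padic p_pr) (padic_cst q)) < e.
Proof.
move=> e0; have e20 : 0 < e / 2 by rewrite divr_gt0.
have [L hL] := @padic_cauchy_ultra p p_pr u (e / 2) (padic_seqP u) e20.
exists (u L); rewrite -padic_piN -padic_piD.
set w := _ + _; rewrite ltNge; apply/negP => h.
have [K hK] := @padic_norm_lim p p_pr w (e / 2) e20.
have := hK _ (leq_maxr L K); have := hL _ (leq_maxl L K).
change (padic_abs p (w (maxn L K))) with (padic_abs p (u (maxn L K) - u L)).
move: h; move: (N _) (padic_abs _ _) => b a; rewrite ltr_norml => h ae /andP[].
by move: h ae; lra.
Qed.

(** Diagonal argument: rationals chosen within [2^-1 ^+ n] of [x n] form a Cauchy sequence, whose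
    class is the limit. *)
Lemma padic_complete (x : nat -> Qp) :
  (forall e : rat, 0 < e -> exists K, forall m n, (K <= m)%N -> (K <= n)%N ->
     N (x m - x n) < e) ->
  exists l, forall e : rat, 0 < e -> exists K, forall n, (K <= n)%N -> N (x n - l) < e.
Proof.
move=> cx.
have approx n : exists q, N (x n - \pi_(padic p_pr) (padic_cst q)) < 2^-1 ^+ n.
  by have := padic_approx (repr (x n)) (exprn_gt0 n (_ : 0 < 2^-1 :> rat)); rewrite reprK; apply.
have [q hq] := choice approx.
have hqe (e : rat) : 0 < e -> exists K, forall n, (K <= n)%N -> N (x n - \pi_(padic p_pr) (padic_cst (q n))) < e.
  move=> /half_expr_small[K hK]; exists K => n Kn; apply: lt_trans (hq n) _.
  by apply: le_lt_trans hK; rewrite ler_wiXn2l // invf_le1.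
have qE m n : padic_abs p (q m - q n) = N (\pi_(padic p_pr) (padic_cst (q m)) - \pi_(padic p_pr) (padic_cst (q n))).
  rewrite -padic_piN -padic_piD; apply/esym/padic_normP.
  by apply: padic_abs_lim_stable; exists 0%N.
have cq : q \in padic_cauchy p_pr.
  apply/asboolP => e e0; have [K hK] := hqe e e0; have [L hL] := cx e e0.
  exists (maxn K L) => m n; rewrite !geq_max => /andP[Km Lm] /andP[Kn Ln].
  rewrite qE; set a := \pi _; set b := \pi _.
  have -> : a - b = (a - x m) + ((x m - x n) + (x n - b)) by ring.
  apply: padic_normD_lt; first by rewrite padic_normC hK.
  by apply: padic_normD_lt; [exact: hL|exact: hK].
exists (\pi_(padic p_pr) (PadicSeq cq)) => e e0; have [K hK] := hqe e e0.
have e20 : 0 < e / 2 by rewrite divr_gt0.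
move/asboolP: (cq) => /(_ _ e20)[L hL]; exists (maxn K L) => n; rewrite geq_max.
move=> /andP[Kn Ln]; set l := \pi _.
rewrite -[x n](subrK (\pi_(padic p_pr) (padic_cst (q n)))) -addrA.
apply: padic_normD_lt; first exact: hK.
rewrite /l -padic_piN -padic_piD ltNge; set w := padic_cst _ - _; apply/negP => h.
have [K' hK'] := @padic_norm_lim p p_pr w (e / 2) e20.
have := hK' _ (leq_maxr L K'); have := hL n _ Ln (leq_maxl L K').
change (padic_abs p (w (maxn L K'))) with (padic_abs p (q n - q (maxn L K'))).
move: h; move: (N _) (padic_abs _ _) => b a; rewrite ltr_norml => h ae /andP[].
by move: h ae; lra.
Qed.

End PadicNormTheory.

(** * Unconditional sums of null families *)

Section NullFamilies.
Variables (p : nat) (p_pr : prime p).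
Local Notation Qp := (padic p_pr).
Local Notation N := (@padic_norm p p_pr).

(** In a complete ultrametric field a family whose terms tend to zero is unconditionally summable,
    so [null] serves as the convergence hypothesis for sums over arbitrary index sets. *)
Definition null (I : choiceType) (f : I -> Qp) := forall e : rat, 0 < e ->
  exists A : {fset I}, forall i, i \notin A -> N (f i) < e.

Definition has_sum (I : choiceType) (f : I -> Qp) (s : Qp) := forall e : rat, 0 < e ->
  exists A : {fset I}, forall B : {fset I}, (A `<=` B)%fset ->
    N (\sum_(i <- B) f i - s) < e.

Definition nsum (I : choiceType) (f : I -> Qp) : Qp := xget 0 (has_sum f).

Section OneFamily.
Variable I : choiceType.
Implicit Types (f g : I -> Qp) (A B : {fset I}).

Lemma fsum_sub f A B (e : rat) : (A `<=` B)%fset -> 0 <= e ->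
  (forall i, i \notin A -> N (f i) <= e) ->
  N (\sum_(i <- B) f i - \sum_(i <- A) f i) <= e.
Proof.
move=> AB e0 h.
have -> : \sum_(i <- A) f i = \sum_(i <- B) (if i \in A then f i else 0).
  rewrite -(big_fset_incl _ AB) => [|i _ /negbTE -> //].
  by apply: eq_big_seq => i ->.
rewrite -sumrB; apply: padic_norm_sum => // i _.
by case: ifPn => [_|/h]; rewrite ?subrr ?padic_norm0 ?subr0.
Qed.

Lemma has_sum_unique f s t : has_sum f s -> has_sum f t -> s = t.
Proof.
move=> fs ft; apply/eqP; rewrite -subr_eq0; apply/negPn/negP => d0.
have e0 := padic_norm_gt0 d0.
have [A hA] := fs _ e0; have [B hB] := ft _ e0.
have {}hA := hA _ (fsubsetUl A B); have {}hB := hB _ (fsubsetUr A B).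
move: hA hB; set S := \sum_(i <- _) _ => hA hB.
have : N ((s - S) + (S - t)) < N (s - t).
  by apply: padic_normD_lt => //; rewrite padic_normC.
by rewrite addrA subrK ltxx.
Qed.

Lemma has_sumE f s : has_sum f s -> nsum f = s.
Proof. by move=> fs; apply: has_sum_unique (fs); exact: (xgetI 0 fs). Qed.

(** The increasing finite sets [U n] leave out only terms of norm at most [2^-1 ^+ n]. Any larger
    finite set changes the sum by no more than that, so the sums over [U n] are Cauchy and their
    limit is the sum. *)
Lemma null_has_sum f : null f -> has_sum f (nsum f).
Proof.
move=> nf; suff: exists s, has_sum f s by case=> s fs; exact: (xgetI 0 fs).
have hpos n : 0 < 2^-1 ^+ n :> rat by rewrite exprn_gt0.
have [A hA] := choice (fun n => nf _ (hpos n)).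
pose U n := (\bigcup_(i <- iota 0 n.+1) A i)%fset.
have hU n i : i \notin U n -> N (f i) <= 2^-1 ^+ n.
  move=> iU; apply/ltW/hA; apply: contra iU => iA; apply/bigfcupP; exists n => //.
  by rewrite andbT mem_iota /=; lia.
have UU m n : (m <= n)%N -> (U m `<=` U n)%fset.
  move=> mn; apply/bigfcupsP => i; rewrite mem_iota => im _.
  by apply: bigfcup_sup => //; rewrite mem_iota; lia.
have cauchyU k m n : (k <= m)%N -> (k <= n)%N ->
    N (\sum_(i <- U m) f i - \sum_(i <- U n) f i) <= 2^-1 ^+ k.
  move=> km kn; rewrite -(subrK (\sum_(i <- U k) f i) (\sum_(i <- U m) f i)) -addrA.
  apply: padic_normD; first by apply: fsum_sub (UU _ _ km) (ltW (hpos k)) _; exact: hU.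
  by rewrite padic_normC; apply: fsum_sub (UU _ _ kn) (ltW (hpos k)) _; exact: hU.
have [] := @padic_complete p p_pr (fun n => \sum_(i <- U n) f i).
  move=> e /half_expr_small[k hk]; exists k => m n km kn.
  exact: le_lt_trans (cauchyU _ _ _ km kn) hk.
move=> s hs; exists s => e e0; have [k hk] := half_expr_small e0; have [K hK] := hs _ e0.
have UkB B : (U (maxn k K) `<=` B)%fset -> N (\sum_(i <- B) f i - s) < e.
  move=> UB; rewrite -(subrK (\sum_(i <- U (maxn k K)) f i) (\sum_(i <- B) f i)) -addrA.
  apply: padic_normD_lt; last by apply: hK; rewrite leq_maxr.
  apply: le_lt_trans hk; apply: fsum_sub UB (ltW (hpos k)) _ => i iU; apply: hU.
  by apply: contra iU; apply: fsubsetP; apply: UU; rewrite leq_maxl.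
by exists (U (maxn k K)).
Qed.

Lemma nsum_approx f A (e : rat) : null f -> 0 <= e ->
  (forall i, i \notin A -> N (f i) <= e) -> N (nsum f - \sum_(i <- A) f i) <= e.
Proof.
move=> nf e0 h; rewrite leNgt; apply/negP => hlt.
have [B hB] := null_has_sum nf (le_lt_trans e0 hlt).
have {}hB := hB _ (fsubsetUr A B).
have := fsum_sub (fsubsetUl A B) e0 h.
move: hB; set T := \sum_(i <- (A `|` B)%fset) f i; set S := \sum_(i <- A) f i => hB hT.
have : N ((nsum f - T) + (T - S)) < N (nsum f - S).
  by apply: padic_normD_lt; [rewrite padic_normC|exact: le_lt_trans hlt].
by rewrite addrA subrK ltxx.
Qed.

(** One finite set per [e] is enough, instead of all sufficiently large ones; the identities between
    sums below are obtained in this way. *)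
Lemma nsum_eqP f s : null f ->
  (forall e : rat, 0 < e -> exists A, (forall i, i \notin A -> N (f i) <= e) /\
     N (s - \sum_(i <- A) f i) <= e) -> nsum f = s.
Proof.
move=> nf h; apply/eqP; rewrite -subr_eq0; apply/negPn/negP => /padic_norm_gt0 d0.
have [A [hA sA]] : exists A, (forall i, i \notin A -> N (f i) <= N (nsum f - s) / 2) /\
     N (s - \sum_(i <- A) f i) <= N (nsum f - s) / 2 by apply: h; rewrite divr_gt0.
have e0 : 0 <= N (nsum f - s) / 2 by rewrite divr_ge0 ?padic_norm_ge0.
have hn := nsum_approx nf e0 hA.
rewrite [N (s - _)]padic_normC in sA; have := padic_normD hn sA.
by rewrite addrA subrK; move: d0; lra.
Qed.

Lemma nsum_norm_le f (C : rat) : null f -> 0 <= C -> (forall i, N (f i) <= C) ->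
  N (nsum f) <= C.
Proof.
move=> nf C0 h; have := @nsum_approx f fset0 C nf C0 (fun i _ => h i).
by rewrite big_seq_fset0 subr0.
Qed.

Lemma null_dom f g : null g -> (forall i, N (f i) <= N (g i)) -> null f.
Proof. by move=> ng h e /ng[A hA]; exists A => i /hA; apply: le_lt_trans. Qed.

Lemma null_scale f (C : rat) g : null g -> (forall i, N (f i) <= C * N (g i)) -> null f.
Proof.
move=> ng h e e0; have C0 : 0 < `|C| + 1 by rewrite ltr_wpDl.
have [A hA] := ng _ (divr_gt0 e0 C0); exists A => i /hA gi.
apply: le_lt_trans (h i) _; rewrite ltr_pdivlMr // mulrC in gi; apply: le_lt_trans gi.
rewrite ler_wpM2r ?padic_norm_ge0 //; apply: le_trans (ler_norm C) _.
by rewrite lerDl.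
Qed.

Lemma nullD f g : null f -> null g -> null (fun i => f i + g i).
Proof.
move=> nf ng e e0; have [A hA] := nf e e0; have [B hB] := ng e e0.
exists (A `|` B)%fset => i; rewrite inE negb_or => /andP[iA iB].
by apply: padic_normD_lt; [exact: hA|exact: hB].
Qed.

Lemma nullZ f (a : Qp) : null f -> null (fun i => a * f i).
Proof. by move=> nf; apply: (null_scale (C := N a) nf) => i; rewrite padic_normM. Qed.

Lemma nsumD f g : null f -> null g -> nsum (fun i => f i + g i) = nsum f + nsum g.
Proof.
move=> nf ng; apply: nsum_eqP (nullD nf ng) _ => e e0.
have [A hA] := nf e e0; have [B hB] := ng e e0; exists (A `|` B)%fset.
have hf i : i \notin (A `|` B)%fset -> N (f i) <= e.
  by rewrite inE negb_or => /andP[/hA/ltW].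
have hg i : i \notin (A `|` B)%fset -> N (g i) <= e.
  by rewrite inE negb_or => /andP[_ /hB/ltW].
split; first by move=> i iAB; apply: padic_normD; [exact: hf|exact: hg].
rewrite big_split /= opprD addrACA; apply: padic_normD.
  exact: nsum_approx nf (ltW e0) hf.
exact: nsum_approx ng (ltW e0) hg.
Qed.

Lemma nsumZ f (a : Qp) : null f -> nsum (fun i => a * f i) = a * nsum f.
Proof.
move=> nf; apply: nsum_eqP (nullZ a nf) _ => e e0.
have C0 : 0 < N a + 1 by rewrite ltr_wpDl ?padic_norm_ge0.
have [A hA] := nf _ (divr_gt0 e0 C0); exists A.
have key x : N x <= e / (N a + 1) -> N (a * x) <= e.
  rewrite ler_pdivlMr // padic_normM mulrC => h; apply: le_trans h.
  by rewrite ler_wpM2r ?padic_norm_ge0 // lerDl.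
split; first by move=> i /hA/ltW; exact: key.
rewrite -mulr_sumr -mulrBr; apply: key.
by apply: nsum_approx nf _ _ => [|i /hA/ltW //]; rewrite divr_ge0 // ltW.
Qed.

Lemma nsum_fin f A : (forall i, i \notin A -> f i = 0) -> null f /\ nsum f = \sum_(i <- A) f i.
Proof.
move=> h; have nf : null f by move=> e e0; exists A => i /h ->; rewrite padic_norm0.
split=> //; apply: nsum_eqP nf _ => e e0; exists A; rewrite subrr padic_norm0.
by split=> [i /h ->|]; rewrite ?padic_norm0 ltW.
Qed.

Lemma eq_nsum f g : f =1 g -> nsum f = nsum g.
Proof. by move=> /funext ->. Qed.

Lemma nsum0 f : (forall i, f i = 0) -> nsum f = 0.
Proof.
by move=> h; have [_ ->] := @nsum_fin f fset0 (fun i _ => h i); rewrite big_seq_fset0.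
Qed.

Lemma nsumP f s : has_sum f s <-> partial_sum f @ totally --> s.
Proof.
have -> : partial_sum f = fun B : {fset I} => \sum_(i <- B) f i.
  by apply/funext => B; rewrite /partial_sum big_seq_fsetE.
have FF : ProperFilter (@totally I) := totally_filter.
split=> [fs|/cvg_ballP fs e e0].
  apply/cvg_ballP => e e0; have [A hA] := fs _ e0; exists A => // B AB.
  by rewrite /= padic_ballE padic_normC; exact: hA.
have [A _ hA] := fs _ e0; exists A => B AB.
by rewrite padic_normC -padic_ballE; exact: hA.
Qed.

End OneFamily.

(** * Regrouping and reindexing of null families *)

Section Regroup.
Variables I K : choiceType.

Lemma null_fiber (f : I -> Qp) (pi : I -> K) k : null f ->
  null (fun i => if pi i == k then f i else 0).
Proof.
by move=> nf; apply: null_dom nf _ => i; case: ifP; rewrite // padic_norm0 padic_norm_ge0.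
Qed.

(** Fibres of [pi] are encoded by families on the whole of [I] that vanish off the fibre, so no
    index type depends on [k]. Off the image of a finite set [A], a fibre sum involves only terms
    outside [A], hence is small. *)
Lemma nsum_regroup (f : I -> Qp) (pi : I -> K) : null f ->
  null (fun k => nsum (fun i => if pi i == k then f i else 0)) /\
  nsum (fun k => nsum (fun i => if pi i == k then f i else 0)) = nsum f.
Proof.
move=> nf; set g := fun k => nsum (fun i => if pi i == k then f i else 0).
have hg (A : {fset I}) (e : rat) k : 0 <= e -> (forall i, i \notin A -> N (f i) <= e) ->
    N (g k - \sum_(i <- A) if pi i == k then f i else 0) <= e.
  move=> e0 hA; apply: (nsum_approx (null_fiber pi k nf) e0) => i /hA.
  by case: ifP => _; rewrite ?padic_norm0.
have hout (A : {fset I}) k : k \notin [fset pi i | i in A]%fset ->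
    \sum_(i <- A) (if pi i == k then f i else 0) = 0.
  move=> kA; rewrite big_seq big1 // => i iA; case: eqP => // ik.
  by rewrite -ik in_imfset in kA.
have ng : null g.
  move=> e e0; have e20 : 0 < e / 2 by rewrite divr_gt0.
  have [A hA] := nf _ e20; exists [fset pi i | i in A]%fset => k kA.
  have := hg A _ k (ltW e20) (fun i h => ltW (hA i h)); rewrite hout // subr0.
  by move: e0; lra.
split=> //; apply: nsum_eqP ng _ => e e0; have [A hA] := nf _ e0.
exists [fset pi i | i in A]%fset; split=> [k kA|].
  by have := hg A _ k (ltW e0) (fun i h => ltW (hA i h)); rewrite hout // subr0.
have h1 := nsum_approx nf (ltW e0) (fun i h => ltW (hA i h)).
rewrite -(subrK (\sum_(i <- A) f i) (nsum f)) -addrA; apply: padic_normD => //.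
have -> : \sum_(i <- A) f i =
    \sum_(k <- [fset pi i | i in A]%fset) \sum_(i <- A) if pi i == k then f i else 0.
  rewrite exchange_big /= big_seq [RHS]big_seq; apply: eq_bigr => i iA.
  rewrite (big_fsetD1 (pi i)) ?in_imfset //= eqxx big_seq big1 ?addr0 // => k.
  by rewrite !inE eq_sym => /andP[/negbTE ->].
rewrite -sumrB; apply: padic_norm_sum (ltW e0) _ => k _.
by rewrite padic_normC; apply: hg (ltW e0) (fun i h => ltW (hA i h)).
Qed.

Lemma nsum_reindex (f : I -> Qp) (h : K -> I) : null f -> injective h ->
  (forall i, (exists k, i = h k) \/ f i = 0) ->
  null (f \o h) /\ nsum (f \o h) = nsum f.
Proof.
move=> nf hi hf.
(* The preimage of a finite set under an injection is finite; it is built from a chosen partial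
   inverse of [h]. *)
have pre (A : {fset I}) : exists B : {fset K}, forall k, (k \in B) = (h k \in A).
  pose P (i : I) (o : option K) := match o with Some k => h k = i | None => forall k, h k <> i end.
  have exP i : exists o, P i o.
    have [[k hk]|hk] := pselect (exists k, h k = i); first by exists (Some k).
    by exists None => k hki; apply: hk; exists k.
  have [g hg] := choice exP.
  exists [fset k | k in pmap g A]%fset => k; rewrite !inE mem_pmap.
  apply/mapP/idP => [[i iA]|hkA].
    by have := hg i; rewrite /P; case: (g i) => // k' hk' [->]; rewrite hk'.
  by exists (h k) => //; have := hg (h k); rewrite /P; case: (g _) => [k' /hi ->|/(_ k)].
have nfh : null (f \o h).
  move=> e /nf[A hA]; have [B hB] := pre A; exists B => k.
  by rewrite hB => /hA.
split=> //; apply: nsum_eqP nfh _ => e e0; have [A hA] := nf e e0; have [B hB] := pre A.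
exists B; split=> [k|]; first by rewrite hB => /hA/ltW.
have -> : \sum_(k <- B) (f \o h) k = \sum_(i <- [fset h k | k in B]%fset) f i.
  by rewrite big_imfset //= => k k' _ _; exact: hi.
apply: (nsum_approx nf (ltW e0)) => i; have [iA|/hA/ltW //] := boolP (i \in A).
case: (hf i) => [[k ik]|-> _]; last by rewrite padic_norm0 ltW.
by rewrite ik in_imfset //= hB -ik iA.
Qed.

End Regroup.

Lemma nsum_fubini (I J : choiceType) (F : I -> J -> Qp) :
  null (fun u : I * J => F u.1 u.2) ->
  null (fun i => nsum (F i)) /\
  nsum (fun i => nsum (F i)) = nsum (fun u : I * J => F u.1 u.2).
Proof.
move=> nF; have rowE i :
    nsum (F i) = nsum (fun u : I * J => if u.1 == i then F u.1 u.2 else 0).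
  pose g := fun u : I * J => if u.1 == i then F u.1 u.2 else 0.
  have ng : null g := null_fiber fst i nF.
  have [||_ <-] := @nsum_reindex _ _ g (fun j : J => (i, j)) ng.
  - by move=> j j' [].
  - by move=> [i' j']; rewrite /g /=; case: eqP => [->|_]; [left; exists j'|right].
  - by apply: eq_nsum => j; rewrite /g /= eqxx.
rewrite (funext rowE); exact: nsum_regroup.
Qed.

(** Only finitely many rows have a bound that is not below [e], and each of them has finitely many
    entries that are not below [e]. *)
Lemma null_pair (I J : choiceType) (F : I -> J -> Qp) (c : I -> rat) :
  (forall e : rat, 0 < e -> exists A : {fset I}, forall i, i \notin A -> c i < e) ->
  (forall i j, N (F i j) <= c i) -> (forall i, null (F i)) ->
  null (fun u : I * J => F u.1 u.2).
Proof.
move=> nc hF nF e e0; have [A hA] := nc e e0.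
have [B hB] := choice (fun i => nF i e e0).
exists (A `*` \bigcup_(i <- A) B i)%fset => -[i j] /= h.
have [iA|iA] := boolP (i \in A); last exact: le_lt_trans (hF i j) (hA i iA).
apply: hB; apply: contra h => jB; rewrite in_fsetM iA /=.
by apply/bigfcupP; exists i; rewrite ?iA.
Qed.

Lemma mem_fset_iota (m k : nat) : (m \in [fset m | m in iota 0 k]%fset) = (m < k)%N.
Proof.
apply/imfsetP/idP => [[x hx ->]|mk]; first by have : x \in iota 0 k := hx; rewrite mem_iota.
by exists m => //; change (m \in iota 0 k); rewrite mem_iota.
Qed.

Lemma big_fset_iota (f : nat -> Qp) k :
  \sum_(m <- [fset m | m in iota 0 k]%fset) f m = \sum_(m < k) f m.
Proof.
rewrite big_imfset; last by [].
rewrite (perm_big (iota 0 k)).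
  by rewrite -(big_mkord xpredT f) /index_iota subn0.
by apply: uniq_perm; rewrite ?iota_uniq ?enum_finmem_uniq // => m; rewrite enum_finmemE.
Qed.

Definition conv (u v : nat -> Qp) n := \sum_(i < n.+1) u i * v (n - i)%N.

(** The product of the sums is a double sum by [nsum_fubini]; regrouping along the total index gives
    the Cauchy product. *)
Lemma nsum_conv (u v : nat -> Qp) (C : rat) : null u -> null v ->
  (forall i, N (v i) <= C) ->
  null (conv u v) /\ nsum (conv u v) = nsum u * nsum v.
Proof.
move=> nu nv hC; have C0 : 0 <= C := le_trans (padic_norm_ge0 _) (hC 0%N).
have nF : null (fun w : nat * nat => u w.1 * v w.2).
  apply: (@null_pair _ _ (fun i j => u i * v j) (fun i => N (u i) * C)) => [e e0|i j|i].
  - have C1 : 0 < C + 1 by rewrite ltr_wpDl.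
    have [A hA] := nu _ (divr_gt0 e0 C1); exists A => i /hA.
    rewrite ltr_pdivlMr //; apply: le_lt_trans.
    by rewrite ler_wpM2l ?padic_norm_ge0 // lerDl.
  - by rewrite padic_normM ler_wpM2l ?padic_norm_ge0.
  - exact: nullZ.
have [n1 e1] := nsum_fubini (F := fun i j => u i * v j) nF.
have [n2 e2] := nsum_regroup (fun w : nat * nat => (w.1 + w.2)%N) nF.
have E : (fun k => nsum (fun w : nat * nat => if (w.1 + w.2)%N == k then u w.1 * v w.2 else 0))
    = conv u v.
  apply/funext => n; rewrite /conv.
  pose A := [fset ((i, (n - i)%N) : (nat * nat)%type) | i in iota 0 n.+1]%fset.
  have [|_ ->] := @nsum_fin _ (fun w : nat * nat => if (w.1 + w.2)%N == n then u w.1 * v w.2 else 0) A.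
    move=> [i j] /= h; case: eqP => // ijn; case/negP: h.
    by apply/imfsetP; exists i => /=; [change (i \in iota 0 n.+1); rewrite mem_iota; lia|congr (_, _); lia].
  rewrite /A big_imfset; last by move=> i j _ _ [].
  rewrite (perm_big (iota 0 n.+1)); last first.
    apply: uniq_perm; rewrite ?iota_uniq //; first exact: enum_finmem_uniq.
    by move=> i; rewrite enum_finmemE.
  rewrite big_seq (eq_bigr (fun i => u i * v (n - i)%N)).
    by rewrite -big_seq -[iota 0 n.+1]/(index_iota 0 n.+1) big_mkord.
  by move=> i; rewrite mem_iota => hi /=; rewrite ifT //; apply/eqP; lia.
rewrite E in n2 e2; split=> //; rewrite e2 -e1.
have -> : (fun i => nsum (fun j => u i * v j)) = (fun i => nsum v * u i).
  by apply/funext => i; rewrite (nsumZ _ nv); exact: mulrC.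
by rewrite (nsumZ _ nu); exact: mulrC.
Qed.
End NullFamilies.

(** * Restricted power series *)

Section Tate.
Variables (p : nat) (p_pr : prime p).
Local Notation Qp := (padic p_pr).
Local Notation N := (@padic_norm p p_pr).

Definition unit_ball l (z : 'rV[Qp]_l) := forall i, N (z 0 i) <= 1.

Section OneDim.
Variable l : nat.
Local Notation E := 'rV[Qp]_l.
Local Notation K := {ffun 'I_l -> nat}.
Implicit Types (f g : E -> Qp) (z w : E) (k : K) (C : rat).

(* f is, on the closed unit ball, an element of the Tate algebra of Gauss norm at
   most C; the values of f off that ball are arbitrary. *)
Definition tate C f := exists a : K -> Qp,
  [/\ null a, forall k, N (a k) <= C &
      forall z, unit_ball z -> f z = nsum (fun k => a k * monomial k z)].

Lemma monomial_le1 k z : unit_ball z -> N (monomial k z) <= 1.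
Proof.
move=> hz; rewrite /monomial; elim/big_ind: _ => [|x y x1 y1|i _].
- by rewrite padic_norm1.
- by rewrite -[1]mulr1; exact: padic_normM_le.
- by rewrite padic_normX exprn_ile1 ?padic_norm_ge0.
Qed.

Lemma null_mul (I : choiceType) (c m : I -> Qp) :
  null c -> (forall i, N (m i) <= 1) -> null (fun i => c i * m i).
Proof.
move=> nc hm; apply: null_dom nc _ => i.
by rewrite padic_normM ler_piMr ?padic_norm_ge0.
Qed.

Lemma tate_ge0 C f : tate C f -> 0 <= C.
Proof. by move=> [a [_ h _]]; apply: le_trans (padic_norm_ge0 _) (h [ffun=> 0%N]). Qed.

Lemma tate_le C C' f : C <= C' -> tate C f -> tate C' f.
Proof. by move=> CC [a [na ha fa]]; exists a; split=> // k; exact: le_trans (ha k) CC. Qed.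

Lemma eq_tate C f g : (forall z, unit_ball z -> f z = g z) -> tate C f -> tate C g.
Proof. by move=> fg [a [na ha fa]]; exists a; split=> // z hz; rewrite -fg // fa. Qed.

Lemma tate_bound C f z : tate C f -> unit_ball z -> N (f z) <= C.
Proof.
move=> tf; have C0 := tate_ge0 tf; have [a [na ha fa]] := tf.
move=> hz; rewrite fa //; apply: nsum_norm_le => // [|k].
  by apply: null_mul => // k; exact: monomial_le1.
by rewrite padic_normM -[C]mulr1; apply: ler_pM; rewrite ?padic_norm_ge0 ?monomial_le1.
Qed.

(** Exponents may repeat: regrouping along [d] collects equal monomials and, the norm being
    ultrametric, does not raise the bound. Products and infinite sums of series can thus keep their
    natural index sets. *)
Lemma tate_family (I : choiceType) (c : I -> Qp) (d : I -> K) C f :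
  0 <= C -> null c -> (forall i, N (c i) <= C) ->
  (forall z, unit_ball z -> f z = nsum (fun i => c i * monomial (d i) z)) -> tate C f.
Proof.
move=> C0 nc hc hf.
exists (fun k => nsum (fun i => if d i == k then c i else 0)); split.
- by have [] := nsum_regroup d nc.
- move=> k; apply: nsum_norm_le => // [|i]; first exact: null_fiber.
  by case: ifP => // _; rewrite padic_norm0.
move=> z hz; rewrite hf //.
have nm : null (fun i => c i * monomial (d i) z).
  by apply: null_mul => // i; exact: monomial_le1.
have [_ <-] := nsum_regroup d nm; apply: eq_nsum => k.
rewrite mulrC -nsumZ; last exact: null_fiber.
by apply: eq_nsum => i; case: eqP => [->|_]; rewrite ?mulr0 // mulrC.
Qed.

Lemma monomial0 z : monomial [ffun=> 0%N] z = 1.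
Proof. by rewrite /monomial big1 // => i _; rewrite ffunE expr0. Qed.

Lemma monomial_coord i z : monomial [ffun j => (j == i) : nat] z = z 0 i.
Proof.
rewrite /monomial (bigD1 i) //= ffunE eqxx expr1 big1 ?mulr1 // => j ji.
by rewrite ffunE (negbTE ji) expr0.
Qed.

Lemma monomialD k k' z :
  monomial [ffun i => k i + k' i]%N z = monomial k z * monomial k' z.
Proof. by rewrite /monomial -big_split; apply: eq_bigr => i _; rewrite ffunE exprD. Qed.

Lemma tate_one_term (c : Qp) k : tate (N c) (fun z => c * monomial k z).
Proof.
have h (g : unit -> Qp) : null g /\ nsum g = g tt.
  by have := @nsum_fin _ _ _ g [fset tt]%fset; rewrite big_seq_fset1; apply=> -[]; rewrite inE.
apply: (@tate_family unit (fun=> c) (fun=> k)) => //; first exact: padic_norm_ge0.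
  exact: (h _).1.
by move=> z _; rewrite (h _).2.
Qed.

Lemma tate_cst (c : Qp) : tate (N c) (fun=> c).
Proof.
by apply: eq_tate (tate_one_term c [ffun=> 0%N]) => z _; rewrite monomial0 mulr1.
Qed.

Lemma tate_coord i : tate 1 (fun z => z 0 i).
Proof.
rewrite -(padic_norm1 p_pr).
apply: eq_tate (tate_one_term 1 [ffun j => (j == i) : nat]) => z _.
by rewrite monomial_coord mul1r.
Qed.

Lemma tate_nsum (J : choiceType) (F : J -> E -> Qp) (c : J -> rat) C : 0 <= C ->
  (forall j, tate (c j) (F j)) -> (forall j, c j <= C) ->
  (forall e : rat, 0 < e -> exists A : {fset J}, forall j, j \notin A -> c j < e) ->
  tate C (fun z => nsum (fun j => F j z)).
Proof.
move=> C0 /choice[a ha] cC c0.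
have na : null (fun u : J * K => a u.1 u.2).
  by apply: (@null_pair _ _ _ _ a c) => // j; [have [_ + _] := ha j|have [] := ha j].
apply: (@tate_family _ (fun u => a u.1 u.2) snd) => // [u|z hz].
  by have [_ h _] := ha u.1; apply: le_trans (h _) (cC _).
have nam : null (fun u : J * K => a u.1 u.2 * monomial u.2 z).
  by apply: null_mul => // u; exact: monomial_le1.
have [_ <-] := nsum_fubini (F := fun j k => a j k * monomial k z) nam.
by apply: eq_nsum => j; have [_ _ ->] := ha j.
Qed.

Lemma null_tate_nsum (J : choiceType) (F : J -> E -> Qp) (c : J -> rat) z :
  (forall j, tate (c j) (F j)) ->
  (forall e : rat, 0 < e -> exists A : {fset J}, forall j, j \notin A -> c j < e) ->
  unit_ball z -> null (fun j => F j z).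
Proof.
move=> hF c0 hz e /c0[A hA]; exists A => j /hA; apply: le_lt_trans.
exact: tate_bound (hF j) hz.
Qed.

Lemma tateD C f g : tate C f -> tate C g -> tate C (fun z => f z + g z).
Proof.
move=> [a [na ha fa]] [b [nb hb gb]]; exists (fun k => a k + b k); split.
- exact: nullD.
- by move=> k; exact: padic_normD.
move=> z hz; rewrite fa // gb // -nsumD; first last.
- by apply: null_mul => // k; exact: monomial_le1.
- by apply: null_mul => // k; exact: monomial_le1.
by apply: eq_nsum => k; rewrite mulrDl.
Qed.

Lemma tateM C C' f g : tate C f -> tate C' g -> tate (C * C') (fun z => f z * g z).
Proof.
move=> tf tg; have C0 := tate_ge0 tf; have C'0 := tate_ge0 tg.
move: tf tg => [a [na ha fa]] [b [nb hb gb]].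
have nab : null (fun u : K * K => a u.1 * b u.2).
  apply: (@null_pair _ _ _ _ (fun i j => a i * b j) (fun i => N (a i) * C')) => [e e0|i j|i].
  - have C1 : 0 < C' + 1 by rewrite ltr_wpDl.
    have [A hA] := na _ (divr_gt0 e0 C1); exists A => i /hA.
    rewrite ltr_pdivlMr //; apply: le_lt_trans.
    by rewrite ler_wpM2l ?padic_norm_ge0 // lerDl.
  - by rewrite padic_normM ler_wpM2l ?padic_norm_ge0.
  - exact: nullZ.
apply: (@tate_family _ _ (fun u : K * K => [ffun i => u.1 i + u.2 i]%N) _ _ _ nab).
- exact: mulr_ge0.
- by move=> u; exact: padic_normM_le.
move=> z hz.
have nam : null (fun u : K * K => a u.1 * monomial u.1 z * (b u.2 * monomial u.2 z)).
  apply: null_dom nab _ => u; rewrite !padic_normM ler_pM ?mulr_ge0 ?padic_norm_ge0 //.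
    by rewrite ler_piMr ?padic_norm_ge0 // monomial_le1.
  by rewrite ler_piMr ?padic_norm_ge0 // monomial_le1.
transitivity (nsum (fun u : K * K => a u.1 * monomial u.1 z * (b u.2 * monomial u.2 z))).
  have [_ <-] := nsum_fubini (F := fun i j => a i * monomial i z * (b j * monomial j z)) nam.
  rewrite fa // gb // mulrC -nsumZ; last by apply: null_mul => // k; exact: monomial_le1.
  apply: eq_nsum => k; rewrite mulrC -nsumZ //.
  by apply: null_mul => // k'; exact: monomial_le1.
by apply: eq_nsum => u; rewrite monomialD mulrACA.
Qed.

Lemma tateZ C (c : Qp) f : tate C f -> tate (N c * C) (fun z => c * f z).
Proof. by move=> tf; apply: tateM => //; exact: tate_cst. Qed.

Lemma tateN C f : tate C f -> tate C (fun z => - f z).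
Proof.
move/(tateZ (-1)); rewrite padic_normN padic_norm1 mul1r.
by apply: eq_tate => z _; rewrite mulN1r.
Qed.

Lemma tateB C f g : tate C f -> tate C g -> tate C (fun z => f z - g z).
Proof. by move=> tf tg; apply: tateD => //; exact: tateN. Qed.

Lemma tate0 C : 0 <= C -> tate C (fun=> 0).
Proof. by move=> C0; apply: tate_le (tate_cst 0); rewrite padic_norm0. Qed.

Lemma tate_sum C (I : Type) (r : seq I) (P : pred I) (F : I -> E -> Qp) : 0 <= C ->
  (forall i, P i -> tate C (F i)) -> tate C (fun z => \sum_(i <- r | P i) F i z).
Proof.
move=> C0 hF; elim: r => [|i r ih].
  by apply: eq_tate (tate0 C0) => z _; rewrite big_nil.
have [Pi|Pi] := boolP (P i).
  by apply: eq_tate (tateD (hF i Pi) ih) => z _; rewrite big_cons Pi.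
by apply: eq_tate ih => z _; rewrite big_cons (negbTE Pi).
Qed.

Lemma tateM1 C f g : tate C f -> tate 1 g -> tate C (fun z => f z * g z).
Proof. by move=> tf tg; rewrite -[C]mulr1; exact: tateM. Qed.

Lemma tate1M C f g : tate 1 f -> tate C g -> tate C (fun z => f z * g z).
Proof. by move=> tf tg; rewrite -[C]mul1r; exact: tateM. Qed.

Lemma tateX n f : tate 1 f -> tate 1 (fun z => f z ^+ n).
Proof.
move=> tf; elim: n => [|n ih]; first by have := tate_cst 1; rewrite padic_norm1.
by apply: eq_tate (tateM1 tf ih) => z _; rewrite exprS.
Qed.

End OneDim.

(** * Composition of restricted power series *)

Section Composition.
Variables l l' : nat.
Implicit Types (g : 'rV[Qp]_l -> 'rV[Qp]_l') (h : 'rV[Qp]_l' -> Qp).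

Definition tate_map g := forall i, tate 1 (fun z => g z 0 i).

Lemma tate_map_ball g z : tate_map g -> unit_ball z -> unit_ball (g z).
Proof. by move=> tg hz i; exact: tate_bound (tg i) hz. Qed.

(** The difference telescopes one factor at a time and the other factors have Gauss norm at most 1,
    so the constant does not depend on the exponents. *)
Lemma tate_monomial_diff (I : Type) (r : seq I) (F G : I -> 'rV[Qp]_l -> Qp) (k : I -> nat) (C : rat) :
  0 <= C -> (forall i, tate 1 (F i)) -> (forall i, tate 1 (G i)) ->
  (forall i, tate C (fun z => F i z - G i z)) ->
  [/\ tate 1 (fun z => \prod_(i <- r) F i z ^+ k i),
      tate 1 (fun z => \prod_(i <- r) G i z ^+ k i) &
      tate C (fun z => \prod_(i <- r) F i z ^+ k i - \prod_(i <- r) G i z ^+ k i)].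
Proof.
move=> C0 hF hG hFG.
have hX i n : tate C (fun z => F i z ^+ n - G i z ^+ n).
  elim: n => [|n ih]; first by apply: eq_tate (tate0 _ C0) => z _; rewrite subrr.
  apply: eq_tate (tateD (tateM1 (hFG i) (tateX n (hF i))) (tate1M (hG i) ih)) => z _.
  by rewrite !exprS; ring.
have one : tate 1 (fun _ : 'rV[Qp]_l => 1 : Qp).
  by have := @tate_cst l 1; rewrite padic_norm1.
elim: r => [|i r [ih1 ih2 ih3]]; split.
- by apply: eq_tate one => z _; rewrite big_nil.
- by apply: eq_tate one => z _; rewrite big_nil.
- by apply: eq_tate (tate0 _ C0) => z _; rewrite !big_nil subrr.
- by apply: eq_tate (tateM1 (tateX (k i) (hF i)) ih1) => z _; rewrite big_cons.
- by apply: eq_tate (tateM1 (tateX (k i) (hG i)) ih2) => z _; rewrite big_cons.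
- apply: eq_tate (tateD (tateM1 (hX i (k i)) ih1) (tate1M (tateX (k i) (hG i)) ih3)) => z _.
  by rewrite !big_cons; ring.
Qed.

Lemma tate_comp (C : rat) h g : tate C h -> tate_map g -> tate C (h \o g).
Proof.
move=> th tg; have C0 := tate_ge0 th; have [a [na ha hE]] := th.
have tm k : tate 1 (fun z => monomial k (g z)).
  have h0 i : tate 0 (fun z => g z 0 i - g z 0 i).
    by apply: eq_tate (tate0 _ (lexx 0)) => z _; rewrite subrr.
  by have [] := tate_monomial_diff (index_enum 'I_l') k (lexx 0) tg tg h0.
have ta k : tate (N (a k)) (fun z => a k * monomial k (g z)).
  exact: tateM1 (tate_cst _ _) (tm k).
apply: eq_tate (tate_nsum C0 ta ha na) => z hz.
by rewrite /= hE //; exact: tate_map_ball.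
Qed.

(** A Lipschitz estimate for Gauss norms, obtained monomial by monomial. It gives both the
    contraction in the inversion of maps and the gain from shrinking a ball. *)
Lemma tate_comp_lip (C D : rat) h g g' : tate C h -> tate_map g -> tate_map g' ->
  0 <= D -> (forall i, tate D (fun z => g z 0 i - g' z 0 i)) ->
  tate (C * D) (fun z => h (g z) - h (g' z)).
Proof.
move=> th tg tg' D0 tgg; have C0 := tate_ge0 th; have [a [na ha hE]] := th.
have tm k : tate D (fun z => monomial k (g z) - monomial k (g' z)).
  by have [] := tate_monomial_diff (index_enum 'I_l') k D0 tg tg' tgg.
have ta k : tate (N (a k) * D) (fun z => a k * (monomial k (g z) - monomial k (g' z))).
  exact: tateM (tate_cst _ _) (tm k).
have aD k : N (a k) * D <= C * D by rewrite ler_wpM2r.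
have nD e : 0 < e -> exists A : {fset {ffun 'I_l' -> nat}}, forall k, k \notin A -> N (a k) * D < e.
  move=> e0; have D1 : 0 < D + 1 by rewrite ltr_wpDl.
  have [A hA] := na _ (divr_gt0 e0 D1); exists A => k /hA.
  rewrite ltr_pdivlMr //; apply: le_lt_trans.
  by rewrite ler_wpM2l ?padic_norm_ge0 // lerDl.
apply: eq_tate (tate_nsum (mulr_ge0 C0 D0) ta aD nD) => z hz.
have hg := tate_map_ball tg hz; have hg' := tate_map_ball tg' hz.
have nu : null (fun k => a k * monomial k (g z)).
  by apply: null_mul => // k; exact: monomial_le1.
have nv : null (fun k => a k * monomial k (g' z)).
  by apply: null_mul => // k; exact: monomial_le1.
rewrite !hE // -[X in _ = _ + X]mulN1r -(nsumZ _ nv) -(nsumD nu (nullZ _ nv)).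
by apply: eq_nsum => k; ring.
Qed.

End Composition.
End Tate.

(** * Partial derivatives *)

Section Derivatives.
Variables (p : nat) (p_pr : prime p).
Local Notation Qp := (padic p_pr).
Local Notation N := (@padic_norm p p_pr).

Definition pd l (i : 'I_l) (f : 'rV[Qp]_l -> Qp) : 'rV[Qp]_l -> Qp :=
  fun z => dirderiv f z (delta_mx 0 i).

Lemma padic_dnbhs_proper : ProperFilter ((0 : Qp)^').
Proof.
apply: Build_ProperFilter_ex => A /nbhs_ballP[e /= e0 hA].
have [n hn] := padic_pX_small p_pr e0.
exists (p%:R ^+ n); apply: hA; last by rewrite expf_neq0 // padic_p_neq0.
by rewrite padic_ballE sub0r padic_normN hn.
Qed.

(* A quadratic bound on the remainder holds for analytic functions, and is
   stable under composition without any epsilon management. *)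
Definition taylor1 l (f : 'rV[Qp]_l -> Qp) (x : 'rV[Qp]_l) (L : 'I_l -> Qp) :=
  exists C d : rat, [/\ 0 <= C, 0 < d & forall (w : 'rV[Qp]_l) (rho : rat),
    rho < d -> (forall i, N (w 0 i) <= rho) ->
    N (f (x + w) - f x - \sum_i w 0 i * L i) <= C * rho ^+ 2].

Section Taylor.
Variable l : nat.
Local Notation E := 'rV[Qp]_l.
Local Notation K := {ffun 'I_l -> nat}.
Implicit Types (f g : E -> Qp) (x z w v : E) (k : K) (L : 'I_l -> Qp).

(** Divided by [h], the quadratic remainder at [h *: v] is still of order [N h], so the difference
    quotient converges. *)
Lemma taylor1_dirderiv f x L v : taylor1 f x L -> dirderiv f x v = \sum_i v 0 i * L i.
Proof.
move=> [C [d [C0 d0 hf]]]; have FF := padic_dnbhs_proper; apply: (cvg_lim (@padic_hausdorff p p_pr)).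
have [V [V0 hV]] : exists V : rat, 0 < V /\ forall i, N (v 0 i) <= V.
  exists (1 + \sum_i N (v 0 i)); split=> [|i].
    by rewrite ltr_pwDl // sumr_ge0 // => i _; exact: padic_norm_ge0.
  rewrite (bigD1 i) //= addrCA lerDl addr_ge0 // sumr_ge0 // => j _.
  exact: padic_norm_ge0.
apply/cvg_ballP => e e0.
(* The first bound keeps [h *: v] where the remainder is controlled, the second makes the remainder
   divided by [h] less than [e]; the added 1 covers [C = 0]. *)
pose r := Num.min (d / V) (e / (C * V ^+ 2 + 1)).
have C1 : 0 < C * V ^+ 2 + 1 by rewrite ltr_wpDl // mulr_ge0 // exprn_ge0 // ltW.
have r0 : 0 < r by rewrite lt_min !divr_gt0.
suff main (h : Qp) : N h < r -> h != 0 ->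
    N (h^-1 * (f (x + h *: v) - f x) - \sum_i v 0 i * L i) < e.
  apply/nbhs_ballP; exists r => //= h; rewrite padic_ballE sub0r padic_normN => hr h0.
  by rewrite padic_ballE padic_normC; exact: main.
move=> hr h0; have nh := padic_norm_gt0 h0.
have := hf (h *: v) (N h * V).
have -> : \sum_i (h *: v) 0 i * L i = h * \sum_i v 0 i * L i.
  by rewrite mulr_sumr; apply: eq_bigr => i _; rewrite mxE mulrA.
set S := \sum_i v 0 i * L i; set D := f (x + h *: v) - f x => hD.
have -> : h^-1 * D - S = h^-1 * (D - h * S) by rewrite [RHS]mulrBr mulrA mulVf // mul1r.
rewrite padic_normM padic_normV mulrC ltr_pdivrMr //.
move: hr; rewrite lt_min => /andP[hr1 hr2].
apply: (le_lt_trans (hD _ _)).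
- by rewrite -ltr_pdivlMr.
- by move=> i; rewrite mxE padic_normM ler_wpM2l ?padic_norm_ge0.
rewrite exprMn mulrCA expr2 -mulrA mulrC ltr_pM2r //.
move: hr2; rewrite ltr_pdivlMr //; apply: le_lt_trans.
by rewrite ler_wpM2l ?padic_norm_ge0 // lerDl.
Qed.

Lemma taylor1_pd f x L i : taylor1 f x L -> pd i f x = L i.
Proof.
move=> /taylor1_dirderiv hf; rewrite /pd hf (bigD1 i) //= mxE !eqxx mul1r.
by rewrite big1 ?addr0 // => j ji; rewrite mxE (negbTE ji) andbF mul0r.
Qed.

(** The subtraction is truncated: an exponent 0 stays 0, harmlessly, since the derivative then
    carries the integer factor 0. *)
Definition mdec i k : K := [ffun j => k j - (j == i)]%N.

Definition dmonomial i k z : Qp := (k i)%:R * monomial (mdec i k) z.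

Lemma monomial_mdec i k z : (0 < k i)%N -> monomial k z = z 0 i * monomial (mdec i k) z.
Proof.
move=> ki; rewrite -(monomial_coord i z) -monomialD; congr monomial.
by apply/ffunP => j; rewrite !ffunE; have [->|_] /= := eqVneq j i; lia.
Qed.

Lemma mdecC i j k : mdec i (mdec j k) = mdec j (mdec i k).
Proof. by apply/ffunP => a; rewrite !ffunE subnAC. Qed.

(** Leibniz rule for the variable [i] times the lowered monomial; it is the inductive step of
    [monomial_taylor]. *)
Lemma dmonomial_mdec i j k z : (0 < k i)%N ->
  dmonomial j k z = (j == i)%:R * monomial (mdec i k) z + z 0 i * dmonomial j (mdec i k) z.
Proof.
move=> ki; rewrite /dmonomial ffunE; have [->|ji] := eqVneq j i.
  case E : (k i) ki => [//|n] _; rewrite subn1 /= mul1r mulrCA.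
  case: n E => [|n] E; first by rewrite mul0r addr0 mul1r.
  rewrite -(@monomial_mdec i (mdec i k)) ?ffunE ?E ?eqxx //.
  by rewrite -(natr1 n.+1) addrC mulrDl mul1r.
rewrite mul0r add0r subn0 mulrCA mdecC -monomial_mdec //.
by rewrite ffunE eq_sym (negbTE ji) subn0.
Qed.

Lemma dmonomial_le1 i k z : unit_ball z -> N (dmonomial i k z) <= 1.
Proof.
move=> hz; rewrite -[1]mulr1; apply: padic_normM_le (padic_norm_nat_le1 _ _) _.
exact: monomial_le1.
Qed.

Lemma unit_ballD z w : unit_ball z -> unit_ball w -> unit_ball (z + w).
Proof. by move=> hz hw i; rewrite mxE; apply: padic_normD. Qed.

(** Induction on the total degree, splitting off one variable at a time. Only integers occur as
    coefficients, so the constant is 1 for every exponent. *)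
Lemma monomial_taylor k z w (rho : rat) : unit_ball z -> rho <= 1 ->
  (forall i, N (w 0 i) <= rho) ->
  N (monomial k (z + w) - monomial k z - \sum_i w 0 i * dmonomial i k z) <= rho ^+ 2.
Proof.
move=> hz rho1 hw.
have hw1 : unit_ball w by move=> i; apply: le_trans (hw i) rho1.
move: {2}(\sum_i k i)%N (leqnn (\sum_i k i)%N) => n.
elim: n k => [|n ih] k.
  rewrite leqn0 sum_nat_eq0 => /forallP k0.
  have {}k0 : k = [ffun=> 0%N] by apply/ffunP => i; rewrite ffunE; apply/eqP/k0.
  rewrite k0 !monomial0 subrr sub0r padic_normN big1 ?padic_norm0 ?sqr_ge0 // => i _.
  by rewrite /dmonomial ffunE mul0r mulr0.
have [/existsP[i ki] hk|/existsPn k0 _] := boolP [exists i, (0 < k i)%N]; last first.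
  by apply: ih; rewrite big1 // => i _; apply/eqP; rewrite -leqn0 leqNgt k0.
rewrite (@monomial_mdec i k (z + w)) // (@monomial_mdec i k z) // mxE.
have -> : \sum_j w 0 j * dmonomial j k z =
    w 0 i * monomial (mdec i k) z + z 0 i * \sum_j w 0 j * dmonomial j (mdec i k) z.
  under eq_bigr do rewrite (dmonomial_mdec _ _ ki) mulrDr.
  rewrite big_split /=; congr (_ + _); last by rewrite mulr_sumr; apply: eq_bigr => j _; ring.
  rewrite (bigD1 i) //= eqxx mul1r big1 ?addr0 // => j /negbTE ->.
  by rewrite mul0r mulr0.
have hm : (\sum_j mdec i k j <= n)%N.
  rewrite -ltnS; apply: leq_trans hk; rewrite (bigD1 i) //= [ltnRHS](bigD1 i) //=.
  rewrite ffunE eqxx -addSn leq_add //; first by lia.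
  by apply: leq_sum => j _; rewrite ffunE leq_subr.
have rho0 : 0 <= rho := le_trans (padic_norm_ge0 _) (hw i).
set M := monomial (mdec i k) _; set M' := monomial (mdec i k) z.
set S := \sum_j _.
have -> : (z 0 i + w 0 i) * M - z 0 i * M' - (w 0 i * M' + z 0 i * S) =
    (z 0 i + w 0 i) * (M - M' - S) + w 0 i * S by ring.
apply: padic_normD.
  rewrite -[rho ^+ 2]mul1r; apply: padic_normM_le; last exact: ih.
  exact: padic_normD.
rewrite expr2; apply: padic_normM_le => //; apply: padic_norm_sum => // j _.
by rewrite -[rho]mulr1; apply: padic_normM_le => //; exact: dmonomial_le1.
Qed.

Lemma nsum_sum (I : choiceType) (J : Type) (r : seq J) (F : J -> I -> Qp) :
  (forall j, null (F j)) ->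
  null (fun i => \sum_(j <- r) F j i) /\
  nsum (fun i => \sum_(j <- r) F j i) = \sum_(j <- r) nsum (F j).
Proof.
move=> hF; elim: r => [|j r [ih1 ih2]].
  split; last by rewrite big_nil; apply: nsum0 => i; rewrite big_nil.
  by apply: (@nsum_fin _ _ _ _ fset0 _).1 => i _; rewrite big_nil.
have -> : (fun i => \sum_(j <- j :: r) F j i) = (fun i => F j i + \sum_(j <- r) F j i).
  by apply/funext => i; rewrite big_cons.
by rewrite big_cons -ih2 nsumD //; split=> //; exact: nullD.
Qed.

(** In an ultrametric sum the remainders of the terms combine with their supremum as constant; this
    is what allows differentiation under the sum. *)
Lemma nsum_taylor (I : choiceType) (F : I -> E -> Qp) (dF : 'I_l -> I -> Qp) (C : I -> rat)
    (B : rat) f z :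
  0 <= B -> (forall x, unit_ball x -> null (fun i => F i x)) ->
  (forall j, null (dF j)) ->
  (forall i, C i <= B) -> unit_ball z ->
  (forall i w (rho : rat), rho <= 1 -> (forall j, N (w 0 j) <= rho) ->
    N (F i (z + w) - F i z - \sum_j w 0 j * dF j i) <= C i * rho ^+ 2) ->
  (forall x, unit_ball x -> f x = nsum (fun i => F i x)) ->
  forall w (rho : rat), rho <= 1 -> (forall j, N (w 0 j) <= rho) ->
    N (f (z + w) - f z - \sum_j w 0 j * nsum (dF j)) <= B * rho ^+ 2.
Proof.
move=> B0 nF ndF CB hz hF hf w rho rho1 hw.
have hw1 : unit_ball w by move=> i; apply: le_trans (hw i) rho1.
have hzw := unit_ballD hz hw1.
have [n1 e1] := @nsum_sum I 'I_l (index_enum 'I_l) (fun j i => w 0 j * dF j i)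
  (fun j => nullZ _ (ndF j)).
have -> : \sum_j w 0 j * nsum (dF j) = nsum (fun i => \sum_j w 0 j * dF j i).
  by rewrite e1; apply: eq_bigr => j _; rewrite nsumZ.
have n2 := nullZ (-1) (nF _ hz); have n3 := nullZ (-1) n1.
rewrite !hf // -[X in _ + X - _]mulN1r -[X in _ - X]mul1r -mulNr.
rewrite -(nsumZ _ (nF _ hz)) -(nsumZ _ n1) -nsumD; [|exact: nF|by []].
rewrite -nsumD; [|by apply: nullD; [exact: nF|]|by []].
apply: nsum_norm_le => [||i]; [|by rewrite mulr_ge0 ?sqr_ge0|].
  by apply: nullD => //; apply: nullD => //; exact: nF.
rewrite !mulN1r; apply: le_trans (hF i _ _ rho1 hw) _.
by rewrite ler_wpM2r ?sqr_ge0.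
Qed.

Lemma taylor1I f z L C : 0 <= C ->
  (forall w (rho : rat), rho <= 1 -> (forall j, N (w 0 j) <= rho) ->
    N (f (z + w) - f z - \sum_j w 0 j * L j) <= C * rho ^+ 2) -> taylor1 f z L.
Proof. by move=> C0 h; exists C, 1; split=> // w rho /ltW rho1; exact: h. Qed.

(* All iterated partial derivatives of a series sum_k a_k z^k have the form
   sum_i c_i z^(d i); keeping the original index set I makes their symmetry
   an identity between monomials. *)
Lemma family_pd (I : choiceType) (c : I -> Qp) (d : I -> K) C f : 0 <= C -> null c ->
  (forall i, N (c i) <= C) ->
  (forall z, unit_ball z -> f z = nsum (fun i => c i * monomial (d i) z)) ->
  (forall z w (rho : rat), unit_ball z -> rho <= 1 -> (forall j, N (w 0 j) <= rho) ->
    N (f (z + w) - f z - \sum_j w 0 j * pd j f z) <= C * rho ^+ 2) /\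
  (forall j z, unit_ball z ->
     pd j f z = nsum (fun i => (c i * (d i j)%:R) * monomial (mdec j (d i)) z)).
Proof.
move=> C0 nc hc hf.
have T z : unit_ball z -> forall w (rho : rat), rho <= 1 -> (forall j, N (w 0 j) <= rho) ->
    N (f (z + w) - f z -
      \sum_j w 0 j * nsum (fun i => (c i * (d i j)%:R) * monomial (mdec j (d i)) z))
    <= C * rho ^+ 2.
  move=> hz.
  apply: (@nsum_taylor I (fun i x => c i * monomial (d i) x)
     (fun j i => (c i * (d i j)%:R) * monomial (mdec j (d i)) z) (fun i => N (c i))) => //.
  - by move=> x hx; apply: null_mul => // i; exact: monomial_le1.
  - move=> j; apply: null_mul; last by move=> i; exact: monomial_le1.
    by apply: null_mul => // i; exact: padic_norm_nat_le1.
  move=> i w rho rho1 hw; set S := \sum_j _.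
  have -> : S = c i * \sum_j w 0 j * dmonomial j (d i) z.
    by rewrite mulr_sumr; apply: eq_bigr => j _; rewrite /dmonomial; ring.
  rewrite -!mulrBr padic_normM ler_wpM2l ?padic_norm_ge0 //.
  exact: monomial_taylor.
have P j z (hz : unit_ball z) := taylor1_pd j (taylor1I C0 (T z hz)).
split=> // z w rho hz rho1 hw; under eq_bigr do rewrite P //.
exact: T.
Qed.

Lemma tate_taylor C f z w (rho : rat) : tate C f -> unit_ball z -> rho <= 1 ->
  (forall j, N (w 0 j) <= rho) ->
  N (f (z + w) - f z - \sum_j w 0 j * pd j f z) <= C * rho ^+ 2.
Proof.
move=> tf; have C0 := tate_ge0 tf; have [a [na ha fa]] := tf.
by have [+ _] := @family_pd _ a id C f C0 na ha fa; apply.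
Qed.

Lemma tate_taylor1 C f z : tate C f -> unit_ball z -> taylor1 f z (fun i => pd i f z).
Proof.
move=> tf hz; apply: taylor1I (tate_ge0 tf) _ => w rho rho1 hw.
exact: (tate_taylor tf).
Qed.

(** The new coefficients are integer multiples of the old ones, so neither the ball nor the bound
    gets worse. *)
Lemma tate_pd C f i : tate C f -> tate C (pd i f).
Proof.
move=> tf; have C0 := tate_ge0 tf; have [a [na ha fa]] := tf.
have [_ h] := @family_pd _ a id C f C0 na ha fa.
apply: (tate_family C0 _ _ (h i)); first by apply: null_mul => // k; exact: padic_norm_nat_le1.
move=> k; rewrite -[C]mulr1; apply: padic_normM_le => //; exact: padic_norm_nat_le1.
Qed.

Lemma pdC C f i j z : tate C f -> unit_ball z -> pd i (pd j f) z = pd j (pd i f) z.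
Proof.
move=> tf hz; have C0 := tate_ge0 tf; have [a [na ha fa]] := tf.
have [_ h] := @family_pd _ a id C f C0 na ha fa.
have H s t : pd s (pd t f) z = nsum (fun k : K =>
    (a k * (k t)%:R * (mdec t k s)%:R) * monomial (mdec s (mdec t k)) z).
  have [|k|_ ->] // := @family_pd _ (fun k => a k * (k t)%:R) (mdec t) C _ C0 _ _ (h t).
  - by apply: null_mul => // k; exact: padic_norm_nat_le1.
  - by rewrite -[C]mulr1; apply: padic_normM_le => //; exact: padic_norm_nat_le1.
rewrite !H; apply: eq_nsum => k; rewrite mdecC; congr (_ * _); rewrite -!mulrA; congr (_ * _).
(* For distinct indices, lowering one exponent leaves the other unchanged, and the integer factors
   commute. *)
rewrite -!natrM !ffunE; congr _%:R; have [->//|ij] := eqVneq i j.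
by rewrite !subn0 mulnC.
Qed.

Lemma eq_taylor1 f g x L : (exists2 d : rat, 0 < d & forall w, (forall i, N (w 0 i) < d) ->
  f (x + w) = g (x + w)) -> taylor1 f x L -> taylor1 g x L.
Proof.
move=> [d' d'0 fg] [C [d [C0 d0 hf]]]; exists C, (Num.min d d'); split=> //.
  by rewrite lt_min d0.
move=> w rho; rewrite lt_min => /andP[r1 r2] hw.
rewrite -fg => [|i]; last exact: le_lt_trans (hw i) r2.
have := fg 0; rewrite addr0 => <- => [|i]; last by rewrite mxE padic_norm0.
exact: hf.
Qed.

Lemma eq_unit_taylor1 f g z : (forall z, unit_ball z -> f z = g z) -> unit_ball z ->
  (forall L, taylor1 f z L -> taylor1 g z L).
Proof.
move=> fg hz L; apply: eq_taylor1; exists 1 => // w hw; apply: fg.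
by apply: unit_ballD => // j; exact: ltW.
Qed.

(** The closed unit ball is also open, so equality on it determines the derivatives at all its
    points, those of norm 1 included. *)
Lemma eq_pd C f g i z : tate C f -> (forall z, unit_ball z -> f z = g z) -> unit_ball z ->
  pd i g z = pd i f z.
Proof.
by move=> tf fg hz; have /(eq_unit_taylor1 fg hz)/taylor1_pd := tate_taylor1 tf hz.
Qed.

Lemma pd_nsum (J : choiceType) (F : J -> E -> Qp) (c : J -> rat) C i z : 0 <= C ->
  (forall j, tate (c j) (F j)) -> (forall j, c j <= C) ->
  (forall e : rat, 0 < e -> exists A : {fset J}, forall j, j \notin A -> c j < e) ->
  unit_ball z ->
  pd i (fun z => nsum (fun j => F j z)) z = nsum (fun j => pd i (F j) z).
Proof.
move=> C0 hF cC c0 hz.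
suff T : taylor1 (fun z => nsum (F^~ z)) z (fun i => nsum (fun j => pd i (F j) z)).
  exact: taylor1_pd i T.
apply: (taylor1I C0) => w rho rho1 hw.
have h := @nsum_taylor J F (fun i j => pd i (F j) z) c C (fun z => nsum (F^~ z)) z C0.
apply: h => //.
- by move=> x hx; apply: (null_tate_nsum hF).
- by move=> a; apply: (null_tate_nsum (fun j => tate_pd a (hF j))).
- by move=> j w' rho' rho'1 hw'; apply: (tate_taylor (hF j)).
Qed.

Lemma taylor1_ext f x L L' : L =1 L' -> taylor1 f x L -> taylor1 f x L'.
Proof. by move=> /funext ->. Qed.

Lemma taylor1_cst (c : Qp) x : taylor1 (fun=> c) x (fun=> 0).
Proof.
apply: (@taylor1I _ _ _ 0) => // w rho _ _; rewrite subrr sub0r padic_normN mul0r.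
by rewrite big1 ?padic_norm0 // => i _; rewrite mulr0.
Qed.

Lemma taylor1_coord i x : taylor1 (fun z => z 0 i) x (fun j => (j == i)%:R).
Proof.
apply: (@taylor1I _ _ _ 0) => // w rho _ _; rewrite mul0r (bigD1 i) //= eqxx mulr1.
rewrite big1 => [|j /negbTE ->]; last by rewrite mulr0.
by rewrite mxE addr0 addrAC addrK subrr padic_norm0.
Qed.

Lemma taylor1D f g x L L' : taylor1 f x L -> taylor1 g x L' ->
  taylor1 (fun z => f z + g z) x (fun i => L i + L' i).
Proof.
move=> [C [d [C0 d0 hf]]] [C' [d' [C'0 d'0 hg]]].
exists (Num.max C C'), (Num.min d d'); split; rewrite ?le_max ?C0 ?lt_min ?d0 //.
move=> w rho; rewrite lt_min => /andP[r1 r2] hw.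
under eq_bigr do rewrite mulrDr.
rewrite big_split /= !opprD (_ : forall a b c e u v : Qp,
  a + b + (c + e) + (u + v) = (a + c + u) + (b + e + v)); last by move=> *; ring.
apply: padic_normD.
  by apply: le_trans (hf w rho r1 hw) _; rewrite ler_wpM2r ?sqr_ge0 // le_max lexx.
by apply: le_trans (hg w rho r2 hw) _; rewrite ler_wpM2r ?sqr_ge0 // le_max lexx orbT.
Qed.

End Taylor.

Lemma fin_rat_bound (I : finType) (f : I -> rat) : exists2 B, 0 < B & forall i, f i <= B.
Proof.
exists (1 + \sum_i `|f i|) => [|i]; first by rewrite ltr_pwDl // sumr_ge0.
rewrite (bigD1 i) //= addrCA; apply: le_trans (ler_norm _) _; rewrite lerDl.
by rewrite addr_ge0 // sumr_ge0.
Qed.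

Lemma taylor1_comp l l' (F : 'rV[Qp]_l -> 'rV[Qp]_l') (g : 'rV[Qp]_l' -> Qp) x
    (L : 'I_l' -> 'I_l -> Qp) (M : 'I_l' -> Qp) :
  (forall j, taylor1 (fun z => F z 0 j) x (L j)) -> taylor1 g (F x) M ->
  taylor1 (g \o F) x (fun i => \sum_j L j i * M j).
Proof.
move=> /choice[C /choice[d hF]] [C' [d' [C'0 d'0 hg]]].
have [A A0 hA] := fin_rat_bound C.
have [D D0 hD] := fin_rat_bound (fun j => (d j)^-1).
have [B B0 hB] := fin_rat_bound (fun u : 'I_l' * 'I_l => N (L u.1 u.2)).
have [m m0 hm] := fin_rat_bound (fun j => N (M j)).
(* [F] moves [x] by at most [(A + B) * rho], which gives the first term through the remainder of
   [g]; the remainder of [F], at most [A * rho ^+ 2], passes through the linear part of [g] and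
   gives the second. *)
exists (C' * (A + B) ^+ 2 + A * m), (Num.min (Num.min 1 D^-1) (d' / (A + B))); split.
- by rewrite addr_ge0 // mulr_ge0 ?sqr_ge0 // ltW.
- by rewrite !lt_min ltr01 invr_gt0 D0 divr_gt0 // addr_gt0.
move=> w rho; rewrite !lt_min => /andP[/andP[r1 rD] rd'] hw.
(* In dimension 0 no coordinate forces [rho] to be nonnegative, so this case is treated apart. *)
have [l0|rho0] : (l = 0)%N \/ 0 <= rho.
  case: (l) w hw => [|n] w hw; [by left|right].
  exact: le_trans (padic_norm_ge0 _) (hw ord0).
- subst l; have -> : w = 0 by apply/matrixP => i [].
  rewrite addr0 subrr big_ord0 subr0 padic_norm0 mulr_ge0 ?sqr_ge0 //.
  by rewrite addr_ge0 // mulr_ge0 ?sqr_ge0 // ltW.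
pose u := F (x + w) - F x.
pose r j := u 0 j - \sum_i w 0 i * L j i.
have hr j : N (r j) <= A * rho ^+ 2.
  have [Cj0 dj0 hj] := hF j; rewrite /r !mxE.
  have rdj : rho < d j.
    apply: lt_le_trans rD _; rewrite -[d j]invrK lef_pV2 ?posrE ?invr_gt0 //.
  by apply: le_trans (hj w rho rdj hw) _; rewrite ler_wpM2r ?sqr_ge0.
have hu j : N (u 0 j) <= (A + B) * rho.
  rewrite -(subrK (\sum_i w 0 i * L j i) (u 0 j)) -/(r j); apply: padic_normD.
    apply: le_trans (hr j) _; rewrite expr2 mulrA ler_wpM2r //.
    apply: le_trans (_ : A * 1 <= _); first by rewrite ler_wpM2l // ltW.
    by rewrite mulr1 lerDl ltW.
  apply: padic_norm_sum => [|i _]; first by rewrite mulr_ge0 // addr_ge0 // ltW.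
  rewrite mulrC; apply: padic_normM_le => //.
  by apply: le_trans (hB (j, i)) _; rewrite lerDr ltW.
have hAB : 0 < A + B by rewrite addr_gt0.
have := hg u ((A + B) * rho); rewrite mulrC -ltr_pdivlMr // => /(_ rd').
rewrite [rho * _]mulrC => /(_ hu).
have -> : F x + u = F (x + w) by rewrite /u addrC subrK.
move=> h1; rewrite /comp.
have -> : \sum_i w 0 i * (\sum_j L j i * M j) = \sum_j u 0 j * M j - \sum_j r j * M j.
  rewrite -sumrB; transitivity (\sum_j \sum_i w 0 i * L j i * M j).
    rewrite exchange_big /=; apply: eq_bigr => i _; rewrite mulr_sumr.
    by apply: eq_bigr => j _; rewrite mulrA.
  by apply: eq_bigr => j _; rewrite /r mulrBl opprB addrC subrK -mulr_suml.
rewrite opprB addrCA addrC; apply: padic_normD.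
  apply: le_trans h1 _; rewrite exprMn mulrA ler_wpM2r ?sqr_ge0 // lerDl.
  by rewrite mulr_ge0 // ltW.
apply: padic_norm_sum => [|j _].
  by rewrite mulr_ge0 ?sqr_ge0 // addr_ge0 // mulr_ge0 ?sqr_ge0 // ltW.
apply: le_trans (padic_normM_le (hr j) (hm j)) _.
rewrite mulrAC ler_wpM2r ?sqr_ge0 // lerDr.
by rewrite mulr_ge0 ?sqr_ge0.
Qed.

(** Chain rule for the pair [(f, g)] followed by the product of two coordinates, whose Taylor
    remainder is exactly [w 0 0 * w 0 1]. *)
Lemma taylor1M l (f g : 'rV[Qp]_l -> Qp) x L L' : taylor1 f x L -> taylor1 g x L' ->
  taylor1 (fun z => f z * g z) x (fun i => L i * g x + L' i * f x).
Proof.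
move=> hf hg.
pose F z : 'rV[Qp]_2 := \row_j if j == 0 then f z else g z.
pose h (y : 'rV[Qp]_2) := y 0 0 * y 0 1.
have hh y : taylor1 h y (fun j => if j == 0 then y 0 1 else y 0 0).
  apply: (@taylor1I _ _ _ _ 1) => // w rho _ hw.
  rewrite !big_ord_recl big_ord0 /= addr0 /h !mxE.
  rewrite (_ : lift ord0 ord0 = 1); last exact/val_inj.
  rewrite (_ : _ - _ = w 0 0 * w 0 1); last by ring.
  by rewrite mul1r expr2; apply: padic_normM_le.
have hL j : taylor1 (fun z => F z 0 j) x (if j == 0 then L else L').
  case: eqP => [->|/eqP j0]; first by under eq_fun do rewrite mxE.
  by under eq_fun do rewrite mxE (negbTE j0).
have := taylor1_comp hL (hh (F x)).
have -> : h \o F = fun z => f z * g z by apply/funext => z; rewrite /h /= !mxE.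
by apply: taylor1_ext => i; rewrite !big_ord_recl big_ord0 /= !mxE /= addr0.
Qed.

Section PdRules.
Variable l : nat.
Implicit Types (f g : 'rV[Qp]_l -> Qp) (C : rat) (z : 'rV[Qp]_l).

Lemma pdD C C' f g i z : tate C f -> tate C' g -> unit_ball z ->
  pd i (fun z => f z + g z) z = pd i f z + pd i g z.
Proof.
by move=> tf tg hz; have := taylor1D (tate_taylor1 tf hz) (tate_taylor1 tg hz);
  apply: taylor1_pd.
Qed.

Lemma pdM C C' f g i z : tate C f -> tate C' g -> unit_ball z ->
  pd i (fun z => f z * g z) z = pd i f z * g z + f z * pd i g z.
Proof.
move=> tf tg hz; have := taylor1M (tate_taylor1 tf hz) (tate_taylor1 tg hz).
by move/(taylor1_pd i) ->; rewrite [pd i g z * _]mulrC.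
Qed.

Lemma pd_cst (c : Qp) i z : pd i (fun=> c) z = 0.
Proof. exact: taylor1_pd i (taylor1_cst c z). Qed.

Lemma pdZ C (c : Qp) f i z : tate C f -> unit_ball z ->
  pd i (fun z => c * f z) z = c * pd i f z.
Proof.
by move=> tf hz; rewrite (pdM i (tate_cst l c) tf) // pd_cst mul0r add0r.
Qed.

Lemma pdB C C' f g i z : tate C f -> tate C' g -> unit_ball z ->
  pd i (fun z => f z - g z) z = pd i f z - pd i g z.
Proof.
move=> tf tg hz; have := pdD i tf (tateN tg) hz => ->; congr (_ + _).
rewrite -[RHS]mulN1r -(pdZ _ _ tg) //; apply: (eq_pd i (tateZ (-1) tg) _ hz) => x _.
by rewrite mulN1r.
Qed.

Lemma pd_coord i j z : pd i (fun z => z 0 j) z = (i == j)%:R.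
Proof. exact: taylor1_pd i (taylor1_coord j z). Qed.

Lemma pd_ext f g i z : f =1 g -> pd i f z = pd i g z.
Proof. by move=> /funext ->. Qed.

Lemma pd_sum (I : Type) (r : seq I) (P : pred I) (F : I -> 'rV[Qp]_l -> Qp) C i z : 0 <= C ->
  (forall j, P j -> tate C (F j)) -> unit_ball z ->
  pd i (fun z => \sum_(j <- r | P j) F j z) z = \sum_(j <- r | P j) pd i (F j) z.
Proof.
move=> C0 hF hz; elim: r => [|j r ih].
  by under eq_fun do rewrite big_nil; rewrite big_nil pd_cst.
under eq_fun do rewrite big_cons; rewrite big_cons; case: ifP => // Pj.
by rewrite (pdD i (hF j Pj) (tate_sum r C0 hF)) // ih.
Qed.

End PdRules.

Lemma pd_comp l l' C (h : 'rV[Qp]_l' -> Qp) (g : 'rV[Qp]_l -> 'rV[Qp]_l') i z :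
  tate C h -> tate_map g -> unit_ball z ->
  pd i (h \o g) z = \sum_j pd i (fun z => g z 0 j) z * pd j h (g z).
Proof.
move=> th tg hz; have hg := tate_map_ball tg hz.
have := taylor1_comp (fun j => tate_taylor1 (tg j) hz) (tate_taylor1 th hg).
exact: taylor1_pd.
Qed.

(** * Identity theorem for restricted power series *)

Section Identity.
Variable l : nat.
Local Notation E := 'rV[Qp]_l.
Local Notation K := {ffun 'I_l -> nat}.

Lemma nsum_at0 (a : K -> Qp) : nsum (fun k => a k * monomial k (0 : E)) = a [ffun=> 0%N].
Proof.
have [k hk|_ ->] := @nsum_fin _ _ _ (fun k => a k * monomial k (0 : E)) [fset [ffun=> 0%N]]%fset.
  have [i ki] : exists i, (0 < k i)%N.
    apply/existsP; apply: contraR hk => /existsPn h; rewrite inE; apply/eqP/ffunP => i.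
    by rewrite ffunE; apply/eqP; rewrite -leqn0 leqNgt h.
  by rewrite (monomial_mdec _ ki) mxE mul0r mulr0.
by rewrite big_seq_fset1 monomial0 mulr1.
Qed.

(** The value at 0 is the constant coefficient. A coefficient of positive degree becomes, after a
    partial derivative, one of lower degree up to an integer factor that is nonzero in
    characteristic 0. *)
Lemma null_series0 (a : K -> Qp) : null a ->
  (forall z : E, unit_ball z -> nsum (fun k => a k * monomial k z) = 0) ->
  forall k, a k = 0.
Proof.
move=> na ha k; move: {2}(\sum_i k i)%N (leqnn (\sum_i k i)%N) => n.
elim: n k a na ha => [|n ih] k a na ha.
  rewrite leqn0 sum_nat_eq0 => /forallP k0.
  have -> : k = [ffun=> 0%N] by apply/ffunP => i; rewrite ffunE; apply/eqP/k0.
  by rewrite -nsum_at0 ha // => i; rewrite mxE padic_norm0.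
have [/existsP[i ki] hk|/existsPn k0 _] := boolP [exists i, (0 < k i)%N]; last first.
  by apply: (ih k a) => //; rewrite big1 // => i _; apply/eqP; rewrite -leqn0 leqNgt k0.
have ni : null (fun k : K => a k * (k i)%:R).
  by apply: null_mul => // k'; exact: padic_norm_nat_le1.
(* [mdec i] identifies the exponents 0 and 1 of the variable [i], hence the regrouping; the terms of
   exponent 0 carry the factor 0. *)
pose b k0 := nsum (fun k : K => if mdec i k == k0 then a k * (k i)%:R else 0).
have [nb _] := nsum_regroup (mdec i) ni.
have [B B0 hB] : exists2 B, 0 <= B & forall k, N (a k) <= B.
  have [A hA] := na 1 ltr01; exists (1 + \sum_(k <- A) N (a k)).
    by rewrite addr_ge0 // sumr_ge0 // => *; exact: padic_norm_ge0.
  move=> k'; have [kA|/hA/ltW h] := boolP (k' \in A); last first.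
    by apply: le_trans h _; rewrite lerDl sumr_ge0 // => *; exact: padic_norm_ge0.
  rewrite (big_fsetD1 k') //= addrCA lerDl addr_ge0 // sumr_ge0 // => *.
  exact: padic_norm_ge0.
have hb (z : E) : unit_ball z -> nsum (fun k => b k * monomial k z) = 0.
  move=> hz; pose f (z : E) := nsum (fun k => a k * monomial k z).
  have tf : tate B f by exists a; split.
  have f0 : pd i f z = 0.
    have := eq_pd i (tate0 p_pr l B0) (fun x hx => esym (ha x hx)) hz.
    by rewrite pd_cst.
  have [_ /(_ i z hz)] := @family_pd _ _ a id B f B0 na hB (fun x _ => erefl).
  rewrite f0 => ->.
  have nz : null (fun k : K => a k * (k i)%:R * monomial (mdec i k) z).
    by apply: null_mul => // k'; exact: monomial_le1.
  have [_ <-] := nsum_regroup (mdec i) nz; apply: eq_nsum => k0.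
  rewrite mulrC -nsumZ; last exact: null_fiber.
  by apply: eq_nsum => k'; case: eqP => [->|_]; rewrite ?mulr0 // mulrC.
have := ih (mdec i k) b nb hb; rewrite {1}/b.
have [k' hk'|_ ->] := @nsum_fin _ _ _ (fun k' : K =>
    if mdec i k' == mdec i k then a k' * (k' i)%:R else 0) [fset k]%fset.
  case: eqP => // kk; case: (posnP (k' i)) => [->|k'i]; first by rewrite mulr0.
  case/negP: hk'; rewrite inE; apply/eqP/ffunP => j; move/ffunP: kk => /(_ j).
  rewrite !ffunE; have [->|_] /= := eqVneq j i; last by rewrite !subn0.
  by move=> e; rewrite -(subnK ki) -(subnK k'i) e.
rewrite big_seq_fset1 eqxx => h.
have : a k * (k i)%:R = 0.
  apply: h; rewrite -ltnS; apply: leq_trans hk; rewrite (bigD1 i) //= [ltnRHS](bigD1 i) //=.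
  rewrite ffunE eqxx -addSn leq_add //; first by lia.
  by apply: leq_sum => j _; rewrite ffunE leq_subr.
by move/eqP; rewrite mulf_eq0 (negbTE (padic_nat_neq0 _ ki)) orbF => /eqP.
Qed.

End Identity.
End Derivatives.

(** * Analytic maps *)

Section AnalyticMaps.
Variables (p : nat) (p_pr : prime p).
Local Notation Qp := (padic p_pr).
Local Notation N := (@padic_norm p p_pr).

Lemma rV_ballE l (x : 'rV[Qp]_l) (r : rat) (y : 'rV[Qp]_l) :
  ball x r y <-> 0 < r /\ forall j, N (x 0 j - y 0 j) < r.
Proof.
split=> [[r0 h]|[r0 h]]; first by split=> // j; exact: h.
by split=> // i j; rewrite (ord1 i) padic_ballE.
Qed.

Lemma rV_nbhsP l (x : 'rV[Qp]_l) (A : set 'rV[Qp]_l) :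
  nbhs x A <-> exists2 r : rat, 0 < r & forall y : 'rV[Qp]_l, (forall j, N (x 0 j - y 0 j) < r) -> A y.
Proof.
split=> [/nbhs_ballP[r /= r0 h]|[r r0 h]].
  by exists r => // y hy; apply/h/rV_ballE.
by apply/nbhs_ballP; exists r => //= y /rV_ballE[_]; exact: h.
Qed.

Lemma has_sum_null (I : choiceType) (f : I -> Qp) s : has_sum f s -> null f.
Proof.
move=> fs e e0; have [A hA] := fs e e0; exists A => i iA.
have := hA _ (fsubset_refl A); have := hA _ (fsubsetUr [fset i]%fset A).
rewrite big_fsetU1 //=; set S := \sum_(j <- A) f j => h1 h2.
have -> : f i = (f i + S - s) + (s - S) by ring.
by apply: padic_normD_lt => //; rewrite padic_normC.
Qed.

Lemma null_bounded (I : choiceType) (a : I -> Qp) : null a ->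
  exists2 B : rat, 0 <= B & forall k, N (a k) <= B.
Proof.
move=> na; have [A hA] := na 1 ltr01; exists (1 + \sum_(k <- A) N (a k)).
  by rewrite addr_ge0 // sumr_ge0 // => *; exact: padic_norm_ge0.
move=> k'; have [kA|/hA/ltW h] := boolP (k' \in A); last first.
  by apply: le_trans h _; rewrite lerDl sumr_ge0 // => *; exact: padic_norm_ge0.
rewrite (big_fsetD1 k') //= addrCA lerDl addr_ge0 // sumr_ge0 // => *.
exact: padic_norm_ge0.
Qed.

Lemma monomialZ l (k : {ffun 'I_l -> nat}) (c : Qp) (z : 'rV[Qp]_l) :
  monomial k (c *: z) = c ^+ (\sum_i k i)%N * monomial k z.
Proof.
rewrite /monomial (eq_bigr (fun i => c ^+ k i * z 0 i ^+ k i)) => [|i _]; last by rewrite mxE exprMn.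
by rewrite big_split /= prodrXr.
Qed.

Lemma unit_ball0 l : unit_ball (0 : 'rV[Qp]_l).
Proof. by move=> i; rewrite mxE padic_norm0. Qed.

Lemma unit_ballZ l (c : Qp) (z : 'rV[Qp]_l) : N c <= 1 -> unit_ball z -> unit_ball (c *: z).
Proof. by move=> c1 hz i; rewrite mxE -[1]mulr1; apply: padic_normM_le. Qed.

Lemma tate_map_affine l l' (a : 'rV[Qp]_l') (A : 'M[Qp]_(l, l')) :
  unit_ball a -> (forall i j, N (A i j) <= 1) -> tate_map (fun z => a + z *m A).
Proof.
move=> ha hA j.
have h : tate 1 (fun z : 'rV[Qp]_l => a 0 j + \sum_i z 0 i * A i j).
  apply: tateD; first exact: tate_le (ha j) (tate_cst _ _).
  apply: tate_sum => // i _; apply: tateM1 (tate_coord _ i) _.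
  exact: tate_le (hA i j) (tate_cst _ _).
by apply: eq_tate h => z _; rewrite !mxE.
Qed.

Lemma tate_map_scale l (a : 'rV[Qp]_l) (c : Qp) :
  unit_ball a -> N c <= 1 -> tate_map (fun z => a + c *: z).
Proof.
move=> ha hc j; have := tate_map_affine (A := c%:M) ha.
move=> /(_ _ j) h; apply: eq_tate (h _) => [z _|i j']; first by rewrite mul_mx_scalar.
by rewrite mxE; case: eqP => _; rewrite ?padic_norm0.
Qed.

Lemma tate_lip l C (f : 'rV[Qp]_l -> Qp) z w (rho : rat) : tate C f ->
  unit_ball z -> unit_ball w -> 0 <= rho -> (forall i, N (z 0 i - w 0 i) <= rho) ->
  N (f z - f w) <= C * rho.
Proof.
move=> tf hz hw rho0 h.
have cst (x : 'rV[Qp]_l) : unit_ball x -> tate_map (fun _ : 'rV[Qp]_l => x).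
  by move=> hx i; exact: tate_le (hx i) (tate_cst _ _).
have := @tate_comp_lip p p_pr l l C rho f (fun=> z) (fun=> w) tf (cst _ hz) (cst _ hw) rho0.
move=> /(_ (fun i => tate_le (h i) (tate_cst _ _)))/tate_bound; apply; exact: (@unit_ball0 l).
Qed.

(** The map [z |-> c *: z] is compared with the zero map through [tate_comp_lip]. The gain [N c] is
    how the deviation from a constant form is made small. *)
Lemma tate_shrink l C (f : 'rV[Qp]_l -> Qp) (c : Qp) : tate C f -> N c <= 1 -> f 0 = 0 ->
  tate (C * N c) (fun z => f (c *: z)).
Proof.
move=> tf c1 f0.
have h1 := tate_map_scale (@unit_ball0 l) c1.
have h2 : tate_map (fun _ : 'rV[Qp]_l => 0 : 'rV[Qp]_l).
  by move=> i; apply: eq_tate (tate0 p_pr l ler01) => z _; rewrite mxE.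
have h3 i : tate (N c) (fun z : 'rV[Qp]_l => (0 + c *: z) 0 i - (0 : 'rV[Qp]_l) 0 i).
  apply: eq_tate (tateM1 (tate_cst _ c) (tate_coord _ i)) => z _.
  by rewrite !mxE; ring.
apply: eq_tate (tate_comp_lip tf h1 h2 (padic_norm_ge0 c) h3) => z _.
by rewrite add0r f0 subr0.
Qed.

(** Radii must be norms of scalars for a ball to be rescaled to the unit ball. A coordinate of
    largest norm, or a small power of [p] if that is larger, provides the scalar. *)
Lemma fin_padic_le l (w : 'rV[Qp]_l) (r : rat) : 0 < r -> (forall i, N (w 0 i) < r) ->
  exists c : Qp, [/\ c != 0, N c < r & forall i, N (w 0 i) <= N c].
Proof.
move=> r0 hw; suff [c [c0 cr hc]] : exists c : Qp, [/\ c != 0, N c < r &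
    forall i, i \in enum 'I_l -> N (w 0 i) <= N c].
  by exists c; split=> // i; apply: hc; rewrite mem_enum.
elim: (enum 'I_l) => [|i s [c [c0 cr hc]]].
  have [n hn] := padic_pX_small p_pr r0; exists (p%:R ^+ n); split=> //.
    by rewrite expf_neq0 // padic_p_neq0.
  exact: hn.
have [h|h] := leP (N (w 0 i)) (N c).
  by exists c; split=> // j; rewrite inE => /predU1P[->//|]; exact: hc.
exists (w 0 i); split=> //.
  by apply/eqP => wi; move: h; rewrite wi padic_norm0 ltNge padic_norm_ge0.
move=> j; rewrite inE => /predU1P[->//|/hc hj].
exact: le_trans hj (ltW h).
Qed.

Section AnalyticP.
Variables l l' : nat.
Implicit Types (U : set 'rV[Qp]_l) (f : 'rV[Qp]_l -> 'rV[Qp]_l').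

Definition tate_at f x (c : Qp) := forall j, exists C, tate C (fun z => f (x + c *: z) 0 j).

(** Every point of an ultrametric ball is a centre of it, and a series that converges on an open
    ball becomes a restricted one once a smaller closed ball is rescaled to the unit ball. Each
    analytic function can thus be studied by [tate] around the given point. *)
Lemma analyticP U f : analytic U f <-> forall x, U x -> exists c : Qp,
  [/\ c != 0, forall z, unit_ball z -> U (x + c *: z) & tate_at f x c].
Proof.
split=> [anf x Ux|h x Ux].
  have [x0 [r [/rV_ballE[r0 xr] rU hf]]] := anf x Ux.
  have [c [c0 cr hc]] : exists c : Qp, [/\ c != 0, N c < r & forall i, N ((x - x0) 0 i) <= N c].
    by apply: fin_padic_le => // i; rewrite !mxE padic_normC.
  pose z1 := c^-1 *: (x - x0).
  have hz1 : unit_ball z1.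
    move=> i; rewrite mxE padic_normM padic_normV mulrC ler_pdivrMr ?padic_norm_gt0 //.
    by rewrite mul1r.
  have xE z : x + c *: z = x0 + c *: (z1 + z).
    by rewrite scalerDr scalerA divff // scale1r addrA [x0 + _]addrC subrK.
  have hball z : unit_ball z -> ball x0 r (x0 + c *: z).
    move=> hz; apply/rV_ballE; split=> // j; rewrite !mxE opprD addrA subrr sub0r padic_normN.
    by apply: le_lt_trans cr; rewrite padic_normM ler_piMr ?padic_norm_ge0.
  exists c; split=> // [z hz|j].
    by rewrite xE; apply/rU/hball/unit_ballD.
  have [a ha] := hf j; pose b k := a k * c ^+ (\sum_i k i)%N.
  have hs z : unit_ball z -> has_sum (fun k => b k * monomial k z) (f (x0 + c *: z) 0 j).
    move=> hz; have /nsumP := ha _ (hball z hz).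
    have -> : x0 + c *: z - x0 = c *: z by rewrite addrC addKr.
    have -> // : (fun k => a k * monomial k (c *: z)) = fun k => b k * monomial k z.
    by apply/funext => k; rewrite monomialZ mulrA.
  (* At the point with all coordinates 1 every monomial is 1, so convergence there says that the
     coefficients form a null family. *)
  have nb : null b.
    have /has_sum_null : has_sum b (f (x0 + c *: const_mx 1) 0 j).
      have h1 : unit_ball (const_mx 1 : 'rV[Qp]_l) by move=> i; rewrite mxE padic_norm1.
      have := hs _ h1.
      have -> // : (fun k => b k * monomial k (const_mx 1)) = b.
      by apply/funext => k; rewrite /monomial big1 ?mulr1 // => i _; rewrite mxE expr1n.
    by [].
  have [B B0 hB] := null_bounded nb; exists B.
  have tb : tate B (fun z => f (x0 + c *: z) 0 j).
    by exists b; split=> // z hz; rewrite (has_sumE (hs z hz)).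
  have hm := @tate_map_scale l z1 1 hz1; rewrite padic_norm1 in hm.
  by apply: eq_tate (tate_comp tb (hm (lexx 1))) => z _ /=; rewrite xE scale1r.
have [c [c0 cU hf]] := h x Ux; exists x, (N c).
have nc := padic_norm_gt0 c0.
have hz y : ball x (N c) y -> exists2 z, unit_ball z & y = x + c *: z.
  move=> /rV_ballE[_ hy]; exists (c^-1 *: (y - x)) => [i|].
    rewrite mxE padic_normM padic_normV mulrC ler_pdivrMr // mul1r !mxE padic_normC.
    exact: ltW.
  by rewrite scalerA divff // scale1r addrC subrK.
split=> [|y /hz[z zB ->]|j]; [|exact: cU|].
  by apply/rV_ballE; split=> // j; rewrite subrr padic_norm0.
have [C [a [na ha fa]]] := hf j; exists (fun k => a k / c ^+ (\sum_i k i)%N) => y /hz[z zB yE].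
apply/nsumP; rewrite yE addrAC subrr add0r fa //.
have -> : (fun k => a k / c ^+ (\sum_i k i)%N * monomial k (c *: z)) =
    (fun k => a k * monomial k z).
  by apply/funext => k; rewrite monomialZ mulrA divfK // expf_neq0.
by apply: null_has_sum; apply: null_mul => // k; exact: monomial_le1.
Qed.

Lemma analytic_open U f : analytic U f -> open U.
Proof.
move=> anf; rewrite openE => x Ux; have [x0 [r [xr rU _]]] := anf x Ux.
move/rV_ballE: xr => [r0 xr]; apply/rV_nbhsP; exists r => // y hy.
apply/rU/rV_ballE; split=> // j; rewrite -(subrK (x 0 j) (x0 0 j)) -addrA.
exact: padic_normD_lt.
Qed.

Lemma eq_analytic U f g : (forall x, U x -> f x = g x) -> analytic U f -> analytic U g.
Proof.
move=> fg /analyticP h; apply/analyticP => x Ux; have [c [c0 cU hf]] := h x Ux.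
exists c; split=> // j; have [C tf] := hf j; exists C.
by apply: eq_tate tf => z hz; rewrite fg //; exact: cU.
Qed.

Lemma taylor1_affine (a : 'rV[Qp]_l') (A : 'M[Qp]_(l, l')) x j :
  taylor1 (fun y => (a + y *m A) 0 j) x (fun i => A i j).
Proof.
apply: (@taylor1I _ _ _ _ _ _ 0) => // w rho _ _; rewrite mul0r mulmxDl !mxE.
by rewrite (_ : _ - _ = 0) ?padic_norm0 //; ring.
Qed.

End AnalyticP.

Lemma analytic_taylor1 l l' (U : set 'rV[Qp]_l) (f : 'rV[Qp]_l -> 'rV[Qp]_l') x j :
  analytic U f -> U x -> taylor1 (fun z => f z 0 j) x (fun i => jacobian f x i j).
Proof.
move=> /analyticP h Ux; have [c [c0 _ hf]] := h x Ux; have [C tf] := hf j.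
have E : (fun z => f z 0 j) =
    (fun z => f (x + c *: z) 0 j) \o (fun y => - (c^-1 *: x) + y *m c^-1%:M).
  apply/funext => y /=; rewrite mul_mx_scalar -scalerN -scalerDr scalerA divff // scale1r.
  by rewrite addrA subrr add0r.
have x0 : - (c^-1 *: x) + x *m c^-1%:M = 0 by rewrite mul_mx_scalar addNr.
have := taylor1_comp (taylor1_affine (- (c^-1 *: x)) c^-1%:M x) (M := fun i => pd i (fun z => f (x + c *: z) 0 j) 0).
rewrite x0 => /(_ _ (tate_taylor1 tf (@unit_ball0 l))); rewrite -E => T.
by apply: taylor1_ext (T) => i; rewrite mxE; apply/esym/(taylor1_pd i T).
Qed.

Lemma analytic_comp l l' l'' (U : set 'rV[Qp]_l) (V : set 'rV[Qp]_l')
    (f : 'rV[Qp]_l -> 'rV[Qp]_l') (g : 'rV[Qp]_l' -> 'rV[Qp]_l'') :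
  analytic U f -> analytic V g -> analytic (U `&` f @^-1` V) (g \o f).
Proof.
move=> /analyticP hf /analyticP hg; apply/analyticP => x [Ux Vfx].
have [c [c0 cU tf]] := hf x Ux; have [d [d0 dV tg]] := hg _ Vfx.
have [C hC] := choice tf.
have [B B0 hB] := fin_rat_bound (fun j => Num.max (C j) (N (f x 0 j))).
have nd := padic_norm_gt0 d0.
(* The factor [e] is so small that [f] minus its value at [x] lands in the ball of radius [N d], on
   which [g] is a series; [tate_comp] then applies to [q]. *)
have [n hn] := padic_pX_small p_pr (divr_gt0 nd B0).
have {hn} hn := hn n (leqnn n); rewrite ltr_pdivlMr // in hn.
set e : Qp := p%:R ^+ n in hn.
have e1 : N e <= 1.
  exact: padic_norm_pX_le1.
have tF j : tate B (fun z => f (x + c *: z) 0 j - f x 0 j).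
  apply: tateB; last by apply: tate_le (tate_cst _ _); apply: le_trans (hB j); rewrite le_max lexx orbT.
  by apply: tate_le (hC j); apply: le_trans (hB j); rewrite le_max lexx.
pose q z := d^-1 *: (f (x + (c * e) *: z) - f x).
have tq : tate_map q.
  move=> j; have := tate_shrink (tF j) e1; rewrite scaler0 addr0 subrr => /(_ erefl).
  move=> /(tateZ d^-1) h; apply: tate_le (_ : tate (N d^-1 * (B * N e)) _).
    by rewrite padic_normV ler_pdivrMl // mulr1 mulrC ltW.
  by apply: eq_tate h => z _; rewrite !mxE scalerA.
have fE z : f (x + (c * e) *: z) = f x + d *: q z.
  by rewrite /q scalerA divff // scale1r [RHS]addrC subrK.
exists (c * e); split.
- by rewrite mulf_neq0 // expf_neq0 // padic_p_neq0.
- move=> z hz; split; first by rewrite -scalerA; apply/cU/unit_ballZ.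
  by rewrite /preimage /= fE; apply/dV/tate_map_ball.
- move=> j; have [D tD] := tg j; exists D.
  by apply: eq_tate (tate_comp tD tq) => z _ /=; rewrite fE.
Qed.

Lemma analytic_jacobian_comp l l' l'' (U : set 'rV[Qp]_l) (V : set 'rV[Qp]_l')
    (f : 'rV[Qp]_l -> 'rV[Qp]_l') (g : 'rV[Qp]_l' -> 'rV[Qp]_l'') x :
  analytic U f -> analytic V g -> U x -> V (f x) ->
  jacobian (g \o f) x = jacobian f x *m jacobian g (f x).
Proof.
move=> anf ang Ux Vfx; apply/matrixP => i j; rewrite !mxE.
have T := taylor1_comp (fun k => analytic_taylor1 k anf Ux) (analytic_taylor1 j ang Vfx).
exact: (taylor1_pd i T).
Qed.

Lemma analytic_dirderiv l l' (U : set 'rV[Qp]_l) (f : 'rV[Qp]_l -> 'rV[Qp]_l') x v j :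
  analytic U f -> U x -> dirderiv (fun z => f z 0 j) x v = (v *m jacobian f x) 0 j.
Proof.
by move=> anf Ux; rewrite (taylor1_dirderiv v (analytic_taylor1 j anf Ux)) mxE.
Qed.

Lemma eq_jacobian l l' (U : set 'rV[Qp]_l) (f g : 'rV[Qp]_l -> 'rV[Qp]_l') x :
  analytic U f -> (\forall y \near x, f y = g y) -> U x -> jacobian g x = jacobian f x.
Proof.
move=> anf /rV_nbhsP[r r0 fg] Ux; apply/matrixP => i j; rewrite mxE.
have T := analytic_taylor1 j anf Ux.
have T' : taylor1 (fun z => g z 0 j) x (fun i => jacobian f x i j).
  apply: eq_taylor1 T; exists r => // w hw; rewrite fg // => k.
  by rewrite mxE opprD addrA subrr sub0r padic_normN.
exact: (taylor1_pd i T').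
Qed.

Lemma jacobian_id l (x : 'rV[Qp]_l) : jacobian id x = 1%:M.
Proof. by apply/matrixP => i j; rewrite mxE [LHS]pd_coord mxE. Qed.

Lemma analytic_continuous l l' (U : set 'rV[Qp]_l) (f : 'rV[Qp]_l -> 'rV[Qp]_l') x :
  analytic U f -> U x -> {for x, continuous f}.
Proof.
move=> /analyticP h Ux; have [c [c0 _ /choice[C hC]]] := h x Ux.
have [B B0 hB] := fin_rat_bound C; have nc := padic_norm_gt0 c0.
apply/(@cvg_ballP rat 'rV[Qp]_l' 'rV[Qp]_l (nbhs x) (nbhs_filter x) f (f x)) => e e0.
apply/rV_nbhsP.
exists (Num.min (N c) (e / B * N c)) => [|y hy].
  by rewrite lt_min nc mulr_gt0 // divr_gt0.
pose z := c^-1 *: (y - x).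
have yE : y = x + c *: z by rewrite scalerA divff // scale1r addrC subrK.
have hz i : N (z 0 i) < Num.min 1 (e / B).
  rewrite mxE padic_normM padic_normV mulrC !mxE padic_normC lt_min !ltr_pdivrMr //.
  by rewrite mul1r -lt_min.
apply/rV_ballE; split=> // j.
have [b [_ hb zb]] : exists b : Qp, [/\ b != 0, N b < Num.min 1 (e / B) & forall i, N (z 0 i) <= N b].
  by apply: fin_padic_le => //; rewrite lt_min ltr01 divr_gt0.
move: hb; rewrite lt_min => /andP[b1 b2].
have zB : unit_ball z by move=> i; apply: le_trans (zb i) (ltW b1).
have := tate_lip (hC j) zB (@unit_ball0 l) (padic_norm_ge0 b).
rewrite -yE scaler0 addr0 padic_normC => h1.
have h2 i : N (z 0 i - (0 : 'rV[Qp]_l) 0 i) <= N b by rewrite [X in _ - X]mxE subr0.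
apply: le_lt_trans (h1 h2) _; apply: (le_lt_trans (_ : _ <= B * N b)).
  by rewrite ler_wpM2r ?padic_norm_ge0 //; exact: hB.
by rewrite mulrC -ltr_pdivlMr.
Qed.

End AnalyticMaps.

(** * The Poincare lemma *)

Section Poincare.
Variables (p : nat) (p_pr : prime p) (l : nat).
Local Notation Qp := (padic p_pr).
Local Notation N := (@padic_norm p p_pr).
Local Notation E := 'rV[Qp]_l.
Implicit Types (f g : E -> Qp) (C : rat) (z : E).

Lemma tate_scale C f (c : Qp) : tate C f -> N c <= 1 -> tate C (fun z => f (c *: z)).
Proof.
move=> tf c1; have := tate_comp tf (tate_map_scale (@unit_ball0 p p_pr l) c1).
by apply: eq_tate => z _ /=; rewrite add0r.
Qed.

Lemma pd_scale C f (c : Qp) i z : tate C f -> N c <= 1 -> unit_ball z ->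
  pd i (fun z => f (c *: z)) z = c * pd i f (c *: z).
Proof.
move=> tf c1 hz; have tm := tate_map_scale (@unit_ball0 p p_pr l) c1.
have := pd_comp i tf tm hz; rewrite add0r.
have -> : f \o (fun z => 0 + c *: z) = fun z => f (c *: z).
  by apply/funext => x /=; rewrite add0r.
move=> ->; rewrite (bigD1 i) //= big1 ?addr0 => [|j ji].
  congr (_ * _); transitivity (pd i (fun z : E => c * z 0 i) z).
    by apply: pd_ext => x; rewrite !mxE add0r.
  by rewrite (pdZ c i (tate_coord p_pr i)) // pd_coord eqxx mulr1.
have -> : pd i (fun z : E => (0 + c *: z) 0 j) z = pd i (fun z : E => c * z 0 j) z.
  by apply: pd_ext => x; rewrite !mxE add0r.
by rewrite (pdZ c i (tate_coord p_pr j)) // pd_coord eq_sym (negbTE ji) mulr0 mul0r.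
Qed.

(** Diagonal on monomials: on [monomial k] it is multiplication by the total degree plus [c]. *)
Definition euler (c : nat) f z : Qp := \sum_i z 0 i * pd i f z + c%:R * f z.

Lemma euler_series c (a : {ffun 'I_l -> nat} -> Qp) C f z : 0 <= C -> null a ->
  (forall k, N (a k) <= C) ->
  (forall z, unit_ball z -> f z = nsum (fun k => a k * monomial k z)) -> unit_ball z ->
  euler c f z = nsum (fun k => (a k * (\sum_i k i + c)%:R) * monomial k z).
Proof.
move=> C0 na ha fa hz.
have [_ hpd] := @family_pd _ _ _ _ a id C f C0 na ha fa.
have nai i : null (fun k : {ffun 'I_l -> nat} => a k * (k i)%:R).
  by apply: null_mul => // k; exact: padic_norm_nat_le1.
have n1 i : null (fun k : {ffun 'I_l -> nat} => a k * (k i)%:R * monomial k z).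
  by apply: null_mul => // k; exact: monomial_le1.
have n2 : null (fun k => a k * monomial k z) by apply: null_mul => // k; exact: monomial_le1.
have hi i : z 0 i * pd i f z = nsum (fun k => a k * (k i)%:R * monomial k z).
  rewrite hpd // -nsumZ; last by apply: null_mul => // k; exact: monomial_le1.
  apply: eq_nsum => k; case: (posnP (k i)) => [->|ki]; first by rewrite !mulr0 !mul0r mulr0.
  by rewrite (monomial_mdec z ki); ring.
rewrite /euler; under eq_bigr do rewrite hi.
have [n3 e3] := nsum_sum (index_enum 'I_l) n1.
rewrite -e3 (fa z hz) -(nsumZ _ n2) -nsumD; [|exact: n3|exact: nullZ].
apply: eq_nsum => k; rewrite natrD natr_sum mulrDr mulrDl mulr_sumr mulr_suml.
by congr (_ + _); ring.
Qed.

(** The eigenvalues are positive integers, nonzero in characteristic 0, so the identity theorem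
    applies to the coefficients. *)
Lemma euler_inj c C f : tate C f -> (forall z, unit_ball z -> euler c.+1 f z = 0) ->
  forall z, unit_ball z -> f z = 0.
Proof.
move=> tf ef z hz; have C0 := tate_ge0 tf; have [a [na ha fa]] := tf.
have nb : null (fun k : {ffun 'I_l -> nat} => a k * (\sum_i k i + c.+1)%:R).
  by apply: null_mul => // k; exact: padic_norm_nat_le1.
have h := null_series0 nb; rewrite fa //; apply: nsum0 => k.
have /eqP : a k * (\sum_i k i + c.+1)%:R = 0.
  by apply: h => x hx; rewrite -(euler_series c.+1 C0 na ha fa hx) ef.
by rewrite mulf_eq0 (negbTE (padic_nat_neq0 _ _)) ?addnS // orbF => /eqP ->; rewrite mul0r.
Qed.

(** Dividing the coefficient at degree [d] by [d + c + 1] is not bounded; evaluation at [p z]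
    supplies the factor [p ^ d], whose norm at most [2 ^ (- d)] outweighs the linear growth of the
    inverse. *)
Lemma euler_surj c C f : tate C f -> exists C' g, tate C' g /\
  forall z, unit_ball z -> euler c.+1 g z = f (p%:R *: z).
Proof.
move=> tf; have C0 := tate_ge0 tf; have [a [na ha fa]] := tf.
pose u (k : {ffun 'I_l -> nat}) : Qp :=
  p%:R ^+ (\sum_i k i)%N / (\sum_i k i + c.+1)%:R.
have hu k : N (u k) <= c.+1%:R.
  rewrite /u; move: (\sum_i k i)%N => d; rewrite addnS.
  apply: le_trans (padic_normM_le (padic_norm_pX_le _ d) (padic_norm_natV_le _ _)) _.
  rewrite exprVn ler_pdivrMl ?exprn_gt0 // -natrX -natrM ler_nat.
  have : (d < 2 ^ d)%N by rewrite ltn_expl.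
  by move: (2 ^ d)%N => e; nia.
have nb : null (fun k => a k * u k).
  by apply: (null_scale (C := c.+1%:R) na) => k; rewrite mulrC padic_normM ler_wpM2r ?padic_norm_ge0.
have [B B0 hB] := null_bounded nb.
exists B, (fun z => nsum (fun k => a k * u k * monomial k z)); split.
  by exists (fun k => a k * u k); split; [exact: nb|exact: hB|move=> z _].
move=> z hz; rewrite (euler_series c.+1 B0 nb hB (fun _ _ => erefl) hz).
rewrite fa; last by apply: unit_ballZ hz; rewrite padic_norm_nat_le1.
apply: eq_nsum => k; rewrite monomialZ /u.
rewrite -[a k * _ * _]mulrA divfK ?mulrA // addnS; exact: padic_nat_neq0.
Qed.

(** A partial derivative lowers the degree by 1, which the shift of [c] makes up for. *)
Lemma euler_pd c C f i z : tate C f -> unit_ball z ->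
  pd i (euler c f) z = euler c.+1 (pd i f) z.
Proof.
move=> tf hz; have C0 := tate_ge0 tf.
have t1 j : tate C (fun z => z 0 j * pd j f z).
  by apply: tate1M (tate_coord p_pr j) _; exact: tate_pd.
have t2 : tate C (fun z => c%:R * f z).
  by apply: tate1M => //; exact: tate_le (padic_norm_nat_le1 _ c) (tate_cst _ _).
rewrite /euler (pdD i (tate_sum _ C0 (fun j _ => t1 j)) t2 hz) (pdZ _ i tf hz).
rewrite (pd_sum _ i C0 (fun j _ => t1 j) hz).
rewrite (eq_bigr (fun j => (i == j)%:R * pd j f z + z 0 j * pd j (pd i f) z)); last first.
  by move=> j _; rewrite (pdM i (tate_coord p_pr j) (tate_pd j tf) hz) pd_coord (pdC i j tf hz).
rewrite big_split /= (bigD1 i) //= eqxx big1 => [|j ji]; last first.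
  by rewrite eq_sym (negbTE ji) mul0r.
rewrite -natr1 mul1r addr0; ring.
Qed.

Lemma eulerD c C C' f g z : tate C f -> tate C' g -> unit_ball z ->
  euler c (fun z => f z + g z) z = euler c f z + euler c g z.
Proof.
move=> tf tg hz; rewrite /euler mulrDr addrACA -big_split; congr (_ + _).
by apply: eq_bigr => i _; rewrite (pdD i tf tg hz) mulrDr.
Qed.

(* The primitive is the radial one, with B the inverse of the operator
   euler 2 applied to beta; rescaling by p pays for the denominators. *)
Lemma tate_poincare (beta : 'I_l -> 'I_l -> E -> Qp) C :
  (forall i j, tate C (beta i j)) ->
  (forall i j z, unit_ball z -> beta i j z = - beta j i z) ->
  (forall i j k z, unit_ball z ->
     pd i (beta j k) z + pd j (beta k i) z + pd k (beta i j) z = 0) ->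
  (forall i j, beta i j 0 = 0) ->
  exists C' (B : 'I_l -> 'I_l -> E -> Qp), [/\ forall i j, tate C' (B i j),
    forall i j, B i j 0 = 0 &
    forall i j z, unit_ball z ->
      pd i (fun z => \sum_k z 0 k * B k j z) z - pd j (fun z => \sum_k z 0 k * B k i z) z
      = beta i j (p%:R *: z)].
Proof.
move=> tb anti closed b0.
have ex (u : 'I_l * 'I_l) : exists Cg : rat * (E -> Qp), tate Cg.1 Cg.2 /\
    forall z, unit_ball z -> euler 2 Cg.2 z = beta u.1 u.2 (p%:R *: z).
  by have [C' [g hg]] := euler_surj 1 (tb u.1 u.2); exists (C', g).
have [G hG] := choice ex; have [C' C'0 hC'] := fin_rat_bound (fun u => (G u).1).
pose B i j := (G (i, j)).2.
have tB i j : tate C' (B i j) by have [h _] := hG (i, j); apply: tate_le h; exact: hC'.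
have eB i j z : unit_ball z -> euler 2 (B i j) z = beta i j (p%:R *: z).
  by have [_] := hG (i, j); apply.
have p1 : N p%:R <= 1 := padic_norm_nat_le1 _ p.
have hp z : unit_ball z -> unit_ball (p%:R *: z) by exact: unit_ballZ.
(* Antisymmetry and closedness pass from [beta] to [B] because the Euler operators are injective. *)
have antiB i j z : unit_ball z -> B i j z + B j i z = 0.
  move=> hz; apply: (@euler_inj 1 _ _ (tateD (tB i j) (tB j i))) hz => x hx.
  by rewrite (eulerD 2 (tB i j) (tB j i) hx) !eB // (anti i j) ?addNr //; exact: hp.
have cycB i j k z : unit_ball z -> pd i (B j k) z + pd j (B k i) z + pd k (B i j) z = 0.
  move=> hz; have t a b c := tate_pd a (tB b c).
  have tt : tate C' (fun z => pd i (B j k) z + pd j (B k i) z + pd k (B i j) z).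
    by apply: tateD => //; apply: tateD.
  have ed a b c x : unit_ball x -> euler 3 (pd a (B b c)) x = p%:R * pd a (beta b c) (p%:R *: x).
    move=> hx; rewrite -(euler_pd 2 a (tB b c) hx) -(pd_scale a (tb b c) p1 hx).
    by apply: eq_pd (tate_scale (tb b c) p1) _ hx => y hy; rewrite eB.
  apply: (euler_inj (c := 2) tt) hz => x hx.
  rewrite (eulerD 3 (tateD (t i j k) (t j k i)) (t k i j) hx).
  by rewrite (eulerD 3 (t i j k) (t j k i) hx) !ed // -!mulrDr closed ?mulr0 //; exact: hp.
exists C', B; split=> // [i j|i j z hz].
  (* At 0 only [2 * B i j 0] is left of the Euler operator. Vanishing at 0 will make the primitive
     small after a further rescaling. *)
  have h0 := @unit_ball0 p p_pr l; have := eB i j 0 h0; rewrite scaler0 b0 /euler big1 => [|k _].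
    by rewrite add0r => /eqP; rewrite mulf_eq0 (negbTE (padic_nat_neq0 _ _)) //= => /eqP.
  by rewrite mxE mul0r.
have pg a b : pd a (fun z => \sum_k z 0 k * B k b z) z =
    B a b z + \sum_k z 0 k * pd a (B k b) z.
  rewrite (pd_sum _ a (ltW C'0)) // => [|k _]; last exact: tate1M (tate_coord p_pr k) _.
  rewrite (eq_bigr (fun k => (a == k)%:R * B k b z + z 0 k * pd a (B k b) z)).
    rewrite big_split /= (bigD1 a) //= eqxx mul1r big1 ?addr0 // => k ka.
    by rewrite eq_sym (negbTE ka) mul0r.
  by move=> k _; rewrite (pdM a (tate_coord p_pr k) (tB k b) hz) pd_coord.
(* Differentiating the coordinates gives [2 * B i j], and the cyclic identity turns the other terms
   into the radial derivative of [B i j]; the total is [euler 2 (B i j)]. *)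
rewrite !pg -(eB i j) // /euler.
have -> : B j i z = - B i j z by apply/eqP; rewrite -addr_eq0 antiB.
rewrite opprD opprK addrACA -sumrB addrC; congr (_ + _); last by ring.
apply: eq_bigr => k _; rewrite -mulrBr; congr (_ * _).
have -> : pd j (B k i) z = - pd j (B i k) z.
  have := pdD j (tB k i) (tB i k) hz.
  have -> : pd j (fun z => B k i z + B i k z) z = 0.
    have := eq_pd j (tate0 p_pr l (lexx 0)) (fun x hx => esym (antiB k i x hx)) hz.
    by rewrite pd_cst.
  by move/esym/eqP; rewrite addr_eq0 => /eqP.
have aB : pd k (B j i) z = - pd k (B i j) z.
  have := pdD k (tB j i) (tB i j) hz.
  have -> : pd k (fun z => B j i z + B i j z) z = 0.
    have := eq_pd k (tate0 p_pr l (lexx 0)) (fun x hx => esym (antiB j i x hx)) hz.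
    by rewrite pd_cst.
  by move/esym/eqP; rewrite addr_eq0 => /eqP.
have := cycB i k j z hz; rewrite aB addrAC => /eqP; rewrite subr_eq0 => /eqP <-.
by rewrite opprK.
Qed.

End Poincare.

(** * Flows of vector fields *)

Section Flow.
Variables (p : nat) (p_pr : prime p) (l : nat).
Local Notation Qp := (padic p_pr).
Local Notation N := (@padic_norm p p_pr).
Local Notation E := 'rV[Qp]_l.
Implicit Types (f g : E -> Qp) (C : rat) (z : E).

(** The hypotheses say that [u'] and [v'] are the coefficients of the time derivatives of the series
    [u] and [v], so this is the Leibniz rule for their product. *)
Lemma conv_rec (u v u' v' : nat -> Qp) n :
  (forall n, n.+1%:R * u n.+1 = u' n) -> (forall n, n.+1%:R * v n.+1 = v' n) ->
  n.+1%:R * conv u v n.+1 = conv u' v n + conv u v' n.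
Proof.
move=> hu hv; rewrite /conv mulr_sumr.
rewrite (eq_bigr (fun i : 'I_n.+2 => (i : nat)%:R * u i * v (n.+1 - i)%N +
    u i * ((n.+1 - i)%:R * v (n.+1 - i)%N))); last first.
  move=> i _; have /subnKC {1}<- : (i <= n.+1)%N by rewrite -ltnS.
  by rewrite natrD; ring.
rewrite big_split /=; congr (_ + _).
  rewrite big_ord_recl /= !mul0r add0r; apply: eq_bigr => i _.
  by rewrite /bump /= add1n hu subSS.
rewrite big_ord_recr /= subnn mul0r mulr0 addr0; apply: eq_bigr => i _.
have hi : (i <= n)%N by rewrite -ltnS.
by rewrite subSn // hv.
Qed.

Lemma conv_linl (I : Type) (r : seq I) (c : I -> Qp) (u : I -> nat -> Qp) v n :
  conv (fun m => \sum_(i <- r) c i * u i m) v n = \sum_(i <- r) c i * conv (u i) v n.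
Proof.
rewrite /conv; under eq_bigr do rewrite mulr_suml.
rewrite exchange_big /=; apply: eq_bigr => i _; rewrite mulr_sumr.
by apply: eq_bigr => m _; rewrite mulrA.
Qed.

Lemma conv_linr (I : Type) (r : seq I) (c : I -> Qp) u (v : I -> nat -> Qp) n :
  conv u (fun m => \sum_(i <- r) c i * v i m) n = \sum_(i <- r) c i * conv u (v i) n.
Proof.
rewrite /conv; under eq_bigr do rewrite mulr_sumr.
rewrite exchange_big /=; apply: eq_bigr => i _; rewrite mulr_sumr.
by apply: eq_bigr => m _; rewrite mulrCA.
Qed.

Lemma convDl u u' (v : nat -> Qp) n :
  conv (fun m => u m + u' m) v n = conv u v n + conv u' v n.
Proof. by rewrite /conv -big_split; apply: eq_bigr => m _; rewrite mulrDl. Qed.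

Lemma convDr (u : nat -> Qp) v v' n :
  conv u (fun m => v m + v' m) n = conv u v n + conv u v' n.
Proof. by rewrite /conv -big_split; apply: eq_bigr => m _; rewrite mulrDr. Qed.

Lemma convZl c u (v : nat -> Qp) n : conv (fun m => c * u m) v n = c * conv u v n.
Proof. by rewrite /conv mulr_sumr; apply: eq_bigr => m _; rewrite mulrA. Qed.

Lemma convZr c u (v : nat -> Qp) n : conv u (fun m => c * v m) n = c * conv u v n.
Proof. by rewrite /conv mulr_sumr; apply: eq_bigr => m _; rewrite mulrCA. Qed.

(** The recursion shape of the components of a covariant tensor along a flow: the sums are the terms
    that mix components through derivatives of the field. *)
Lemma conv_rec_lin (I : Type) (r : seq I) (e : Qp) (u u1 v v1 : nat -> Qp)
    (cu cv : I -> Qp) (uc vc : I -> nat -> Qp) n :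
  (forall n, n.+1%:R * u n.+1 = e * (u1 n + \sum_(i <- r) cu i * uc i n)) ->
  (forall n, n.+1%:R * v n.+1 = e * (v1 n + \sum_(i <- r) cv i * vc i n)) ->
  n.+1%:R * conv u v n.+1 = e * (conv u1 v n + conv u v1 n +
    \sum_(i <- r) cu i * conv (uc i) v n + \sum_(i <- r) cv i * conv u (vc i) n).
Proof.
move=> hu hv; rewrite (conv_rec n hu hv) convZl convZr convDl convDr conv_linl conv_linr.
by rewrite -mulrDr; congr (_ * _); ring.
Qed.

Variable X : 'I_l -> E -> Qp.
Hypothesis tX : forall i, tate 1 (X i).

Definition vderiv f z : Qp := \sum_i X i z * pd i f z.

Lemma tate_vderiv C f : tate C f -> tate C (vderiv f).
Proof.
move=> tf; apply: tate_sum (tate_ge0 tf) _ => i _.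
by apply: tate1M (tX i) _; exact: tate_pd.
Qed.

Lemma eq_vderiv C f g z : tate C f -> (forall z, unit_ball z -> f z = g z) -> unit_ball z ->
  vderiv g z = vderiv f z.
Proof. by move=> tf fg hz; apply: eq_bigr => i _; rewrite (eq_pd i tf fg hz). Qed.

Lemma vderivD C C' f g z : tate C f -> tate C' g -> unit_ball z ->
  vderiv (fun z => f z + g z) z = vderiv f z + vderiv g z.
Proof.
move=> tf tg hz; rewrite /vderiv -big_split; apply: eq_bigr => i _.
by rewrite (pdD i tf tg hz) mulrDr.
Qed.

Lemma vderivM C C' f g z : tate C f -> tate C' g -> unit_ball z ->
  vderiv (fun z => f z * g z) z = vderiv f z * g z + f z * vderiv g z.
Proof.
move=> tf tg hz; rewrite /vderiv mulr_suml mulr_sumr -big_split; apply: eq_bigr => i _.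
by rewrite (pdM i tf tg hz) /=; ring.
Qed.

Lemma vderivZ C c f z : tate C f -> unit_ball z ->
  vderiv (fun z => c * f z) z = c * vderiv f z.
Proof.
move=> tf hz; rewrite /vderiv mulr_sumr; apply: eq_bigr => i _.
by rewrite (pdZ c i tf hz) mulrCA.
Qed.

Lemma vderiv_cst c z : vderiv (fun=> c) z = 0.
Proof. by rewrite /vderiv big1 // => i _; rewrite pd_cst mulr0. Qed.

Lemma vderiv_sum (I : Type) (r : seq I) (F : I -> E -> Qp) C z : 0 <= C ->
  (forall j, tate C (F j)) -> unit_ball z ->
  vderiv (fun z => \sum_(j <- r) F j z) z = \sum_(j <- r) vderiv (F j) z.
Proof.
move=> C0 tF hz; rewrite /vderiv exchange_big; apply: eq_bigr => i _.
by rewrite (pd_sum r i C0 (fun j _ => tF j) hz) mulr_sumr.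
Qed.

(** The last sum is the commutator of the partial derivative with the field; it is the origin of the
    derivatives of [X] in [lie]. *)
Lemma pd_vderiv C f i z : tate C f -> unit_ball z ->
  pd i (vderiv f) z = vderiv (pd i f) z + \sum_k pd i (X k) z * pd k f z.
Proof.
move=> tf hz; have C0 := tate_ge0 tf.
have t k : tate C (fun z => X k z * pd k f z) by apply: tate1M (tX k) _; exact: tate_pd.
rewrite /vderiv (pd_sum _ i C0 (fun k _ => t k) hz) -big_split; apply: eq_bigr => k _ /=.
by rewrite (pdM i (tX k) (tate_pd k tf) hz) (pdC i k tf hz) addrC.
Qed.

Lemma tate_conv (F G : nat -> E -> Qp) C C' n : 0 <= C -> 0 <= C' ->
  (forall m, tate C (F m)) -> (forall m, tate C' (G m)) ->
  tate (C * C') (fun z => conv (F^~ z) (G^~ z) n).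
Proof.
move=> C0 C'0 tF tG; apply: tate_sum => [|m _]; first exact: mulr_ge0.
exact: tateM.
Qed.

Lemma vderiv_conv (F G : nat -> E -> Qp) C C' n z : 0 <= C -> 0 <= C' ->
  (forall m, tate C (F m)) -> (forall m, tate C' (G m)) -> unit_ball z ->
  vderiv (fun z => conv (F^~ z) (G^~ z) n) z =
  conv (fun m => vderiv (F m) z) (G^~ z) n + conv (F^~ z) (fun m => vderiv (G m) z) n.
Proof.
move=> C0 C'0 tF tG hz; rewrite /conv.
rewrite (@vderiv_sum _ _ (fun (m : 'I_n.+1) z => F m z * G (n - m)%N z) (C * C')) //.
- by rewrite -big_split; apply: eq_bigr => m _; rewrite (vderivM (tF _) (tG _) hz).
- exact: mulr_ge0.
- by move=> m; exact: tateM.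
Qed.

(* p^2n / n! instead of 1 / n!: exp (p^2 D) converges on the unit ball. *)
Definition exp_coef n : Qp := (p%:R ^+ 2) ^+ n / n`!%:R.

Lemma exp_coefS n : n.+1%:R * exp_coef n.+1 = p%:R ^+ 2 * exp_coef n.
Proof.
have n0 := padic_nat_neq0 p_pr (ltn0Sn n); have f0 := padic_nat_neq0 p_pr (fact_gt0 n).
rewrite /exp_coef factS natrM exprS invfM.
move: (n.+1%:R) (n`!%:R) n0 f0 => a b a0 _.
have -> : a * (p%:R ^+ 2 * (p%:R ^+ 2) ^+ n * (a^-1 / b)) =
  (a * a^-1) * (p%:R ^+ 2 * ((p%:R ^+ 2) ^+ n / b)) by ring.
by rewrite divff // mul1r.
Qed.

Definition exp_term f n z : Qp := exp_coef n * iter n vderiv f z.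

(** The operator [exp (p^2 D)], that is, pullback by the flow at time [p^2]. The flow as a map
    enters only through the images of the coordinate functions. *)
Definition flow f z : Qp := nsum (fun n => exp_term f n z).

Lemma tate_iter_vderiv C f n : tate C f -> tate C (iter n vderiv f).
Proof. by move=> tf; elim: n => //= n; exact: tate_vderiv. Qed.

Lemma tate_exp_term C f n : tate C f -> tate (2^-1 ^+ n * C) (exp_term f n).
Proof.
move=> tf; have := tateZ (exp_coef n) (tate_iter_vderiv n tf); apply: tate_le.
by rewrite ler_wpM2r ?(tate_ge0 tf) // padic_norm_exp_coef.
Qed.

Lemma geom_small C (e : rat) : 0 <= C -> 0 < e ->
  exists A : {fset nat}, forall n, n \notin A -> 2^-1 ^+ n * C < e.
Proof.
move=> C0 e0; have C1 : 0 < C + 1 by rewrite ltr_wpDl.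
have [n hn] := half_expr_small (divr_gt0 e0 C1).
exists [fset m | m in iota 0 n]%fset => m; rewrite !inE mem_iota /= add0n -leqNgt => nm.
rewrite ltr_pdivlMr // in hn; apply: le_lt_trans hn.
apply: ler_pM => //; first by rewrite exprn_ge0 // invr_ge0.
  by apply: ler_wiXn2l; rewrite // invf_le1.
by rewrite lerDl.
Qed.

Lemma geom_le C n : 0 <= C -> 2^-1 ^+ n * C <= C :> rat.
Proof. by move=> C0; rewrite ler_piMl // exprn_ile1 ?invr_ge0 // invf_le1. Qed.

Lemma tate_exp_term1 C f n : tate C f -> tate C (exp_term f n).
Proof. by move=> tf; apply: tate_le (tate_exp_term n tf); exact/geom_le/(tate_ge0 tf). Qed.

Lemma tate_flow C f : tate C f -> tate C (flow f).
Proof.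
move=> tf; have C0 := tate_ge0 tf.
change (tate C (fun z => nsum (fun n => exp_term f n z))).
by apply: (tate_nsum C0 (fun n => tate_exp_term n tf)) => [n|e]; [exact: geom_le|exact: geom_small].
Qed.

Lemma pd_flow C f i z : tate C f -> unit_ball z ->
  pd i (flow f) z = nsum (fun n => pd i (exp_term f n) z).
Proof.
move=> tf hz; have C0 := tate_ge0 tf.
apply: (pd_nsum i C0 (fun n => tate_exp_term n tf)) => // [n|e]; first exact: geom_le.
exact: geom_small.
Qed.

Lemma null_exp_term C f z : tate C f -> unit_ball z -> null (fun n => exp_term f n z).
Proof.
move=> tf hz; apply: (null_tate_nsum (fun n => tate_exp_term n tf)) => // e.
exact: geom_small (tate_ge0 tf).
Qed.

Lemma null_pd_exp_term C f i z : tate C f -> unit_ball z ->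
  null (fun n => pd i (exp_term f n) z).
Proof.
move=> tf hz; apply: (null_tate_nsum (fun n => tate_pd i (tate_exp_term n tf))) => // e.
exact: geom_small (tate_ge0 tf).
Qed.

Lemma exp_termS C f n z : tate C f -> unit_ball z ->
  n.+1%:R * exp_term f n.+1 z = p%:R ^+ 2 * vderiv (exp_term f n) z.
Proof.
move=> tf hz; rewrite /exp_term mulrA exp_coefS -mulrA; congr (_ * _).
by rewrite (vderivZ _ (tate_iter_vderiv n tf) hz).
Qed.

Lemma pd_exp_termS C f i n z : tate C f -> unit_ball z ->
  n.+1%:R * pd i (exp_term f n.+1) z = p%:R ^+ 2 *
    (vderiv (pd i (exp_term f n)) z + \sum_k pd i (X k) z * pd k (exp_term f n) z).
Proof.
move=> tf hz; have tn := tate_exp_term1 n tf.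
rewrite -(pdZ n.+1%:R i (tate_exp_term1 n.+1 tf) hz) -(pd_vderiv i tn hz).
rewrite -(pdZ _ i (tate_vderiv tn) hz).
by apply: (eq_pd i (tateZ (p%:R ^+ 2) (tate_vderiv tn)) _ hz) => x hx; rewrite (exp_termS n tf hx).
Qed.

Lemma nsum_conv_null (u v : nat -> Qp) : null u -> null v ->
  null (conv u v) /\ nsum (conv u v) = nsum u * nsum v.
Proof.
by move=> nu nv; have [B _ hB] := null_bounded nv; exact: nsum_conv nu nv hB.
Qed.

Lemma exp_term0 f z : exp_term f 0 z = f z.
Proof. by rewrite /exp_term /exp_coef fact0 expr0 divr1 mul1r. Qed.

Lemma conv0 (u v : nat -> Qp) : conv u v 0 = u 0%N * v 0%N.
Proof. by rewrite /conv big_ord_recl big_ord0 addr0. Qed.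

(** The exponential of a derivation is multiplicative: the terms for the product and the Cauchy
    product of the two series obey the same recursion, in which [n.+1] can be cancelled. *)
Lemma flowM C C' f g z : tate C f -> tate C' g -> unit_ball z ->
  flow (fun z => f z * g z) z = flow f z * flow g z.
Proof.
move=> tf tg hz; have tfg := tateM tf tg.
have [_ <-] := nsum_conv_null (null_exp_term tf hz) (null_exp_term tg hz).
apply: eq_nsum => n; elim: n z hz => [|n ih] z hz; first by rewrite conv0 !exp_term0.
have C0 := tate_ge0 tf; have C'0 := tate_ge0 tg.
have ec m : tate C (exp_term f m) := tate_exp_term1 m tf.
have ed m : tate C' (exp_term g m) := tate_exp_term1 m tg.
apply: (mulfI (padic_nat_neq0 p_pr (ltn0Sn n))).
rewrite (exp_termS n tfg hz).
rewrite (conv_rec n (fun m => exp_termS m tf hz) (fun m => exp_termS m tg hz)).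
rewrite convZl convZr -mulrDr -(vderiv_conv n C0 C'0 ec ed hz); congr (_ * _).
apply: (eq_vderiv (tate_conv n C0 C'0 ec ed)) => // x hx.
by rewrite ih.
Qed.

Lemma flowD C C' f g z : tate C f -> tate C' g -> unit_ball z ->
  flow (fun z => f z + g z) z = flow f z + flow g z.
Proof.
move=> tf tg hz.
rewrite /flow -nsumD; [|exact: null_exp_term tf hz|exact: null_exp_term tg hz].
apply: eq_nsum => n; rewrite /exp_term -mulrDr; congr (_ * _).
elim: n z hz => [|n ih] z hz //=.
rewrite -(vderivD (tate_iter_vderiv n tf) (tate_iter_vderiv n tg) hz).
have tfg := tateD (tate_le (_ : C <= Num.max C C') tf) (tate_le (_ : C' <= Num.max C C') tg).
rewrite !le_max !lexx orbT in tfg.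
by apply/esym/(eq_vderiv (tate_iter_vderiv n (tfg isT isT))) => // x hx; rewrite ih.
Qed.

Lemma flow_cst c z : unit_ball z -> flow (fun=> c) z = c.
Proof.
move=> hz; have h n x : unit_ball x -> iter n.+1 vderiv (fun=> c) x = 0.
  elim: n x => [|n ih] x hx; first exact: vderiv_cst.
  have := eq_vderiv (tate0 p_pr l (lexx 0)) (fun y hy => esym (ih y hy)) hx.
  by rewrite vderiv_cst.
have [[|n]|_ ] := @nsum_fin _ _ _ (fun n => exp_term (fun=> c) n z) [fset 0%N]%fset.
- by rewrite inE.
- by move=> _; rewrite /exp_term h // mulr0.
by rewrite /flow => ->; rewrite big_seq_fset1 exp_term0.
Qed.

(** The derivation sends this coordinate to 1 and then to 0, so the exponential series has two
    terms. *)
Lemma flow_time i z : (forall z, unit_ball z -> X i z = 1) -> unit_ball z ->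
  flow (fun z => z 0 i) z = z 0 i + p%:R ^+ 2.
Proof.
move=> X1 hz; have h1 x : unit_ball x -> vderiv (fun z => z 0 i) x = 1.
  move=> hx; rewrite /vderiv (bigD1 i) //= pd_coord eqxx X1 // mulr1 big1 ?addr0 // => j ji.
  by rewrite pd_coord (negbTE ji) mulr0.
have h n x : unit_ball x -> iter n.+2 vderiv (fun z => z 0 i) x = 0.
  elim: n x => [|n ih] x hx.
    have := eq_vderiv (tate_cst l 1) (fun y hy => esym (h1 y hy)) hx.
    by rewrite vderiv_cst.
  have := eq_vderiv (tate0 p_pr l (lexx 0)) (fun y hy => esym (ih y hy)) hx.
  by rewrite vderiv_cst.
have [[|[|n]]|_ ] := @nsum_fin _ _ _ (fun n => exp_term (fun z => z 0 i) n z) [fset 0%N; 1%N]%fset.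
- by rewrite !inE.
- by rewrite !inE.
- by move=> _; rewrite /exp_term h // mulr0.
rewrite /flow => ->; rewrite big_fsetU1 ?inE //= big_seq_fset1 exp_term0.
by rewrite /exp_term /= h1 // /exp_coef factS fact0 muln1 divr1 expr1 mulr1.
Qed.

(** Components of the Lie derivative along [X] of the covariant 2-tensor with components [W i j]. *)
Definition lie (W : 'I_l -> 'I_l -> E -> Qp) i j z : Qp :=
  vderiv (W i j) z + \sum_k pd i (X k) z * W k j z + \sum_k pd j (X k) z * W i k z.

Lemma lie_0 i j z : lie (fun _ _ _ => 0) i j z = 0.
Proof.
transitivity (0 + 0 + 0 : Qp); last by rewrite !addr0.
congr (_ + _ + _); [exact: vderiv_cst| |].
  by apply: big1 => m _; exact: mulr0.
by apply: big1 => m _; exact: mulr0.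
Qed.

(* (exp L)(f dg dh) = (exp D f) d(exp D g) d(exp D h) for the Lie derivative L,
   and all the terms of exp L except the first vanish on an invariant tensor. *)
Lemma flow_lie_invariant (W : 'I_l -> 'I_l -> E -> Qp) C i j z :
  (forall i j, tate C (W i j)) ->
  (forall i j z, unit_ball z -> lie W i j z = 0) -> unit_ball z ->
  \sum_a \sum_b flow (W a b) z * pd i (flow (fun z => z 0 a)) z *
     pd j (flow (fun z => z 0 b)) z = W i j z.
Proof.
move=> tW lW hz.
have C0 : 0 <= C := tate_ge0 (tW i j).
pose x a : E -> Qp := fun z => z 0 a.
have tx a : tate 1 (x a) := tate_coord p_pr a.
pose U a b n := exp_term (W a b) n.
pose V a k n := pd k (exp_term (x a) n).
have tU a b n : tate C (U a b n) := tate_exp_term1 n (tW a b).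
have tV a k n : tate 1 (V a k n) := tate_pd k (tate_exp_term1 n (tx a)).
pose UV a b i' n z := conv ((U a b)^~ z) ((V a i')^~ z) n.
have tUV a b i' n : tate C (UV a b i' n).
  by have := tate_conv n C0 ler01 (tU a b) (tV a i'); rewrite mulr1.
pose UVV a b i' j' n z := conv ((UV a b i')^~ z) ((V b j')^~ z) n.
have tUVV a b i' j' n : tate C (UVV a b i' j' n).
  by have := tate_conv n C0 ler01 (tUV a b i') (tV b j'); rewrite mulr1.
(* [Q n] is the term of order [n] of the pulled-back tensor, a double Cauchy product of the series
   of a component and of two coordinate differentials. *)
pose Q n i' j' z := \sum_a \sum_b UVV a b i' j' n z.
have tQ n i' j' : tate C (Q n i' j').
  by apply: tate_sum => // a _; apply: tate_sum.
have nUV a b i' : null ((UV a b i')^~ z).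
  exact: (nsum_conv_null (null_exp_term (tW a b) hz) (null_pd_exp_term i' (tx a) hz)).1.
have sUV a b i' : nsum ((UV a b i')^~ z) = flow (W a b) z * pd i' (flow (x a)) z.
  rewrite (pd_flow i' (tx a) hz).
  exact: (nsum_conv_null (null_exp_term (tW a b) hz) (null_pd_exp_term i' (tx a) hz)).2.
have nUVV a b : null ((UVV a b i j)^~ z).
  exact: (nsum_conv_null (nUV a b i) (null_pd_exp_term j (tx b) hz)).1.
have sUVV a b : nsum ((UVV a b i j)^~ z) =
    flow (W a b) z * pd i (flow (x a)) z * pd j (flow (x b)) z.
  rewrite -sUV (pd_flow j (tx b) hz).
  exact: (nsum_conv_null (nUV a b i) (null_pd_exp_term j (tx b) hz)).2.
rewrite (eq_bigr (fun a => \sum_b nsum ((UVV a b i j)^~ z))); last first.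
  by move=> a _; apply: eq_bigr => b _; rewrite sUVV.
rewrite (eq_bigr (fun a => nsum (fun n => \sum_b UVV a b i j n z))); last first.
  by move=> a _; have [_ ->] := nsum_sum (index_enum 'I_l) (nUVV a).
have n2 a : null (fun n => \sum_b UVV a b i j n z).
  by have [] := nsum_sum (index_enum 'I_l) (nUVV a).
have [_ <-] := nsum_sum (index_enum 'I_l) n2.
have Q0 i' j' y : unit_ball y -> Q 0%N i' j' y = W i' j' y.
  move=> hy; have hV a k : V a k 0%N y = (k == a)%:R.
    have -> : V a k 0%N = pd k (x a).
      by rewrite /V (_ : exp_term (x a) 0 = x a) //; apply/funext => u; rewrite exp_term0.
    by rewrite /x pd_coord.
  rewrite /Q (bigD1 i') //= (bigD1 j') //= big1 => [|b bj]; last first.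
    by rewrite /UVV conv0 hV eq_sym (negbTE bj) mulr0.
  rewrite big1 => [|a ai]; last first.
    by rewrite big1 // => b _; rewrite /UVV conv0 /UV conv0 !hV eq_sym (negbTE ai) mulr0 mul0r.
  by rewrite /UVV conv0 /UV conv0 !hV !eqxx /U exp_term0 !mulr1 !addr0.
(* The derivatives of [X] produced by the two differentials complete the derivative of the product
   to the Lie derivative of [Q n]. *)
have QS n i' j' y : unit_ball y -> n.+1%:R * Q n.+1 i' j' y = p%:R ^+ 2 * lie (Q n) i' j' y.
  move=> hy.
  have recU a b m : m.+1%:R * U a b m.+1 y = p%:R ^+ 2 * vderiv (U a b m) y.
    exact: (exp_termS m (tW a b) hy).
  have recV a k m : m.+1%:R * V a k m.+1 y = p%:R ^+ 2 *
      (vderiv (V a k m) y + \sum_c pd k (X c) y * V a c m y).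
    exact: (pd_exp_termS k m (tx a) hy).
  have recUV a b k m : m.+1%:R * UV a b k m.+1 y = p%:R ^+ 2 *
      (vderiv (UV a b k m) y + \sum_c pd k (X c) y * UV a b c m y).
    have -> := @conv_rec ((U a b)^~ y) ((V a k)^~ y) _ _ m (recU a b) (recV a k).
    rewrite convZl convZr convDr conv_linr -mulrDr addrA.
    by rewrite (vderiv_conv m C0 ler01 (tU a b) (tV a k) hy).
  have recUVV a b m : m.+1%:R * UVV a b i' j' m.+1 y = p%:R ^+ 2 *
      (vderiv (UVV a b i' j' m) y + \sum_c pd i' (X c) y * UVV a b c j' m y +
       \sum_c pd j' (X c) y * UVV a b i' c m y).
    rewrite (vderiv_conv m C0 ler01 (tUV a b i') (tV b j') hy).
    exact: (@conv_rec_lin _ _ _ ((UV a b i')^~ y) _ ((V b j')^~ y) _ _ _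
      (fun c m => UV a b c m y) (fun c m => V b c m y) m (recUV a b i') (recV b j')).
  rewrite /Q mulr_sumr (eq_bigr (fun a => p%:R ^+ 2 * \sum_b
      (vderiv (UVV a b i' j' n) y + \sum_c pd i' (X c) y * UVV a b c j' n y +
       \sum_c pd j' (X c) y * UVV a b i' c n y))); last first.
    by move=> a _; rewrite !mulr_sumr; apply: eq_bigr => b _; rewrite recUVV.
  rewrite -mulr_sumr; congr (_ * _); rewrite /lie.
  have tQa a i'' j'' : tate C (fun y => \sum_b UVV a b i'' j'' n y) by apply: tate_sum.
  rewrite (vderiv_sum _ C0 (fun a => tQa a i' j') hy).
  under eq_bigr do rewrite !big_split /=.
  rewrite !big_split /=; congr (_ + _ + _).
  - by apply: eq_bigr => a _; rewrite (vderiv_sum _ C0 (fun b => tUVV a b i' j' n) hy).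
  - under eq_bigr do rewrite exchange_big /=.
    rewrite exchange_big /=; apply: eq_bigr => c _; rewrite mulr_sumr.
    by apply: eq_bigr => a _; rewrite mulr_sumr.
  - under eq_bigr do rewrite exchange_big /=.
    rewrite exchange_big /=; apply: eq_bigr => c _; rewrite mulr_sumr.
    by apply: eq_bigr => a _; rewrite mulr_sumr.
have eq_lie T T' C' i' j' y : (forall i j, tate C' (T i j)) ->
    (forall i j y, unit_ball y -> T i j y = T' i j y) -> unit_ball y ->
    lie T' i' j' y = lie T i' j' y.
  move=> tT TT hy; rewrite /lie (eq_vderiv (tT i' j') (TT i' j') hy).
  by congr (_ + _ + _); apply: eq_bigr => c _; rewrite TT.
(* [Q 0] is [W], whose Lie derivative vanishes, so the recursion kills every later term. *)
have Qn n i' j' y : unit_ball y -> Q n.+1 i' j' y = 0.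
  elim: n i' j' y => [|n ih] i' j' y hy; apply/eqP.
    have := QS 0%N i' j' y hy.
    rewrite (eq_lie W (Q 0%N) C i' j' y tW (fun i j y hy => esym (Q0 i j y hy)) hy).
    by rewrite lW // mulr0 mul1r => ->.
  have := QS n.+1 i' j' y hy.
  rewrite (eq_lie (fun _ _ _ => 0) (Q n.+1) 0 i' j' y
    (fun _ _ => tate0 p_pr l (lexx 0)) (fun i j y hy => esym (ih i j y hy)) hy).
  by rewrite lie_0 mulr0; move/eqP; rewrite mulf_eq0 (negbTE (padic_nat_neq0 _ _)) => // /eqP ->.
have [[|n]|_ ->] := @nsum_fin _ _ _ (fun n => Q n i j z) [fset 0%N]%fset.
- by rewrite inE.
- by move=> _; rewrite Qn.
by rewrite big_seq_fset1 Q0.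
Qed.

End Flow.

(** * Moser path *)

Section LocalDarboux.
Variables (p : nat) (p_pr : prime p).
Local Notation Qp := (padic p_pr).
Local Notation N := (@padic_norm p p_pr).

(** Cartan's formula in coordinates: the Lie derivative is the contraction of [dW] plus the
    differential of the contraction of [W], and both vanish here. *)
Lemma lie_closed_kernel l (X : 'I_l -> 'rV[Qp]_l -> Qp) (W : 'I_l -> 'I_l -> 'rV[Qp]_l -> Qp)
    C i j z :
  (forall i, tate 1 (X i)) -> (forall i j, tate C (W i j)) ->
  (forall i j z, unit_ball z -> W i j z = - W j i z) ->
  (forall i j k z, unit_ball z -> pd i (W j k) z + pd j (W k i) z + pd k (W i j) z = 0) ->
  (forall j z, unit_ball z -> \sum_k X k z * W k j z = 0) -> unit_ball z ->
  lie X W i j z = 0.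
Proof.
move=> tX tW anti closed ker hz; have C0 := tate_ge0 (tW i j).
(* Differentiating the kernel relation trades the derivatives of [X] for those of [W]. *)
have dker a b : \sum_k pd a (X k) z * W k b z = - \sum_k X k z * pd a (W k b) z.
  apply/eqP; rewrite -addr_eq0 -big_split /=; apply/eqP.
  have t k : tate C (fun z => X k z * W k b z) by exact: tate1M.
  have := eq_pd a (tate0 p_pr l (lexx 0)) (fun x hx => esym (ker b x hx)) hz.
  rewrite pd_cst (pd_sum _ a C0 (fun k _ => t k) hz) => e; rewrite -[RHS]e.
  by apply: eq_bigr => k _; rewrite (pdM a (tX k) (tW k b) hz).
have pdN a b c : pd a (W b c) z = - pd a (W c b) z.
  rewrite -mulN1r -(pdZ _ a (tW c b) hz).
  apply: (eq_pd a (tateZ (-1) (tW c b)) _ hz) => x hx.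
  by rewrite mulN1r -anti.
rewrite /lie dker.
rewrite [X in _ + _ + X](eq_bigr (fun k => - (pd j (X k) z * W k i z))); last first.
  by move=> k _; rewrite (anti i k z hz) mulrN.
rewrite sumrN dker opprK /vderiv -sumrB -big_split /= big1 // => k _.
have := closed k i j z hz; rewrite (pdN i k j) => h.
rewrite -mulrBr -mulrDr (_ : _ - _ + _ = 0) ?mulr0 // -[RHS]h.
by rewrite (pdN i j k); ring.
Qed.

(* Neumann series: X is the sum of the iterates of v |-> v M, which contracts. *)
Lemma tate_neumann l l' (v : 'I_l' -> 'rV[Qp]_l -> Qp) (M : 'I_l' -> 'I_l' -> 'rV[Qp]_l -> Qp) :
  (forall j, tate 1 (v j)) -> (forall i j, tate 2^-1 (M i j)) ->
  exists X : 'I_l' -> 'rV[Qp]_l -> Qp, (forall j, tate 1 (X j)) /\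
    forall j z, unit_ball z -> X j z = v j z + \sum_k X k z * M k j z.
Proof.
move=> tv tM.
have [F [F0 FS]] : exists F : nat -> 'I_l' -> 'rV[Qp]_l -> Qp,
    F 0%N = v /\ forall n, F n.+1 = fun j z => \sum_k F n k z * M k j z.
  by exists (fix F n := if n is m.+1 then fun j z => \sum_k F m k z * M k j z else v).
have tF n j : tate (2^-1 ^+ n * 1) (F n j).
  elim: n j => [|n ih] j; first by rewrite F0 mulr1 expr0.
  rewrite FS; apply: tate_sum => [|k _]; first by rewrite mulr1 exprn_ge0 // invr_ge0.
  by rewrite mulr1 exprSr; apply: tateM => //; have := ih k; rewrite mulr1.
have nF j z : unit_ball z -> null (fun n => F n j z).
  by move=> hz; apply: (null_tate_nsum (fun n => tF n j)) => // e; exact: geom_small.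
exists (fun j z => nsum (fun n => F n j z)); split=> [j|j z hz].
  by apply: (tate_nsum ler01 (fun n => tF n j)) => [n|e]; [exact: geom_le|exact: geom_small].
have nS : null (fun n => F n.+1 j z).
  move=> e e0; have [A hA] := nF j z hz e e0.
  exists [fset n.-1 | n in A]%fset => n h; apply: hA; apply: contra h => h.
  by apply/imfsetP; exists n.+1.
have -> : \sum_k nsum (fun n => F n k z) * M k j z = nsum (fun n => F n.+1 j z).
  have h k : null (fun n => M k j z * F n k z) by apply/nullZ/nF.
  have [_ e] := nsum_sum (index_enum 'I_l') h.
  transitivity (\sum_k nsum (fun n => M k j z * F n k z)).
    by apply: eq_bigr => k _; rewrite (nsumZ _ (nF k z hz)) mulrC.
  by rewrite -e; apply: eq_nsum => n; rewrite FS; apply: eq_bigr => k _; rewrite mulrC.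
apply: nsum_eqP (nF j z hz) _ => e e0.
(* [n] exceeds every index in [A]. The first [n + 1] terms of [F] minus [v] are the first [n] terms
   of the shifted family, so the two index sets differ by one. *)
have [A hA] := nF j z hz e e0; pose n := (\max_(i <- A) i).+1.
have out m : (n <= m)%N -> N (F m j z) <= e.
  move=> nm; apply/ltW/hA; apply/negP => mA; move: nm; rewrite ltnNge.
  by rewrite (@leq_bigmax_seq _ _ xpredT id m).
exists [fset m | m in iota 0 n.+1]%fset.
have outS m : m \notin [fset m | m in iota 0 n.+1]%fset -> (n < m)%N.
  by rewrite mem_fset_iota ltnS -ltnNge.
split=> [m /outS/ltnW/out //|].
rewrite big_fset_iota big_ord_recl F0 opprD addrACA subrr add0r.
have := @nsum_approx p p_pr _ (fun m => F m.+1 j z) [fset m | m in iota 0 n]%fset e nS (ltW e0).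
rewrite big_fset_iota; apply=> m.
by rewrite mem_fset_iota -leqNgt => nm; apply: out; exact: leqW.
Qed.

(** The smallness [delta * kappa <= 2^-1] makes the equation for [Y] a contraction, so the field has
    Gauss norm at most 1, as the exponential requires. [G] is the flow at time [p^2] restricted to
    the slice [s = 0]. *)
Lemma tate_darboux l (Om K : 'M[Qp]_l) (beta : 'I_l -> 'I_l -> 'rV[Qp]_l -> Qp)
    (gamma : 'I_l -> 'rV[Qp]_l -> Qp) (kappa delta : rat) :
  Om^T = - Om -> K *m Om = 1%:M -> (forall i j, N (K i j) <= kappa) ->
  0 <= delta -> delta <= 1 -> delta * kappa <= 2^-1 ->
  (forall i, tate delta (gamma i)) -> (forall i j, tate delta (beta i j)) ->
  (forall i j z, unit_ball z -> pd i (gamma j) z - pd j (gamma i) z = beta i j z) ->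
  exists G : 'I_l -> 'rV[Qp]_l -> Qp, (forall i, tate 2^-1 (fun z => G i z - z 0 i)) /\
    forall i j z, unit_ball z ->
      \sum_a \sum_b Om a b * pd i (G a) z * pd j (G b) z = Om i j - p%:R ^+ 2 * beta i j z.
Proof.
move=> OmT KOm Kk delta0 delta1 dk tg tb dg.
have [C C0 hC] : exists2 C : rat, 1 <= C & forall i j, N (Om i j) <= C.
  have [C C0 hC] := fin_rat_bound (fun u : 'I_l * 'I_l => N (Om u.1 u.2)).
  exists (Num.max 1 C); first by rewrite le_max lexx.
  by move=> i j; rewrite le_max (hC (i, j)) orbT.
have C1 : 0 <= C by apply: le_trans C0.
set eps : Qp := p%:R ^+ 2.
have eps1 : N eps <= 1.
  exact: padic_norm_pX_le1.
pose L := (1 + l)%N; pose s0 : 'I_L := lshift l 0; pose rs (i : 'I_l) : 'I_L := rshift 1 i.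
pose pr (w : 'rV[Qp]_L) : 'rV[Qp]_l := rsubmx w.
have prE w i : pr w 0 i = w 0 (rs i) by rewrite mxE.
have tpr : tate_map pr.
  by move=> i; apply: eq_tate (tate_coord p_pr (rs i)) => w _; rewrite prE.
have prB w : unit_ball w -> unit_ball (pr w) by exact: tate_map_ball tpr.
have half1 : 2^-1 <= 1 :> rat by rewrite invf_le1.
have pdpr D f i w : tate D f -> unit_ball w ->
    pd (rs i) (f \o pr) w = pd i f (pr w) /\ pd s0 (f \o pr) w = 0.
  move=> tf hw; rewrite !(pd_comp _ tf tpr hw).
  have pdw a b : pd a (fun z => pr z 0 b) w = (a == rs b)%:R.
    by rewrite -(pd_coord a (rs b) w); apply: pd_ext => x; rewrite prE.
  split; last by rewrite big1 // => k _; rewrite pdw eq_lrshift mul0r.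
  rewrite (bigD1 i) //= pdw eqxx mul1r big1 ?addr0 // => k ki.
  by rewrite pdw eq_rshift eq_sym (negbTE ki) mul0r.
(* [t] is [- p^2] on the slice [s = 0] and 0 on the slice [s = p^2], the two ends of the path. *)
pose t (w : 'rV[Qp]_L) := w 0 s0 - eps.
have tt : tate 1 t by apply: tateB (tate_coord p_pr s0) _; exact: tate_le eps1 (tate_cst _ _).
pose bt i j (w : 'rV[Qp]_L) := beta i j (pr w).
have tbt i j : tate delta (bt i j) := tate_comp (tb i j) tpr.
pose gt i (w : 'rV[Qp]_L) := gamma i (pr w).
have tgt i : tate delta (gt i) := tate_comp (tg i) tpr.
have cst1 (c : Qp) : N c <= 1 -> tate 1 (fun _ : 'rV[Qp]_L => c).
  by move=> c1; exact: tate_le c1 (tate_cst _ _).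
(* Multiplying the wanted relation [Y (Om + t beta) = - gamma] on the right by [K], the inverse of
   [Om], turns it into this fixed-point equation. *)
have [Y [tY hY]] : exists Y : 'I_l -> 'rV[Qp]_L -> Qp, (forall j, tate 1 (Y j)) /\
    forall j w, unit_ball w -> Y j w = - (\sum_k gt k w * K k j) +
      \sum_k Y k w * (- (t w * \sum_b bt k b w * K b j)).
  apply: (@tate_neumann L l (fun j w => - (\sum_k gt k w * K k j))
     (fun k j w => - (t w * \sum_b bt k b w * K b j))) => [j|i j].
    apply: tateN; apply: tate_sum => // k _; apply: tate_le (le_trans dk half1) _.
    by apply: tateM => //; exact: tate_le (Kk k j) (tate_cst _ _).
  apply: tateN; apply: tate1M => //; apply: tate_sum => [|b _]; first by rewrite invr_ge0.
  by apply: tate_le dk _; apply: tateM => //; exact: tate_le (Kk b j) (tate_cst _ _).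
pose om i j (w : 'rV[Qp]_L) := Om i j + t w * bt i j w.
have cstC i j : tate C (fun _ : 'rV[Qp]_L => Om i j) by exact: tate_le (hC i j) (tate_cst _ _).
have tom i j : tate C (om i j).
  apply: tateD => //; apply: tate1M => //; apply: tate_le (tbt i j).
  exact: le_trans delta1 C0.
have Yom j w : unit_ball w -> \sum_i Y i w * om i j w = - gt j w.
  move=> hw.
  have e1 : \sum_i Y i w * Om i j = - gt j w - t w * \sum_k Y k w * bt k j w.
    rewrite (eq_bigr (fun i => - (\sum_k gt k w * K k i * Om i j) -
        t w * \sum_k Y k w * \sum_b bt k b w * K b i * Om i j)); last first.
      move=> i _; rewrite (hY i w hw) mulrDl mulNr; congr (_ + _); first by rewrite mulr_suml.
      rewrite mulr_suml mulr_sumr -sumrN; apply: eq_bigr => k _.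
      by rewrite -[in RHS]mulr_suml; ring.
    have KO b : \sum_i K b i * Om i j = (b == j)%:R.
      by have := congr1 (fun A : 'M_l => A b j) KOm; rewrite !mxE.
    have s1 (c : 'I_l -> Qp) : \sum_i \sum_b c b * K b i * Om i j = c j.
      rewrite exchange_big /= (eq_bigr (fun b => c b * (b == j)%:R)) => [|b _]; last first.
        by rewrite -KO mulr_sumr; apply: eq_bigr => i _; rewrite mulrA.
      rewrite (bigD1 j) //= eqxx mulr1 big1 ?addr0 // => b /negbTE ->.
      by rewrite mulr0.
    rewrite big_split /= sumrN s1 sumrN -mulr_sumr; congr (- _ - t w * _).
    rewrite exchange_big /=; apply: eq_bigr => k _; rewrite -mulr_sumr; congr (_ * _).
    exact: s1.
  rewrite /om (eq_bigr (fun i => Y i w * Om i j + t w * (Y i w * bt i j w))).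
    by rewrite big_split /= e1 -mulr_sumr subrK.
  by move=> i _; ring.
have Omanti i j : Om i j = - Om j i.
  by have := congr1 (fun A : 'M_l => A j i) OmT; rewrite !mxE.
have banti i j z : unit_ball z -> beta i j z = - beta j i z.
  by move=> hz; rewrite -!dg // opprB.
have omanti i j w : unit_ball w -> om i j w = - om j i w.
  by move=> hw; rewrite /om (Omanti i j) /bt (banti i j _ (prB w hw)); ring.
(* The closed form om + gamma /\ ds, whose kernel contains d/ds + Y. *)
pose W (i j : 'I_L) (w : 'rV[Qp]_L) : Qp := match fintype.split i, fintype.split j with
  | inl _, inl _ => 0 | inl _, inr j' => gt j' w
  | inr i', inl _ => - gt i' w | inr i', inr j' => om i' j' w end.
pose X (i : 'I_L) (w : 'rV[Qp]_L) : Qp := match fintype.split i with inl _ => 1 | inr i' => Y i' w end.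
have splitl (i : 'I_1) : fintype.split (lshift l i) = inl i by exact: (unsplitK (inl i)).
have splitr (i : 'I_l) : fintype.split (rshift 1 i) = inr i by exact: (unsplitK (inr i)).
have Wss w : W s0 s0 w = 0 by rewrite /W !splitl.
have Wsr j w : W s0 (rs j) w = gt j w by rewrite /W splitl splitr.
have Wrs j w : W (rs j) s0 w = - gt j w by rewrite /W splitl splitr.
have Wrr i j w : W (rs i) (rs j) w = om i j w by rewrite /W !splitr.
have Xs w : X s0 w = 1 by rewrite /X splitl.
have Xr i w : X (rs i) w = Y i w by rewrite /X splitr.
have caseL (P : 'I_L -> Prop) : P s0 -> (forall i, P (rs i)) -> forall i, P i.
  move=> h0 hr i; rewrite -(splitK i); case: (fintype.split i) => a /=; last exact: hr.
  by rewrite (ord1 a).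
have sumL (F : 'I_L -> Qp) : \sum_i F i = F s0 + \sum_i F (rs i).
  by rewrite big_split_ord /= big_ord_recl big_ord0 addr0.
have tX i : tate 1 (X i).
  elim/caseL: i => [|i]; rewrite /X ?splitl ?splitr //.
  by apply: cst1; rewrite padic_norm1.
have tgtC i : tate C (gt i) by apply: tate_le (tgt i); exact: le_trans delta1 C0.
have tW i j : tate C (W i j).
  elim/caseL: i => [|i]; elim/caseL: j => [|j]; rewrite /W ?splitl ?splitr //.
    exact: tate0.
  exact: tateN.
have Wanti i j w : unit_ball w -> W i j w = - W j i w.
  move=> hw; elim/caseL: i => [|i]; elim/caseL: j => [|j];
    rewrite ?Wss ?Wsr ?Wrs ?Wrr ?oppr0 ?opprK //.
  exact: omanti.
have Wker j w : unit_ball w -> \sum_k X k w * W k j w = 0.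
  move=> hw; rewrite sumL Xs mul1r; under eq_bigr do rewrite Xr.
  elim/caseL: j => [|j].
    rewrite Wss add0r; under eq_bigr do rewrite Wrs.
    (* The component of the kernel relation along [s] is the value of the antisymmetric [om] on the
       pair [(Y, Y)], hence equals its own opposite. *)
    set S := \sum_i _; suff SS : S + S = 0.
      have := padic_nat_neq0 p_pr (ltn0Sn 1); move/mulfI; apply.
      by rewrite mulr0 -SS; ring.
    have e : S = \sum_i Y i w * \sum_k Y k w * om k i w.
      by apply: eq_bigr => i _; rewrite Yom.
    rewrite {1}e; have -> : S = \sum_i \sum_k Y i w * (Y k w * om k i w).
      by rewrite e; apply: eq_bigr => i _; rewrite mulr_sumr.
    rewrite exchange_big /= -big_split big1 //= => i _; rewrite mulr_sumr -big_split big1 //= => k _.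
    by rewrite (omanti k i w hw); ring.
  by rewrite Wsr; under eq_bigr do rewrite Wrr; rewrite Yom // addrN.
have pdt a w : unit_ball w -> pd a t w = (a == s0)%:R.
  by move=> hw; rewrite /t (pdB a (tate_coord p_pr s0) (cst1 eps eps1) hw) pd_cst pd_coord subr0.
have Wclosed i j k w : unit_ball w ->
    pd i (W j k) w + pd j (W k i) w + pd k (W i j) w = 0.
  move=> hw.
  have dom a i' j' : pd a (om i' j') w = pd a t w * bt i' j' w + t w * pd a (bt i' j') w.
    rewrite /om (pdD a (cstC i' j') (tateM tt (tbt i' j')) hw) pd_cst add0r.
    exact: (pdM a tt (tbt i' j') hw).
  have dom0 i' j' : pd s0 (om i' j') w = bt i' j' w.
    by rewrite dom (pdpr _ _ i' _ (tb i' j') hw).2 mulr0 addr0 (pdt _ _ hw) eqxx mul1r.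
  have domr a i' j' : pd (rs a) (om i' j') w = t w * pd a (beta i' j') (pr w).
    by rewrite dom (pdpr _ _ a _ (tb i' j') hw).1 (pdt _ _ hw) eq_rlshift mul0r add0r.
  have dgt a i' : pd (rs a) (gt i') w = pd a (gamma i') (pr w) /\ pd s0 (gt i') w = 0.
    by apply: (pdpr _ _ _ _ (tg i') hw).
  have Es0 a : pd a (W s0 s0) w = 0.
    by rewrite -(pd_cst 0 a w); apply: pd_ext => x; rewrite Wss.
  have Esr a j' : pd a (W s0 (rs j')) w = pd a (gt j') w.
    by apply: pd_ext => x; rewrite Wsr.
  have Ers a j' : pd a (W (rs j') s0) w = - pd a (gt j') w.
    have -> : W (rs j') s0 = (fun x => -1 * gt j' x) by apply/funext => x; rewrite Wrs mulN1r.
    by rewrite (pdZ _ a (tgt j') hw) mulN1r.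
  have Err a i' j' : pd a (W (rs i') (rs j')) w = pd a (om i' j') w.
    by apply: pd_ext => x; rewrite Wrr.
  have dbeta a i' j' : pd a (beta i' j') (pr w) =
      pd a (pd i' (gamma j')) (pr w) - pd a (pd j' (gamma i')) (pr w).
    rewrite -(pdB a (tate_pd i' (tg j')) (tate_pd j' (tg i')) (prB w hw)).
    apply: (eq_pd a (tateB (tate_pd i' (tg j')) (tate_pd j' (tg i'))) _ (prB w hw)) => x hx.
    by rewrite dg.
  have dgp a b := dg a b _ (prB w hw).
  (* With at least two indices equal to [s0] the terms cancel formally; with exactly one, this is
     [d gamma = beta], as [bt] is the [s]-derivative of [om]; with none, it is the symmetry of the
     second derivatives of [gamma]. *)
  elim/caseL: i => [|i]; elim/caseL: j => [|j]; elim/caseL: k => [|k];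
    rewrite ?Es0 ?Esr ?Ers ?Err ?dom0 ?domr ?(dgt _ _).1 ?(dgt i _).2 ?(dgt j _).2 ?(dgt k _).2.
  - by rewrite !addr0.
  - by ring.
  - by ring.
  - by rewrite /bt -dgp; ring.
  - by ring.
  - by rewrite /bt -dgp; ring.
  - by rewrite /bt -dgp; ring.
  - rewrite !dbeta (pdC i j (tg k) (prB w hw)) (pdC i k (tg j) (prB w hw)).
    rewrite (pdC j k (tg i) (prB w hw)).
    move: (pd j (pd i _) _) (pd k (pd i _) _) (pd k (pd j _) _) (t w) => a b c e.
    by ring.
have lW i j w : unit_ball w -> lie X W i j w = 0.
  by move=> hw; apply: (lie_closed_kernel i j tX tW).
pose io (z : 'rV[Qp]_l) : 'rV[Qp]_L := row_mx 0 z.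
have ios z : io z 0 s0 = 0 by rewrite row_mxEl mxE.
have ior z i : io z 0 (rs i) = z 0 i by rewrite row_mxEr.
have tio : tate_map io.
  move=> i; elim/caseL: i => [|i].
    by apply: eq_tate (tate0 p_pr l ler01) => z _; rewrite ios.
  by apply: eq_tate (tate_coord p_pr i) => z _; rewrite ior.
have ioB z : unit_ball z -> unit_ball (io z) by exact: tate_map_ball tio.
have prio z : pr (io z) = z by rewrite /pr row_mxKr.
pose x a : 'rV[Qp]_L -> Qp := fun w => w 0 a.
have tx a : tate 1 (x a) := tate_coord p_pr a.
have tfx a := tate_flow tX (tx a).
exists (fun a z => flow X (x (rs a)) (io z)); split=> [a|i j z hz].
  (* The term of order 0, which is the coordinate itself, is removed; the others have Gauss norm at
     most 1/2. *)
  pose c n : rat := if n is 0%N then 0 else 2^-1 ^+ n * 1.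
  pose F n w : Qp := if n is 0%N then 0 else exp_term X (x (rs a)) n w.
  have tF n : tate (c n) (F n).
    case: n => [|n]; first exact: tate0.
    exact: (tate_exp_term tX n.+1 (tx (rs a))).
  have h : tate 2^-1 (fun w => nsum (fun n => F n w)).
    apply: (tate_nsum _ tF) => [|[|n]|e e0]; rewrite ?invr_ge0 //=.
      by rewrite mulr1 exprS ler_piMr ?invr_ge0 // exprn_ile1 ?invr_ge0.
    have [A hA] := geom_small ler01 e0; exists A => -[|n] //; exact: hA.
  apply: eq_tate (tate_comp h tio) => z hz /=.
  have hw := ioB z hz.
  have nu := null_exp_term tX (tx (rs a)) hw.
  have nF : null (fun n => F n (io z)).
    by apply: null_dom nu _ => -[|n] //=; rewrite padic_norm0 padic_norm_ge0.
  have [|n1 e1] := @nsum_fin _ _ _ (fun n => if n == 0%N then z 0 a else 0) [fset 0%N]%fset.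
    by move=> n; rewrite inE => /negbTE ->.
  rewrite big_seq_fset1 eqxx in e1.
  have -> : flow X (x (rs a)) (io z) = nsum (fun n => (if n == 0%N then z 0 a else 0) + F n (io z)).
    by apply: eq_nsum => -[|n] /=; rewrite ?add0r // addr0 exp_term0 /x ior.
  by rewrite (nsumD n1 nF) e1 [RHS]addrAC subrr add0r.
have hw := ioB z hz.
have pdG k a : pd k (fun z => flow X (x (rs a)) (io z)) z = pd (rs k) (flow X (x (rs a))) (io z).
  have := pd_comp k (tfx (rs a)) tio hz; rewrite sumL /= => ->.
  have -> : pd k (fun z => io z 0 s0) z = 0.
    by rewrite -(pd_cst 0 k z); apply: pd_ext => y; rewrite ios.
  have E b : pd k (fun z => io z 0 (rs b)) z = (k == b)%:R.
    by rewrite -(pd_coord k b z); apply: pd_ext => y; rewrite ior.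
  rewrite mul0r add0r (bigD1 k) //= E eqxx mul1r big1 ?addr0 // => b bk.
  by rewrite E eq_sym (negbTE bk) mul0r.
(* The time coordinate of the flow is [s + p^2], independent of [z], so the components of [W] along
   [ds] drop out of the pullback. *)
have Fs k : pd (rs k) (flow X (x s0)) (io z) = 0.
  have h y : unit_ball y -> y 0 s0 + p%:R ^+ 2 = flow X (x s0) y.
    by move=> hy; rewrite (flow_time (fun u _ => Xs u) hy).
  rewrite (eq_pd (rs k) (tateD (tx s0) (cst1 eps eps1)) h hw).
  by rewrite (pdD (rs k) (tx s0) (cst1 eps eps1) hw) pd_cst pd_coord eq_rlshift addr0.
(* The flow carries the slice [s = 0] to [s = p^2], where [t] vanishes and only the constant part
   [Om] remains. *)
have FW a b : flow X (W (rs a) (rs b)) (io z) = Om a b.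
  have -> : W (rs a) (rs b) = (fun w => Om a b + t w * bt a b w).
    by apply/funext => w; rewrite Wrr.
  rewrite (flowD tX (cstC a b) (tateM tt (tbt a b)) hw) (flow_cst _ _ hw).
  rewrite (flowM tX tt (tbt a b) hw).
  have -> : flow X t (io z) = 0; last by rewrite mul0r addr0.
  rewrite /t (flowD tX (tx s0) (tateN (cst1 eps eps1)) hw) (flow_cst _ _ hw).
  by rewrite (flow_time (fun u _ => Xs u) hw) ios add0r subrr.
have inv : \sum_a \sum_b flow X (W a b) (io z) * pd (rs i) (flow X (x a)) (io z) *
    pd (rs j) (flow X (x b)) (io z) = W (rs i) (rs j) (io z).
  exact: (flow_lie_invariant tX (rs i) (rs j) tW lW hw).
rewrite Wrr /om /t ios sub0r mulNr /bt prio in inv; rewrite -inv [RHS]sumL.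
have z0 : \sum_b flow X (W s0 b) (io z) * pd (rs i) (flow X (x s0)) (io z) *
    pd (rs j) (flow X (x b)) (io z) = 0.
  by apply: big1 => b _; rewrite [X in _ * X * _](Fs i) mulr0 mul0r.
rewrite [X in _ = X + _]z0 add0r; apply: eq_bigr => a _.
rewrite [RHS]sumL [X in _ = _ * X + _](Fs j).
rewrite [X in _ = X + _]mulr0.
rewrite [RHS]add0r.
apply: eq_bigr => b _.
exact: (congr2 *%R (congr2 *%R (esym (FW a b)) (pdG i a)) (pdG j b)).
Qed.

End LocalDarboux.

(** * Inversion of maps close to the identity *)

Section Inverse.
Variables (p : nat) (p_pr : prime p) (l : nat).
Local Notation Qp := (padic p_pr).
Local Notation N := (@padic_norm p p_pr).
Local Notation E := 'rV[Qp]_l.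

Definition near_id (G : E -> E) := forall i, tate 2^-1 (fun z => G z 0 i - z 0 i).

Let half1 : 2^-1 <= 1 :> rat.
Proof. by rewrite invf_le1. Qed.

Let half0 n : 0 <= 2^-1 ^+ n :> rat.
Proof. by rewrite exprn_ge0 // invr_ge0. Qed.

Lemma near_id_tate G : near_id G -> tate_map G.
Proof.
move=> hG i; apply: eq_tate (tateD (tate_le half1 (hG i)) (tate_coord p_pr i)) => z _.
by rewrite subrK.
Qed.

Lemma padic_norm_small0 (x : Qp) : (forall n, N x <= 2^-1 ^+ n) -> x = 0.
Proof.
move=> h; apply/eqP/negPn/negP => /padic_norm_gt0 /half_expr_small[n hn].
by have := le_lt_trans (h n) hn; rewrite ltxx.
Qed.

(** Points with the same image differ by a difference of displacements, which is at most half as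
    large; iteration leaves only 0. *)
Lemma near_id_inj G (z w : E) : near_id G -> unit_ball z -> unit_ball w -> G z = G w -> z = w.
Proof.
move=> hG hz hw Gzw; apply/rowP => i; apply/eqP; rewrite -subr_eq0; apply/eqP.
apply: padic_norm_small0 => n; elim: n i => [|n ih] i.
  by apply: padic_normB; rewrite ?expr0.
have := tate_lip (hG i) hz hw (half0 n) ih; rewrite Gzw -exprS; congr (_ <= _).
by rewrite -padic_normN; congr (N _); ring.
Qed.

(** Picard iteration for [F z = z - H (F z)], where [H] is the displacement of [G]. Successive
    differences decrease in Gauss norm, not only pointwise, so the limit is again a restricted
    series. *)
Lemma near_id_inverse G : near_id G -> exists F, [/\ near_id F,
  forall z, unit_ball z -> G (F z) = z & forall z, unit_ball z -> F (G z) = z].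
Proof.
move=> hG; pose H i z : Qp := G z 0 i - z 0 i.
have [F [F0 FS]] : exists F : nat -> E -> E,
    F 0%N = id /\ forall n z, F n.+1 z = \row_i (z 0 i - H i (F n z)).
  by exists (fix F (n : nat) : E -> E := if n is m.+1 then fun z => \row_i (z 0 i - H i (F m z)) else id).
have tF n : tate_map (F n).
  elim: n => [|n ih] i; first by rewrite F0; exact: tate_coord.
  have h : tate 1 (fun z => z 0 i - H i (F n z)).
    apply: tateB (tate_coord p_pr i) _; apply: tate_le half1 _.
    exact: (tate_comp (hG i) ih).
  by apply: eq_tate h => z _; rewrite FS mxE.
pose D n i z := F n.+1 z 0 i - F n z 0 i.
have tD n i : tate (2^-1 ^+ n * 2^-1) (D n i).
  elim: n i => [|n ih] i.
    have h := tateN (hG i); rewrite expr0 mul1r; apply: eq_tate h => z _.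
    by rewrite /D FS F0 mxE /H; ring.
  have d0 : 0 <= 2^-1 ^+ n * 2^-1 :> rat by rewrite -exprSr.
  have := tateN (tate_comp_lip (hG i) (tF n.+1) (tF n) d0 ih).
  rewrite exprS -mulrA; apply: eq_tate => z _.
  have e k : F k.+1 z 0 i = z 0 i - H i (F k z) by rewrite FS mxE.
  by rewrite /D (e n.+1) /H (e n) /H; ring.
have tD' n i : tate (2^-1 ^+ n * 1) (D n i).
  by apply: tate_le (tD n i); rewrite ler_wpM2l.
have nD i z : unit_ball z -> null (fun n => D n i z).
  by move=> hz; apply: (null_tate_nsum (fun n => tD' n i)) => // e; exact: geom_small.
pose F' (z : E) : E := \row_i (z 0 i + nsum (fun n => D n i z)).
have nF' : near_id F'.
  move=> i; have h : tate 2^-1 (fun z => nsum (fun n => D n i z)).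
    apply: (tate_nsum _ (fun n => tD n i)) => [|n|e].
    - by rewrite invr_ge0.
    - by rewrite geom_le ?invr_ge0.
    - by apply: geom_small; rewrite invr_ge0.
  by apply: eq_tate h => z _; rewrite mxE addrC addrA addNr add0r.
have tF' := near_id_tate nF'.
have app n i z : unit_ball z -> N (F' z 0 i - F n z 0 i) <= 2^-1 ^+ n.
  move=> hz; have FE : F n z 0 i = z 0 i + \sum_(m < n) D m i z.
    elim: n => [|n ih]; first by rewrite F0 big_ord0 addr0.
    by rewrite big_ord_recr /= addrA -ih /D addrC subrK.
  rewrite FE mxE opprD addrACA subrr add0r -(big_fset_iota (fun m => D m i z)).
  apply: (nsum_approx (nD i z hz)) => // m; rewrite mem_fset_iota -leqNgt => nm.
  apply: le_trans (tate_bound (tD' m i) hz) _; rewrite mulr1.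
  by apply: ler_wiXn2l.
have GF z : unit_ball z -> G (F' z) = z.
  move=> hz; apply/rowP => i; apply/eqP; rewrite -subr_eq0; apply/eqP.
  have hF' := tate_map_ball tF' hz.
  apply: padic_norm_small0 => n; have hFn := tate_map_ball (tF n) hz.
  have h1 := tate_lip (hG i) hF' hFn (half0 n) (fun j => app n j z hz).
  have e : F n.+1 z 0 i = z 0 i - H i (F n z) by rewrite FS mxE.
  have h2 := app n.+1 i z hz; rewrite e /H in h2.
  have -> : G (F' z) 0 i - z 0 i =
      (G (F' z) 0 i - F' z 0 i - (G (F n z) 0 i - F n z 0 i)) +
      (F' z 0 i - (z 0 i - (G (F n z) 0 i - F n z 0 i))) by ring.
  have le2 : 2^-1 * 2^-1 ^+ n <= 2^-1 ^+ n :> rat by rewrite ler_piMl.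
  apply: padic_normD; first exact: le_trans h1 le2.
  by apply: le_trans h2 _; rewrite exprS.
exists F'; split=> // z hz.
have hGz := tate_map_ball (near_id_tate hG) hz.
(* The second composite needs no estimate: [G] is injective and [G (F' (G z)) = G z]. *)
by apply: (near_id_inj hG (tate_map_ball tF' hGz) hz); rewrite GF.
Qed.

Lemma near_id_open_ball G (z : E) : near_id G -> (forall i, N (z 0 i) < 1) ->
  forall i, N (G z 0 i) < 1.
Proof.
move=> hG hz i; rewrite -(subrK (z 0 i) (G z 0 i)); apply: padic_normD_lt => //.
apply: le_lt_trans (tate_bound (hG i) (fun j => ltW (hz j))) _.
by rewrite invf_lt1.
Qed.

End Inverse.

(** * Symplectic bases *)

Section SymplecticBasis.

Lemma xy_index_ind n (P : 'I_(2 * n) -> Prop) :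
  (forall k, P (x_index k)) -> (forall k, P (y_index k)) -> forall i, P i.
Proof.
move=> hx hy i; have hi : (i./2 < n)%N by have := ltn_ord i; lia.
have := odd_double_half i; case: (odd i) => e.
  by rewrite (_ : i = y_index (Ordinal hi)) //; apply/val_inj; rewrite /= -e /=; lia.
by rewrite (_ : i = x_index (Ordinal hi)) //; apply/val_inj; rewrite /= -e /=; lia.
Qed.

Lemma x_index_eq n (i j : 'I_n) : (x_index i == x_index j) = (i == j).
Proof. by rewrite -!val_eqE /= eqn_pmul2l. Qed.

Lemma y_index_eq n (i j : 'I_n) : (y_index i == y_index j) = (i == j).
Proof. by rewrite -!val_eqE /= eqSS eqn_pmul2l. Qed.

Lemma xy_index_eq n (i j : 'I_n) : (x_index i == y_index j) = false.
Proof. by rewrite -!val_eqE /=; apply/negbTE/negP => /eqP; lia. Qed.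

Lemma yx_index_eq n (i j : 'I_n) : (y_index i == x_index j) = false.
Proof. by rewrite eq_sym xy_index_eq. Qed.

Variable F : fieldType.

Definition std_symp n : 'M[F]_(2 * n) := \matrix_(i, j) \sum_(k < n)
  ((i == x_index k)%:R * (j == y_index k)%:R - (i == y_index k)%:R * (j == x_index k)%:R).

Lemma std_sympx n k j : std_symp n (x_index k) j = (j == y_index k)%:R.
Proof.
rewrite mxE (bigD1 k) //= x_index_eq eqxx xy_index_eq mul0r subr0 mul1r big1 ?addr0 // => i ik.
by rewrite x_index_eq xy_index_eq [k == i]eq_sym (negbTE ik) !mul0r subr0.
Qed.

Lemma std_sympy n k j : std_symp n (y_index k) j = - (j == x_index k)%:R.
Proof.
rewrite mxE (bigD1 k) //= y_index_eq eqxx yx_index_eq mul0r sub0r mul1r big1 ?addr0 // => i ik.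
by rewrite y_index_eq yx_index_eq [k == i]eq_sym (negbTE ik) !mul0r subr0.
Qed.

Lemma std_symp_sqr n : std_symp n *m std_symp n = - 1%:M.
Proof.
apply/matrixP => i j; rewrite [LHS]mxE [RHS]mxE [X in - X]mxE.
elim/xy_index_ind: i => k.
  rewrite (bigD1 (y_index k)) //= std_sympx eqxx mul1r std_sympy eq_sym big1 ?addr0 // => a ak.
  by rewrite std_sympx (negbTE ak) mul0r.
rewrite (bigD1 (x_index k)) //= std_sympy eqxx mulN1r std_sympx eq_sym big1 ?addr0 // => a ak.
by rewrite std_sympy (negbTE ak) oppr0 mul0r.
Qed.

Lemma std_symp_form n (u v : 'I_(2 * n) -> F) :
  \sum_i \sum_j std_symp n i j * u i * v j =
  \sum_(k < n) (u (x_index k) * v (y_index k) - u (y_index k) * v (x_index k)).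
Proof.
have delta (w : 'I_(2 * n) -> F) a : \sum_i (i == a)%:R * w i = w a.
  rewrite (bigD1 a) //= eqxx mul1r big1 ?addr0 // => i /negbTE ->.
  by rewrite mul0r.
transitivity (\sum_i \sum_j \sum_(k < n)
   ((i == x_index k)%:R * u i * ((j == y_index k)%:R * v j) -
    (i == y_index k)%:R * u i * ((j == x_index k)%:R * v j))).
  apply: eq_bigr => i _; apply: eq_bigr => j _; rewrite mxE !mulr_suml.
  by apply: eq_bigr => k _; ring.
under eq_bigr do rewrite exchange_big /=.
rewrite exchange_big /=; apply: eq_bigr => k _.
under eq_bigr do rewrite sumrB -!mulr_sumr !delta.
by rewrite sumrB -!mulr_suml !delta.
Qed.

(** Symplectic Gram-Schmidt process, by induction on the number [k] of hyperbolic pairs already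
    found. *)
Lemma symplectic_basis n (Om : 'M[F]_(2 * n)) :
  (forall u : 'rV_(2 * n), (u *m Om *m u^T) 0 0 = 0) ->
  (forall u : 'rV_(2 * n), u *m Om = 0 -> u = 0) ->
  exists A : 'M_(2 * n), A \in unitmx /\ A *m Om *m A^T = std_symp n.
Proof.
move=> alt nd; pose b (u v : 'rV_(2 * n)) := (u *m Om *m v^T) 0 0.
have bDl u u' v : b (u + u') v = b u v + b u' v by rewrite /b !mulmxDl mxE.
have bDr u v v' : b u (v + v') = b u v + b u v' by rewrite /b linearD /= mulmxDr mxE.
have bZr u a v : b u (a *: v) = a * b u v by rewrite /b linearZ /= -scalemxAr mxE.
have bsum u k (w : 'I_k -> 'rV_(2 * n)) (a : 'I_k -> F) :
    b u (\sum_i a i *: w i) = \sum_i a i * b u (w i).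
  by rewrite /b linear_sum mulmx_sumr summxE; apply: eq_bigr => i _; exact: bZr.
have bN u v : b u v = - b v u.
  have a0 w : b w w = 0 := alt w.
  have h := a0 (u + v); rewrite bDl !bDr !a0 add0r addr0 in h.
  by apply/eqP; rewrite -addr_eq0 h.
have main k : (k <= n)%N -> exists e f : nat -> 'rV_(2 * n),
    [/\ forall i j, (i < k)%N -> (j < k)%N -> b (e i) (e j) = 0,
        forall i j, (i < k)%N -> (j < k)%N -> b (f i) (f j) = 0 &
        forall i j, (i < k)%N -> (j < k)%N -> b (e i) (f j) = (i == j)%:R].
  elim: k => [|k ih] kn; first by exists (fun=> 0), (fun=> 0).
  have [e [f [ee ff ef]]] := ih (ltnW kn).
  (* The left kernel of [C] is the orthogonal of the [2 k] vectors found so far, nonzero since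
     [k < n]. *)
  pose C : 'M_(2 * n, k + k) := row_mx (\matrix_(a < (2 * n)%N, i < k) (Om *m (e i)^T) a 0)
                                       (\matrix_(a < (2 * n)%N, i < k) (Om *m (f i)^T) a 0).
  pose u := nz_row (kermx C).
  have u0 : u != 0.
    rewrite nz_row_eq0 -mxrank_eq0 mxrank_ker -lt0n subn_gt0.
    by apply: leq_ltn_trans (rank_leq_col C) _; lia.
  have /sub_kermxP uC : (u <= kermx C)%MS by exact: nz_row_sub.
  have ue i : (i < k)%N -> b u (e i) = 0.
    move=> ik; have := congr1 (fun M : 'rV_(k + k) => M 0 (lshift k (Ordinal ik))) uC.
    rewrite [RHS]mxE => <-; rewrite /b -mulmxA !mxE; apply: eq_bigr => a _.
    by rewrite row_mxEl [in RHS]mxE.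
  have uf i : (i < k)%N -> b u (f i) = 0.
    move=> ik; have := congr1 (fun M : 'rV_(k + k) => M 0 (rshift k (Ordinal ik))) uC.
    rewrite [RHS]mxE => <-; rewrite /b -mulmxA !mxE; apply: eq_bigr => a _.
    by rewrite row_mxEr [in RHS]mxE.
  have [v uv] : exists v, b u v = 1.
    have [j hj] : exists j, (u *m Om) 0 j != 0.
      apply/existsP; apply: contraR u0 => /existsPn h; apply/eqP/nd/rowP => j.
      by rewrite [RHS]mxE; apply/eqP/negPn/h.
    exists (((u *m Om) 0 j)^-1 *: delta_mx 0 j); rewrite bZr /b trmx_delta -colE [X in _ * X]mxE.
    by rewrite mulVf.
  (* The components of [v] along the earlier pairs are removed; as [u] is orthogonal to these pairs,
     its pairing with [v] stays 1. *)
  pose v' := v + (\sum_(i < k) - b (e i) v *: f i) + \sum_(i < k) b (f i) v *: e i.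
  have bv' w : b w v' = b w v + \sum_(i < k) - b (e i) v * b w (f i) +
      \sum_(i < k) b (f i) v * b w (e i) by rewrite /v' !bDr !bsum.
  have uv' : b u v' = 1.
    rewrite bv' uv !big1 ?addr0 // => i _; first by rewrite ue ?mulr0.
    by rewrite uf ?mulr0.
  have delta (w : 'I_k -> F) j (jk : (j < k)%N) :
      \sum_(i < k) w i * (j == i)%:R = w (Ordinal jk).
    rewrite (bigD1 (Ordinal jk)) //= eqxx mulr1 big1 ?addr0 // => i ij.
    rewrite (_ : _ == _ = false) ?mulr0 //; apply/negbTE; apply: contra ij => /eqP ji.
    by apply/eqP/val_inj.
  have ev' j : (j < k)%N -> b (e j) v' = 0.
    move=> jk; rewrite bv' [X in _ + X]big1 => [|i _]; last by rewrite ee ?mulr0.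
    rewrite (eq_bigr (fun i : 'I_k => - b (e i) v * (j == i)%:R)) => [|i _]; last by rewrite ef.
    by rewrite (delta _ j jk) addr0 subrr.
  have fv' j : (j < k)%N -> b (f j) v' = 0.
    move=> jk; rewrite bv' [X in _ + X + _]big1 => [|i _]; last by rewrite ff ?mulr0.
    rewrite (eq_bigr (fun i : 'I_k => - b (f i) v * (j == i)%:R)) => [|i _]; last first.
      by rewrite [b (f j) _]bN ef // mulrN mulNr eq_sym.
    by rewrite (delta _ j jk) addr0 subrr.
  exists (fun i => if i == k then u else e i), (fun i => if i == k then v' else f i).
  have lt i : (i < k.+1)%N -> i != k -> (i < k)%N.
    by rewrite ltnS leq_eqVlt; case: (i == k).
  split=> i j ik jk; have [ei|ik'] := eqVneq i k; have [ej|jk'] := eqVneq j k.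
  - exact: alt.
  - by rewrite ue // lt.
  - by rewrite bN ue ?oppr0 // lt.
  - by rewrite ee // lt.
  - exact: alt.
  - by rewrite bN fv' ?oppr0 // lt.
  - by rewrite fv' // lt.
  - by rewrite ff // lt.
  - by rewrite uv' ei ej eqxx.
  - by rewrite uf ?lt // ei eq_sym (negbTE jk').
  - by rewrite ev' ?lt // ej (negbTE ik').
  - by rewrite ef // lt.
have [e [f [ee ff ef]]] := main n (leqnn n).
pose A : 'M[F]_(2 * n) := \matrix_i (if odd i then f i./2 else e i./2).
have AE i j : (A *m Om *m A^T) i j = b (row i A) (row j A).
  by rewrite /b -row_mul [LHS]mxE [RHS]mxE; apply: eq_bigr => k _; rewrite !mxE.
have Ax k : row (x_index k) A = e k by rewrite rowK; have [-> ->] : odd (x_index k) = false /\ (x_index k)./2 = k by rewrite /=; lia.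
have Ay k : row (y_index k) A = f k by rewrite rowK; have [-> ->] : odd (y_index k) = true /\ (y_index k)./2 = k by rewrite /=; lia.
have AA : A *m Om *m A^T = std_symp n.
  apply/matrixP => i j; rewrite AE; elim/xy_index_ind: i => i; elim/xy_index_ind: j => j;
    rewrite ?std_sympx ?std_sympy ?Ax ?Ay.
  - by rewrite ee // xy_index_eq.
  - by rewrite ef // y_index_eq eq_sym.
  - by rewrite bN ef // x_index_eq.
  - by rewrite ff // yx_index_eq oppr0.
exists A; split=> //.
(* The standard matrix squares to -1, which exhibits a right inverse of [A]. *)
have : A *m (Om *m A^T *m (- std_symp n)) = 1%:M.
  by rewrite !mulmxA AA mulmxN std_symp_sqr opprK.
by case/mulmx1_unit.
Qed.

End SymplecticBasis.

(** * Darboux coordinates in affine space *)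

Section DarbouxAnalytic.
Variables (p : nat) (p_pr : prime p).
Local Notation Qp := (padic p_pr).
Local Notation N := (@padic_norm p p_pr).

Lemma tate_affine l (a : Qp) (m : 'I_l -> Qp) :
  exists C, tate C (fun z : 'rV[Qp]_l => a + \sum_i z 0 i * m i).
Proof.
have [B B0 hB] := fin_rat_bound (fun i => N (m i)).
exists (Num.max (N a) B); apply: tateD.
  by apply: tate_le (tate_cst _ _); rewrite le_max lexx.
apply: tate_sum => [|i _]; first by rewrite le_max padic_norm_ge0.
apply: tate1M (tate_coord p_pr i) _; apply: tate_le (tate_cst _ _).
by rewrite le_max hB orbT.
Qed.

Lemma analytic_affine l l' (a : 'rV[Qp]_l') (A : 'M[Qp]_(l, l')) :
  analytic setT (fun x => a + x *m A).
Proof.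
apply/analyticP => x _; exists 1; split=> [||j]; rewrite ?oner_neq0 //.
have [C tC] := tate_affine (l := l) ((a + x *m A) 0 j) (A^~ j); exists C.
apply: eq_tate tC => z _; rewrite scale1r mulmxDl addrA [RHS]mxE; congr (_ + _).
by rewrite mxE.
Qed.

Lemma jacobian_affine l l' (a : 'rV[Qp]_l') (A : 'M[Qp]_(l, l')) x :
  jacobian (fun x => a + x *m A) x = A.
Proof. by apply/matrixP => i j; rewrite mxE; exact: taylor1_pd i (taylor1_affine a A x j). Qed.

Definition open_unit_ball l : set 'rV[Qp]_l := [set z | forall i, N (z 0 i) < 1].

Lemma analytic_near_id l (G : 'rV[Qp]_l -> 'rV[Qp]_l) :
  near_id G -> analytic (@open_unit_ball l) G.
Proof.
move=> hG; apply/analyticP => x hx.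
have p1 : N p%:R <= 1 := padic_norm_nat_le1 _ p.
exists p%:R; split=> [|z hz i|j]; first exact: padic_p_neq0.
  rewrite !mxE; apply: padic_normD_lt => //; rewrite padic_normM.
  apply: le_lt_trans (_ : N p%:R * 1 < 1).
    by rewrite ler_wpM2l ?padic_norm_ge0.
  by rewrite mulr1; apply: le_lt_trans (padic_norm_p_le p_pr) _; rewrite invf_lt1.
exists 1.
exact: (tate_comp (near_id_tate hG j) (tate_map_scale (fun i => ltW (hx i)) p1)).
Qed.

Section AtPoint.
Variables (l : nat) (U : set 'rV[Qp]_l) (Om : 'I_l -> 'I_l -> 'rV[Qp]_l -> Qp)
  (x0 : 'rV[Qp]_l) (K : 'M[Qp]_l).
Hypotheses (Ux0 : U x0)
  (an : forall i j, analytic U (fun x => \row_(_ < 1) Om i j x))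
  (anti : forall i j x, U x -> Om i j x = - Om j i x)
  (closed : forall i j k x, U x ->
     pd i (Om j k) x + pd j (Om k i) x + pd k (Om i j) x = 0)
  (KOm : K *m (\matrix_(i, j) Om i j x0) = 1%:M).

(** A power of [p] below the finitely many individual radii gives one ball on which all coefficients
    are series. *)
Lemma tate_at_family : exists c : Qp, exists C : rat,
  [/\ c != 0, forall z, unit_ball z -> U (x0 + c *: z) &
      forall i j, tate C (fun z => Om i j (x0 + c *: z))].
Proof.
have h i j : exists u : Qp * rat, [/\ u.1 != 0, forall z, unit_ball z -> U (x0 + u.1 *: z) &
    tate u.2 (fun z => Om i j (x0 + u.1 *: z))].
  have /analyticP/(_ _ Ux0)[c [c0 cU /(_ 0)[C tC]]] := an i j.
  by exists (c, C); split=> //; apply: eq_tate tC => z _; rewrite mxE.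
have [u hu] := choice (fun ij : 'I_l * 'I_l => h ij.1 ij.2).
have [B B0 hB] := fin_rat_bound (fun ij => (N (u ij).1)^-1).
have [C C0 hC] := fin_rat_bound (fun ij => (u ij).2).
have B10 : 0 < B^-1 by rewrite invr_gt0.
have [n hn] := padic_pX_small p_pr B10; have {} hn := hn n (leqnn n).
have le ij : N (p%:R ^+ n) <= N (u ij).1.
  have [u0 _ _] := hu ij; apply: le_trans (ltW hn) _.
  by rewrite -[leRHS]invrK lef_pV2 ?posrE ?invr_gt0 ?padic_norm_gt0.
have cU z ij : unit_ball z -> exists2 w, unit_ball w &
    x0 + p%:R ^+ n *: z = x0 + (u ij).1 *: w.
  have [u0 _ _] := hu ij; move=> hz; exists ((p%:R ^+ n / (u ij).1) *: z).
    apply: unit_ballZ hz; rewrite padic_normM padic_normV ler_pdivrMr ?padic_norm_gt0 //.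
    by rewrite mul1r.
  by rewrite scalerA mulrC divfK.
exists (p%:R ^+ n), C; split=> [|z hz|i j].
- by rewrite expf_neq0 // padic_p_neq0.
(* In dimension 0 no coefficient provides a ball inside [U], but then the only point is [x0]. *)
- case: (pselect (exists i : 'I_l, True)) => [[i _]|l0].
    have [w hw ->] := cU z (i, i) hz; have [_ + _] := hu (i, i); exact.
  have -> : x0 + p%:R ^+ n *: z = x0 by apply/rowP => i; case: l0; exists i.
  exact: Ux0.
- have [u0 _ tu] := hu (i, j).
  have h1 : N (p%:R ^+ n / (u (i, j)).1) <= 1.
    by rewrite padic_normM padic_normV ler_pdivrMr ?padic_norm_gt0 // mul1r.
  apply: eq_tate (tate_scale (tate_le (hC (i, j)) tu) h1) => z _ /=.
  by rewrite scalerA mulrC divfK.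
Qed.

(* Scaling by a power of p makes the non-constant part of Om small. *)
Lemma darboux_at : exists (lam : Qp) (G : 'rV[Qp]_l -> 'rV[Qp]_l),
  [/\ lam != 0, near_id G & forall i j z, unit_ball z -> U (x0 + lam *: z) /\
      \sum_a \sum_b Om a b x0 * jacobian G z i a * jacobian G z j b = Om i j (x0 + lam *: z)].
Proof.
have [c [C [c0 cU tOm]]] := tate_at_family.
have p1 : N p%:R <= 1 := padic_norm_nat_le1 _ p.
(* The sign matches the normal form [Om - p^2 beta] of [tate_darboux]. *)
pose beta1 i j (z : 'rV[Qp]_l) := Om i j x0 - Om i j (x0 + c *: z).
have [B B0 hB] := fin_rat_bound (fun ij : 'I_l * 'I_l => N (Om ij.1 ij.2 x0)).
pose C1 := Num.max C B.
have C10 : 0 <= C1 by rewrite le_max (ltW B0) orbT.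
have tb1 i j : tate C1 (beta1 i j).
  apply: tateB; last by apply: tate_le (tOm i j); rewrite le_max lexx.
  by apply: tate_le (tate_cst _ _); rewrite le_max (hB (i, j)) orbT.
have anti1 i j z : unit_ball z -> beta1 i j z = - beta1 j i z.
  by move=> hz; rewrite /beta1 (anti i j Ux0) (anti i j (cU z hz)) -opprD.
have tOmx i j x : U x -> taylor1 (Om i j) x (fun k => pd k (Om i j) x).
  move=> Ux; have T := analytic_taylor1 0 (an i j) Ux.
  have E : (fun z => (\row_(_ < 1) Om i j z) 0 0) = Om i j by apply/funext => z; rewrite mxE.
  rewrite E in T; apply: taylor1_ext (T) => k; exact/esym/(taylor1_pd k T).
have pd1 k i j z : unit_ball z -> pd k (beta1 i j) z = - (c * pd k (Om i j) (x0 + c *: z)).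
  move=> hz; have hx := cU z hz.
  have := taylor1_comp (fun a => taylor1_affine x0 c%:M z a) (M := fun a => pd a (Om i j) (x0 + z *m c%:M)).
  rewrite mul_mx_scalar => /(_ _ (tOmx i j _ hx)) T.
  have E : Om i j \o (fun y => x0 + y *m c%:M) = fun y => Om i j (x0 + c *: y).
    by apply/funext => y /=; rewrite mul_mx_scalar.
  rewrite E in T; rewrite /beta1 (pdB k (tate_cst l (Om i j x0)) (tOm i j) hz) pd_cst sub0r.
  rewrite (taylor1_pd k T) (bigD1 k) //= mxE eqxx mulr1n big1 ?addr0 // => a ak.
  by rewrite mxE eq_sym (negbTE ak) mulr0n mul0r.
have closed1 i j k z : unit_ball z ->
    pd i (beta1 j k) z + pd j (beta1 k i) z + pd k (beta1 i j) z = 0.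
  move=> hz; rewrite !pd1 // -!opprD -!mulrDr closed ?mulr0 ?oppr0 //; exact: cU.
have zero1 i j : beta1 i j 0 = 0 by rewrite /beta1 scaler0 addr0 subrr.
have [C2 [Bm [tB Bm0 hBm]]] := tate_poincare tb1 anti1 closed1 zero1.
have [kap kap0 hkap] := fin_rat_bound (fun ij : 'I_l * 'I_l => N (K ij.1 ij.2)).
pose del : rat := Num.min 1 (2^-1 / kap).
have del0 : 0 < del by rewrite lt_min ltr01 divr_gt0 // invr_gt0.
have [del1 delk] : del <= 1 /\ del * kap <= 2^-1.
  split; first by rewrite ge_min lexx.
  by rewrite -ler_pdivlMr // ge_min lexx orbT.
pose eps : Qp := p%:R ^+ 2.
have eps0 : eps != 0 by rewrite expf_neq0 // padic_p_neq0.
pose D := Num.max C1 `|C2| + 1.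
have D0 : 0 < D by rewrite ltr_wpDl // le_max C10.
(* [mu] must compensate both Gauss norms and the division by [eps], and still leave them below
   [del]. *)
have [M hM] := padic_pX_small p_pr (divr_gt0 (mulr_gt0 del0 (padic_norm_gt0 eps0)) D0).
have {} hM := hM M (leqnn M); set mu : Qp := p%:R ^+ M in hM.
have mu1 : N mu <= 1 := padic_norm_pX_le1 _ M.
have mu0 : mu != 0 by rewrite expf_neq0 // padic_p_neq0.
have small C' : C' <= D -> N eps^-1 * (C' * N mu) <= del.
  move=> CD; rewrite padic_normV ler_pdivrMl ?padic_norm_gt0 // [leRHS]mulrC.
  apply: le_trans (ler_wpM2r (padic_norm_ge0 mu) CD) _.
  by rewrite [leLHS]mulrC; apply: ltW; rewrite -ltr_pdivlMr.
have C1D : C1 <= D by rewrite /D; apply: le_trans (_ : Num.max C1 `|C2| <= _); rewrite ?lerDl // le_max lexx.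
have C2D : C2 <= D.
  rewrite /D; apply: le_trans (ler_norm C2) _; apply: le_trans (_ : Num.max C1 `|C2| <= _).
    by rewrite le_max lexx orbT.
  by rewrite lerDl.
have muB z : unit_ball z -> unit_ball (mu *: z) by exact: unit_ballZ.
pose beta i j (z : 'rV[Qp]_l) := eps^-1 * beta1 i j (p%:R *: (mu *: z)).
pose gamma1 j (z : 'rV[Qp]_l) := \sum_k z 0 k * Bm k j z.
(* Since [beta] keeps coefficient functions and not the factor [mu ^+ 2] of a pulled-back form, its
   primitive is [gamma1] at [mu *: z] divided by [eps * mu]. It is small nevertheless: one factor
   [mu] is already in the coordinate, and [Bm] vanishes at 0. *)
pose gamma j (z : 'rV[Qp]_l) := eps^-1 * \sum_k z 0 k * Bm k j (mu *: z).
have tbeta i j : tate del (beta i j).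
  have h0 : beta1 i j (p%:R *: 0) = 0 by rewrite scaler0 zero1.
  by apply: tate_le (tateZ eps^-1 (tate_shrink (tate_scale (tb1 i j) p1) mu1 h0)); exact: small.
have tgamma j : tate del (gamma j).
  apply: tate_le (small _ C2D) _; apply: tateZ; apply: tate_sum => [|k _].
    by rewrite mulr_ge0 ?padic_norm_ge0 // (tate_ge0 (tB j j)).
  exact: tate1M (tate_coord p_pr k) (tate_shrink (tB k j) mu1 (Bm0 k j)).
have tgamma1 j : tate C2 (gamma1 j).
  apply: tate_sum => [|k _]; first exact: tate_ge0 (tB j j).
  exact: tate1M (tate_coord p_pr k) (tB k j).
have gE j z : gamma j z = (eps^-1 * mu^-1) * gamma1 j (mu *: z).
  rewrite /gamma /gamma1 -mulrA; congr (_ * _); rewrite mulr_sumr; apply: eq_bigr => k _.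
  by rewrite mxE !mulrA mulVf // mul1r.
have pdg i j z : unit_ball z -> pd i (gamma j) z = eps^-1 * pd i (gamma1 j) (mu *: z).
  move=> hz; rewrite (pd_ext i z (gE j)) (pdZ _ i (tate_scale (tgamma1 j) mu1) hz).
  by rewrite (pd_scale i (tgamma1 j) mu1 hz) mulrA divfK.
have dg i j z : unit_ball z -> pd i (gamma j) z - pd j (gamma i) z = beta i j z.
  by move=> hz; rewrite !pdg // -mulrBr hBm //; exact: muB.
pose Om0 : 'M[Qp]_l := \matrix_(i, j) Om i j x0.
have OmT : Om0^T = - Om0.
  by apply/matrixP => i j; rewrite !mxE; exact: anti.
have [G [tG hG]] := tate_darboux OmT KOm (fun i j => hkap (i, j)) (ltW del0) del1 delk
  tgamma tbeta dg.
(* Three scalings: [c] for convergence, [p] for the Poincare lemma, [mu] for smallness. *)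
exists (c * p%:R * mu), (fun z : 'rV[Qp]_l => \row_i G i z); split.
- by rewrite !mulf_neq0 // padic_p_neq0.
- by move=> i; apply: eq_tate (tG i) => z _; rewrite mxE.
move=> i j z hz; have h1 : unit_ball (p%:R *: (mu *: z)) by apply/unit_ballZ/muB.
have xE : x0 + (c * p%:R * mu) *: z = x0 + c *: (p%:R *: (mu *: z)) by rewrite !scalerA.
split; first by rewrite xE; exact: cU.
have JE a b : jacobian (fun z => \row_i G i z) z a b = pd a (G b) z.
  by rewrite mxE; apply: pd_ext => y; rewrite mxE.
have := hG i j z hz; rewrite /beta mulrA divff // mul1r mxE /beta1 -xE opprB addrC subrK => <-.
by apply: eq_bigr => a _; apply: eq_bigr => b _; rewrite !JE mxE.
Qed.

End AtPoint.
End DarbouxAnalytic.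

Lemma congr_mx_mul (R : comNzRingType) n (X P J : 'M[R]_n) :
  (X *m P) *m J *m (X *m P)^T = X *m (P *m J *m P^T) *m X^T.
Proof. by rewrite trmx_mul !mulmxA. Qed.

(** The Leibniz expansion of a determinant of size 2. *)
Lemma sum_perm2 (R : comNzRingType) (F G : 'I_2 -> R) :
  \sum_(s : 'S_2) (-1) ^+ s * (F (s 0) * G (s 1)) = F 0 * G 1 - F 1 * G 0.
Proof.
transitivity (\det (\matrix_(i < 2, j < 2) if i == 0 then F j else G j)).
  apply: eq_bigr => s _; congr (_ * _).
  rewrite !big_ord_recl big_ord0 mulr1 !mxE /=.
  by rewrite (_ : lift ord0 ord0 = 1) //; exact/val_inj.
rewrite (expand_det_row _ 0) !big_ord_recl big_ord0 addr0 /cofactor !det_mx11 !mxE /=.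
rewrite expr0 mul1r expr1 mulN1r mulrN.
by congr (_ * G _ - F _ * G _); exact/val_inj.
Qed.

Section DarbouxOpen.
Variables (p : nat) (p_pr : prime p).
Local Notation Qp := (padic p_pr).

(** [K] is [G] between affine maps: before it, the passage to the rescaled centred coordinate; after
    it, the opposite scaling, composed with the change to a symplectic basis of the form at [x0]. *)
Lemma darboux_open n (U : set 'rV[Qp]_(2 * n)) (Om : 'I_(2 * n) -> 'I_(2 * n) -> 'rV[Qp]_(2 * n) -> Qp)
    (x0 : 'rV[Qp]_(2 * n)) :
  U x0 -> (forall i j, analytic U (fun x => \row_(_ < 1) Om i j x)) ->
  (forall i j x, U x -> Om i j x = - Om j i x) ->
  (forall i j k x, U x ->
     pd i (Om j k) x + pd j (Om k i) x + pd k (Om i j) x = 0) ->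
  (forall u : 'rV_(2 * n), u *m (\matrix_(i, j) Om i j x0) = 0 -> u = 0) ->
  exists (K K' : 'rV[Qp]_(2 * n) -> 'rV[Qp]_(2 * n)) (V V' : set 'rV[Qp]_(2 * n)),
  [/\ analytic V K /\ analytic V' K', V x0 /\ V `<=` U,
      forall x, V x -> V' (K x) /\ K' (K x) = x,
      forall y, V' y -> V (K' y) /\ K (K' y) = y &
      forall x, V x ->
        (\matrix_(i, j) Om i j x) = jacobian K x *m std_symp _ n *m (jacobian K x)^T].
Proof.
move=> Ux0 an anti closed nd; pose Om0 : 'M_(2 * n) := \matrix_(i, j) Om i j x0.
have Om0T : Om0^T = - Om0 by apply/matrixP => i j; rewrite !mxE; exact: anti.
have alt (u : 'rV_(2 * n)) : (u *m Om0 *m u^T) 0 0 = 0.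
  set S := u *m Om0 *m u^T.
  have ST : S^T = - S by rewrite /S !trmx_mul trmxK Om0T mulNmx mulmxN mulmxA.
  have e : S 0 0 = - S 0 0 by have := congr1 (fun M : 'M_1 => M 0 0) ST; rewrite !mxE.
  apply: (mulfI (padic_nat_neq0 p_pr (ltn0Sn 1))).
  by rewrite mulr0 mulr_natl mulr2n {1}e addNr.
have [A [uA AO]] := symplectic_basis alt nd.
pose J := std_symp Qp n; pose P := invmx A.
have OP : Om0 = P *m J *m P^T.
  by rewrite /J -AO /P trmx_inv !mulmxA mulVmx // mul1mx mulmxK ?unitmx_tr.
(* From [Om0 = P J P^T] and [J^2 = -1], the inverse of [Om0] is explicit. *)
have KOm : (- (A^T *m J *m A)) *m Om0 = 1%:M.
  rewrite OP mulNmx -!mulmxA (mulmxA A) mulmxV // mul1mx (mulmxA J) std_symp_sqr.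
  by rewrite mulNmx mul1mx mulmxN opprK /P trmx_inv mulmxV ?unitmx_tr.
have [lam [G [lam0 hG eG]]] := darboux_at Ux0 an anti closed KOm.
have [F [hF GF FG]] := near_id_inverse hG.
pose B : set 'rV[Qp]_(2 * n) := @open_unit_ball p p_pr (2 * n).
have BB z : B z -> unit_ball z by move=> hz i; exact: ltW.
pose a1 (x : 'rV[Qp]_(2 * n)) := - (lam^-1 *: x0) + x *m (lam^-1)%:M.
(* The factor [lam] cancels the [lam^-1] of [a1] in the Jacobian, as [darboux_at] compares
   coefficients without the square of [lam]. *)
pose a2 (z : 'rV[Qp]_(2 * n)) := 0 + z *m (lam *: P).
pose b1 (z : 'rV[Qp]_(2 * n)) := x0 + z *m lam%:M.
pose b2 (y : 'rV[Qp]_(2 * n)) := 0 + y *m (lam^-1 *: A).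
have a1E x : a1 x = lam^-1 *: (x - x0) by rewrite /a1 mul_mx_scalar addrC -scalerBr.
have b1E z : b1 z = x0 + lam *: z by rewrite /b1 mul_mx_scalar.
have a1K x : b1 (a1 x) = x by rewrite b1E a1E scalerA divff // scale1r addrC subrK.
have b1K z : a1 (b1 z) = z by rewrite a1E b1E addrAC subrr add0r scalerA mulVf // scale1r.
have a2K z : b2 (a2 z) = z.
  by rewrite /a2 /b2 !add0r -!scalemxAr -scalemxAl scalerA -mulmxA mulVmx // mulmx1 mulVf // scale1r.
have b2K y : a2 (b2 y) = y.
  by rewrite /a2 /b2 !add0r -!scalemxAr -scalemxAl scalerA -mulmxA mulmxV // mulmx1 divff // scale1r.
have anG1 : analytic (a1 @^-1` B) (G \o a1).
  by have := analytic_comp (analytic_affine (- (lam^-1 *: x0)) (lam^-1)%:M) (analytic_near_id hG);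
    rewrite setTI.
have anF1 : analytic (b2 @^-1` B) (F \o b2).
  by have := analytic_comp (analytic_affine 0 (lam^-1 *: A)) (analytic_near_id hF); rewrite setTI.
have anG : analytic (a1 @^-1` B) (a2 \o (G \o a1)).
  by have := analytic_comp anG1 (analytic_affine 0 (lam *: P)); rewrite preimage_setT setIT.
have anF : analytic (b2 @^-1` B) (b1 \o (F \o b2)).
  by have := analytic_comp anF1 (analytic_affine x0 lam%:M); rewrite preimage_setT setIT.
have VU : a1 @^-1` B `<=` U.
  move=> x hx; have [[i _]|l0] := pselect (exists i : 'I_(2 * n), True).
    by have [+ _] := eG i i _ (BB _ hx); rewrite -b1E a1K.
  by have -> : x = x0 by apply/rowP => i; case: l0; exists i.
exists (a2 \o (G \o a1)), (b1 \o (F \o b2)), (a1 @^-1` B), (b2 @^-1` B); split.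
- by split; [exact: anG|exact: anF].
- split; [|exact: VU].
  move=> i; rewrite a1E subrr scaler0 mxE padic_norm0; exact: ltr01.
- move=> x hx; rewrite /= /preimage /= a2K; split; first exact: near_id_open_ball hG hx.
  by rewrite (FG _ (BB _ hx)) a1K.
- move=> y hy; rewrite /= /preimage /= b1K; split; first exact: near_id_open_ball hF hy.
  by rewrite (GF _ (BB _ hy)) b2K.
move=> x hx; have JK : jacobian (a2 \o (G \o a1)) x = jacobian G (a1 x) *m P.
  rewrite (analytic_jacobian_comp anG1 (analytic_affine 0 (lam *: P)) hx) //.
  rewrite (analytic_jacobian_comp (analytic_affine (- (lam^-1 *: x0)) (lam^-1)%:M)
    (analytic_near_id hG)) // !jacobian_affine mul_scalar_mx -scalemxAl -scalemxAr scalerA.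
  by rewrite mulVf // scale1r.
rewrite JK congr_mx_mul -OP.
apply/matrixP => i j; rewrite [LHS]mxE; have [_] := eG i j _ (BB _ hx).
rewrite -b1E a1K => <-; rewrite [RHS]mxE exchange_big /=; apply: eq_bigr => b _.
rewrite [X in _ = X * _]mxE [X in _ = _ * X]mxE mulr_suml; apply: eq_bigr => a _.
by rewrite [X in _ = _ * X * _]mxE; congr (_ * _); exact: mulrC.
Qed.

End DarbouxOpen.

(** * Forms and charts on a manifold *)

Section ManifoldDarboux.
Variables (p : nat) (p_pr : prime p).
Local Notation Qp := (padic p_pr).

Definition pair2 (T : Type) (u v : T) (i : 'I_2) : T := if i == 0 then u else v.

Section TwoForms.
Variables (l : nat) (f : ('I_2 -> 'rV[Qp]_l) -> Qp).
Hypotheses (fm : multilinear f) (fa : alternating f).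

Lemma pair2E (T : Type) (v : 'I_2 -> T) : v = pair2 (v 0) (v 1).
Proof.
apply/funext => i; rewrite /pair2; case: eqP => [->//|/eqP i0]; congr v; apply/val_inj.
by move: i i0 => [[|[|i]] hi].
Qed.

Lemma form2_linl a x y v : f (pair2 (a *: x + y) v) = a * f (pair2 x v) + f (pair2 y v).
Proof.
have E w : f [eta pair2 x v with 0 |-> w] = f (pair2 w v).
  by congr f; apply/funext => i; rewrite /pair2 /=; case: eqP.
by have := fm (pair2 x v) 0 a x y; rewrite !E.
Qed.

Lemma form2_linr a x y v : f (pair2 v (a *: x + y)) = a * f (pair2 v x) + f (pair2 v y).
Proof.
have E w : f [eta pair2 v x with 1 |-> w] = f (pair2 v w).
  by congr f; rewrite [RHS]pair2E [LHS]pair2E.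
by have := fm (pair2 v x) 1 a x y; rewrite !E.
Qed.

Lemma form2_antisym u v : f (pair2 u v) = - f (pair2 v u).
Proof.
have a0 w : f (pair2 w w) = 0 by apply: (@fa _ 0 1).
have := a0 (1 *: u + v); rewrite form2_linl !form2_linr !a0 !mul1r add0r addr0.
by move/eqP; rewrite addr_eq0 => /eqP.
Qed.

Lemma form2_expand u v : f (pair2 u v) =
  (u *m (\matrix_(i, j) f (pair2 (delta_mx 0 i) (delta_mx 0 j))) *m v^T) 0 0.
Proof.
have f0l v' : f (pair2 0 v') = 0.
  by have := form2_linl 0 0 0 v'; rewrite scaler0 addr0 mul0r add0r => _;
    have := form2_linl 1 0 0 v'; rewrite scaler0 addr0 mul1r -{1}[f _]addr0 => /addrI.
have f0r v' : f (pair2 v' 0) = 0 by rewrite form2_antisym f0l oppr0.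
have suml (I : Type) (r : seq I) (a : I -> Qp) (x : I -> 'rV[Qp]_l) v' :
    f (pair2 (\sum_(i <- r) a i *: x i) v') = \sum_(i <- r) a i * f (pair2 (x i) v').
  elim: r => [|i r ih]; first by rewrite !big_nil f0l.
  by rewrite !big_cons form2_linl ih.
have sumr (I : Type) (r : seq I) (a : I -> Qp) (x : I -> 'rV[Qp]_l) v' :
    f (pair2 v' (\sum_(i <- r) a i *: x i)) = \sum_(i <- r) a i * f (pair2 v' (x i)).
  elim: r => [|i r ih]; first by rewrite !big_nil f0r.
  by rewrite !big_cons form2_linr ih.
rewrite {1}(row_sum_delta u) suml [RHS]mxE.
under [RHS]eq_bigr do rewrite mxE mulr_suml.
rewrite exchange_big /=; apply: eq_bigr => i _.
rewrite {1}(row_sum_delta v) sumr mulr_sumr; apply: eq_bigr => j _.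
by rewrite !mxE mulrAC mulrA.
Qed.

End TwoForms.

Section Charts.
Variables (l : nat) (M : topologicalType).
Implicit Types c : chart p_pr M l.

Lemma within_open_nbhs (S T : topologicalType) (A : set S) (f : S -> T) x (B : set T) :
  open A -> {within A, continuous f} -> A x -> nbhs (f x) B -> nbhs x (A `&` f @^-1` B).
Proof.
move=> oA cf Ax fB; have cx : {for x, continuous f}.
  by move: cf; rewrite continuous_open_subspace // => /(_ x); apply; rewrite inE.
by apply: filterI; [exact: open_nbhs_nbhs|exact: cx].
Qed.

Lemma open_chart_preimage c (V : set 'rV[Qp]_l) : open V ->
  open (chart_dom c `&` c @^-1` V).
Proof.
move=> oV; rewrite openE => q [hq Vq].
apply: (within_open_nbhs (open_chart_dom c) (@chart_map_continuous _ _ _ _ c) hq).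
by apply: open_nbhs_nbhs; split.
Qed.

Lemma transitionE c c' q : chart_dom c q -> transition c c' (c q) = c' q.
Proof. by move=> hq; rewrite /transition /= chart_mapK. Qed.

(** The image is exactly [V'], open as a domain of analyticity; both continuity conditions come from
    the analyticity of [K] and [K']. *)
Lemma chart_compose c (V V' : set 'rV[Qp]_l) (K K' : 'rV[Qp]_l -> 'rV[Qp]_l) :
  analytic V K -> analytic V' K' -> V `<=` chart_cod c ->
  (forall x, V x -> V' (K x) /\ K' (K x) = x) ->
  (forall y, V' y -> V (K' y) /\ K (K' y) = y) ->
  exists c1 : chart p_pr M l,
    [/\ chart_dom c1 = chart_dom c `&` c @^-1` V,
        (c1 : M -> 'rV_l) = K \o c & chart_inv c1 = chart_inv c \o K'].
Proof.
move=> anK anK' VU hK hK'; have oV := analytic_open anK; have oV' := analytic_open anK'.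
pose D := chart_dom c `&` c @^-1` V.
have codE : (K \o c) @` D = V'.
  apply/seteqP; split=> [y [q [_ Vq] <-]|y hy]; first by have [] := hK _ Vq.
  have [Vy Ky] := hK' y hy; have [q hq cq] := VU _ Vy.
  by exists q => /=; [split; rewrite // /preimage /= cq|rewrite cq].
have oD : open D := open_chart_preimage c oV.
have oC : open ((K \o c) @` D) by rewrite codE.
have mapK q : D q -> (chart_inv c \o K') ((K \o c) q) = q.
  by move=> [hq Vq] /=; have [_ ->] := hK _ Vq; exact: chart_mapK.
have cm : {within D, continuous (K \o c)}.
  apply: continuous_in_subspaceT => q; rewrite inE => -[hq Vq].
  apply: continuous_comp; last exact: analytic_continuous anK Vq.
  have := @chart_map_continuous _ _ _ _ c; rewrite continuous_open_subspace.
    by move=> /(_ q); apply; rewrite inE.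
  exact: open_chart_dom.
have ci : {within (K \o c) @` D, continuous (chart_inv c \o K')}.
  rewrite codE; apply: continuous_in_subspaceT => y; rewrite inE => hy.
  apply: continuous_comp; first exact: analytic_continuous anK' hy.
  have := @chart_inv_continuous _ _ _ _ c; rewrite continuous_open_subspace.
    by move=> /(_ (K' y)); apply; rewrite inE; apply: VU; have [] := hK' y hy.
  exact: open_chart_cod.
by exists (Chart oD oC mapK cm ci).
Qed.

End Charts.

Section Atlas.
Variables (l : nat) (M : analytic_manifold p_pr l).
Implicit Types c : chart p_pr M l.

Definition overlap c c' : set 'rV[Qp]_l := c @` (chart_dom c `&` chart_dom c').

Lemma atlas_analytic c c' : atlas _ c -> atlas _ c' -> analytic (overlap c c') (transition c c').
Proof. exact: (@atlas_compatible _ _ _ M). Qed.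

Lemma overlapP c c' q : chart_dom c q -> chart_dom c' q -> overlap c c' (c q).
Proof. by move=> h h'; exists q. Qed.

(** The transitions compose only near [c m], on the overlap of the three domains; a Jacobian depends
    only on the germ. *)
Lemma transition_jacobianM c c' c'' m : chart_around m c -> chart_around m c' ->
  chart_around m c'' ->
  jacobian (transition c c'') (c m) =
  jacobian (transition c c') (c m) *m jacobian (transition c' c'') (c' m).
Proof.
move=> [ac hc] [ac' hc'] [ac'' hc''].
have an1 := atlas_analytic ac ac'; have an2 := atlas_analytic ac' ac''.
have h1 := overlapP hc hc'; have h2 := overlapP hc' hc''.
rewrite -(transitionE c' hc) in h2.
rewrite -[in RHS](transitionE c' hc) -(analytic_jacobian_comp an1 an2 h1 h2).
apply: (eq_jacobian (analytic_comp an1 an2)); last by split.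
have : nbhs (c m) (overlap c c') by apply: open_nbhs_nbhs; split=> //; exact: analytic_open an1.
apply: filterS => _ [q [hq hq'] <-] /=.
by rewrite !transitionE.
Qed.

Lemma transition_jacobian1 c m : chart_around m c -> jacobian (transition c c) (c m) = 1%:M.
Proof.
move=> [ac hc]; rewrite -(jacobian_id (c m)).
have an := atlas_analytic ac ac; have h := overlapP hc hc.
have ai : analytic (overlap c c) (@id 'rV[Qp]_l).
  by apply: eq_analytic an => _ [q [hq _] <-]; rewrite transitionE.
apply: (eq_jacobian ai) => //.
have : nbhs (c m) (overlap c c) by apply: open_nbhs_nbhs; split=> //; exact: analytic_open an.
by apply: filterS => _ [q [hq _] <-]; rewrite transitionE.
Qed.

Lemma chart_atP m : chart_around m (@chart_at _ _ _ M m).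
Proof. by rewrite /chart_at; case: cid. Qed.

(** The coordinates in one chart are transported to the others, consistently by the cocycle rule.
    This turns nondegeneracy on tangent spaces into a statement on matrices. *)
Lemma tangent_vector_ex m c (u0 : 'rV[Qp]_l) : chart_around m c ->
  exists u : tangent_space m, tangent_coord u c = u0.
Proof.
move=> hc; pose u c' : 'rV[Qp]_l :=
  if `[< chart_around m c' >] then u0 *m jacobian (transition c c') (c m) else 0.
have hu : u \in tangent_family m.
  apply/asboolP; split=> [c' hc'|c' c'' hc' hc'']; rewrite /u.
    by case: asboolP.
  rewrite !(introT (asboolP _)) // -mulmxA.
  by rewrite (transition_jacobianM hc hc' hc'').
exists (TangentVector hu) => /=; rewrite /u (introT (asboolP _)) //.
by rewrite transition_jacobian1 // mulmx1.
Qed.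

End Atlas.

End ManifoldDarboux.

(** * Darboux charts on a symplectic manifold *)

Section Darboux.
Variables (p : nat) (p_pr : prime p).
Local Notation Qp := (padic p_pr).
Local Notation N := (@padic_norm p p_pr).
Variables (n : nat) (M : analytic_manifold p_pr (2 * n)) (omega : form_family M 2).
Hypothesis (omega_symplectic : symplectic_form omega).
Implicit Types c : chart p_pr M (2 * n).
Local Notation E := 'rV[Qp]_(2 * n).

Definition form_coef c (i j : 'I_(2 * n)) (x : E) : Qp :=
  omega c x (pair2 (delta_mx 0 i) (delta_mx 0 j)).

Lemma form_coefE c x u v : atlas _ c -> chart_cod c x ->
  omega c x (pair2 u v) = (u *m (\matrix_(i, j) form_coef c i j x) *m v^T) 0 0.
Proof.
have [[h _ _] _ _] := omega_symplectic; move=> ac hx; have [fm fa] := h c x ac hx.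
exact: form2_expand fm fa u v.
Qed.

Lemma form_coef_anti c i j x : atlas _ c -> chart_cod c x ->
  form_coef c i j x = - form_coef c j i x.
Proof.
have [[h _ _] _ _] := omega_symplectic; move=> ac hx; have [fm fa] := h c x ac hx.
exact: form2_antisym fm fa _ _.
Qed.

Lemma form_coef_analytic c i j : atlas _ c ->
  analytic (chart_cod c) (fun x => \row_(_ < 1) form_coef c i j x).
Proof. by have [[_ h _] _ _] := omega_symplectic; move=> ac; exact: h. Qed.

Lemma form_coef_taylor1 c i j x : atlas _ c -> chart_cod c x ->
  taylor1 (form_coef c i j) x (fun k => pd k (form_coef c i j) x).
Proof.
move=> ac hx; have T := analytic_taylor1 0 (form_coef_analytic i j ac) hx.
have e : (fun z => (\row_(_ < 1) form_coef c i j z) 0 0) = form_coef c i j.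
  by apply/funext => z; rewrite mxE.
rewrite e in T; apply: taylor1_ext (T) => k; exact/esym/(taylor1_pd k T).
Qed.

Lemma form_coef_pd_anti c i j k x : atlas _ c -> chart_cod c x ->
  pd k (form_coef c i j) x = - pd k (form_coef c j i) x.
Proof.
move=> ac hx.
have T := taylor1M (taylor1_cst (-1) x) (form_coef_taylor1 j i ac hx).
have [r r0 hr] : exists2 r : rat, 0 < r &
    forall y : E, (forall j, N (x 0 j - y 0 j) < r) -> chart_cod c y.
  by apply/rV_nbhsP; apply: open_nbhs_nbhs; split=> //; exact: open_chart_cod.
have T' : taylor1 (form_coef c i j) x (fun a => 0 * form_coef c j i x + pd a (form_coef c j i) x * -1).
  apply: eq_taylor1 T; exists r => // w hw; rewrite mulN1r -form_coef_anti //.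
  by apply: hr => a; rewrite mxE opprD addrA subrr sub0r padic_normN.
by rewrite (taylor1_pd k T') mul0r add0r mulrN1.
Qed.

(** The differential is evaluated on three basis vectors; antisymmetry of the coefficients absorbs
    the minus sign of its middle term. *)
Lemma form_coef_closed c i j k x : atlas _ c -> chart_cod c x ->
  pd i (form_coef c j k) x + pd j (form_coef c k i) x + pd k (form_coef c i j) x = 0.
Proof.
have [_ h _] := omega_symplectic; move=> ac hx; have [q hq cq] := hx.
pose v (a : 'I_3) : E := delta_mx 0 (tnth [tuple i; j; k] a).
have {h} : form_diff omega c (c q) v = 0 := h q c v I (conj ac hq).
rewrite cq /form_diff !big_ord_recl big_ord0 addr0 /= => <-.
have E0 : v \o lift ord0 = pair2 (delta_mx 0 j) (delta_mx 0 k) by rewrite [LHS]pair2E.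
have E1 : v \o lift (lift ord0 ord0) = pair2 (delta_mx 0 i) (delta_mx 0 k).
  by rewrite [LHS]pair2E.
have E2 : v \o lift (lift ord0 (lift ord0 ord0)) = pair2 (delta_mx 0 i) (delta_mx 0 j).
  by rewrite [LHS]pair2E.
rewrite E0 E1 E2 /bump /= !add1n expr0 mul1r expr1 mulN1r sqrrN expr1n mul1r.
rewrite [pd j (form_coef c k i) x](form_coef_pd_anti k i j ac hx) -addrA.
by [].
Qed.

(** Restricted to [chart_at m] because [form_at] evaluates the form in that chart. *)
Lemma form_coef_nondegenerate m c (u : E) : c = chart_at m ->
  u *m (\matrix_(i, j) form_coef c i j (c m)) = 0 -> u = 0.
Proof.
have [_ _ nd] := omega_symplectic; move=> ce hu.
have hc : chart_around m c by rewrite ce; exact: chart_atP.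
have [t tu] := tangent_vector_ex u hc.
apply/eqP/negPn/negP => u0.
have t0 : t != 0.
  apply: contra u0 => /eqP t0; rewrite -tu t0; exact/eqP.
have [w /eqP] := nd m t t0; apply.
rewrite /form_at -ce [X in omega _ _ X]pair2E /= tu.
rewrite form_coefE; [|exact: hc.1|by exists m => //; exact: hc.2].
by rewrite hu mul0mx mxE.
Qed.

Lemma wedge_dcoordE c c' (U : set E) a b x v :
  analytic U (transition c' c) -> U x ->
  wedge (dcoord c a) (dcoord c b) c' x v =
  (v 0 *m jacobian (transition c' c) x) 0 a * (v 1 *m jacobian (transition c' c) x) 0 b -
  (v 1 *m jacobian (transition c' c) x) 0 a * (v 0 *m jacobian (transition c' c) x) 0 b.
Proof.
move=> an Ux.
have dE j (w : 'I_1 -> E) : dcoord c j c' x w = (w 0 *m jacobian (transition c' c) x) 0 j.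
  rewrite /dcoord /form_diff /form_of_fun big_ord_recl big_ord0 addr0 expr0 mul1r.
  rewrite (_ : ord0 = 0); last exact/val_inj.
  exact: (analytic_dirderiv (w 0) j an Ux).
rewrite /wedge invr1 mul1r.
under eq_bigr do rewrite !dE.
have l0 : lshift 1 (0 : 'I_1) = 0 by exact/val_inj.
have r1 : rshift 1 (0 : 'I_1) = 1 by exact/val_inj.
rewrite -(sum_perm2 (fun i => (v i *m jacobian (transition c' c) x) 0 a)
  (fun i => (v i *m jacobian (transition c' c) x) 0 b)).
by apply: eq_bigr => s _; rewrite /= l0 r1.
Qed.

(** The new chart is the chosen chart at [m] followed by the map [K] of [darboux_open]. It need not
    belong to the atlas, so its bi-analyticity with every atlas chart is checked. *)
Lemma darboux_chart (m : M) : exists c : chart p_pr M (2 * n),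
  [/\ local_coordinates c, chart_dom c m &
      eq_form_on (chart_dom c) omega
        (\sum_(i < n) wedge (dcoord c (x_index i)) (dcoord c (y_index i)))].
Proof.
pose c0 := chart_at m.
have [ac0 hc0] : chart_around m c0 by exact: chart_atP.
have Um : chart_cod c0 (c0 m) by exists m.
have D := darboux_open Um (fun i j => form_coef_analytic i j ac0)
  (fun i j x => @form_coef_anti c0 i j x ac0)
  (fun i j k x => @form_coef_closed c0 i j k x ac0)
  (fun u => @form_coef_nondegenerate m c0 u erefl).
case: D => K [K' [V [V' [[anK anK'] [Vm VU] hK hK' hJ]]]].
have [c [dc cE ciE]] := chart_compose anK anK' VU hK hK'.
have tc c' : transition c' c = K \o transition c' c0 by rewrite /transition cE.
have tc' c' : transition c c' = transition c0 c' \o K' by rewrite /transition ciE.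
have an_to c' : atlas _ c' -> analytic (overlap c' c) (transition c' c).
  move=> ac'; have := analytic_comp (atlas_analytic ac' ac0) anK; rewrite -tc.
  congr analytic; apply/seteqP; split=> [y [[q [hq' hq] <-]]|y [q [hq']] ].
    rewrite /preimage /= transitionE // => Vq; exists q => //; split=> //.
    by rewrite dc; split.
  rewrite dc => -[hq Vq] <-; split; first by exists q.
  by rewrite /preimage /= transitionE.
exists c; split.
- move=> c' ac'; split; last exact: an_to.
  rewrite /analytic_change tc'.
  have := analytic_comp anK' (atlas_analytic ac0 ac').
  congr analytic; apply/seteqP; split=> [y [hy [q [hq hq'] K'y]]|y [q []]].
    have [Vy Ky] := hK' y hy; exists q; last by rewrite cE /= K'y.
    by split=> //; rewrite dc; split=> //; rewrite /preimage /= K'y.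
  rewrite dc => -[hq Vq] hq' <-; rewrite cE /=; have [V'q Kq] := hK _ Vq.
  by split=> //; rewrite /preimage /= Kq; exists q.
- by rewrite dc; split.
(* The equality is tested in an arbitrary atlas chart [c']: the invariance of [omega] moves it to
   [c0], where the normal form is known, and the chain rule for [K] brings it back. *)
move=> q c' v hq [ac' hc'].
have [hq0 Vq] : chart_dom c0 q /\ V (c0 q) by move: hq; rewrite dc => -[].
have [[_ _ inv] _ _] := omega_symplectic.
rewrite (inv q c' c0 v (conj ac' hc') (conj ac0 hq0)) [X in omega _ _ X]pair2E.
rewrite form_coefE //; last exact: VU.
have U1 : overlap c' c0 (c' q) by exists q.
have JE : jacobian (transition c' c) (c' q) =
    jacobian (transition c' c0) (c' q) *m jacobian K (c0 q).
  rewrite tc (analytic_jacobian_comp (atlas_analytic ac' ac0) anK U1) ?transitionE //.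
rewrite hJ //.
have -> : (\sum_(i < n) wedge (dcoord c (x_index i)) (dcoord c (y_index i))) c' (c' q) v =
    \sum_(i < n) wedge (dcoord c (x_index i)) (dcoord c (y_index i)) c' (c' q) v.
  by elim/big_rec2: _ => // i f g _ <-.
have Uq : overlap c' c (c' q) by exists q.
set J := jacobian (transition c' c0) (c' q) in JE *; set J' := jacobian K (c0 q) in JE *.
set T := jacobian (transition c' c) (c' q) in JE.
transitivity ((v 0 *m T *m std_symp _ n *m (v 1 *m T)^T) 0 0).
  by rewrite JE !trmx_mul !mulmxA.
transitivity (\sum_i \sum_j std_symp Qp n i j * (v 0 *m T) 0 i * (v 1 *m T) 0 j).
  rewrite mxE exchange_big /=; apply: eq_bigr => j _.
  rewrite [X in X * _]mxE [X in _ * X]mxE mulr_suml; apply: eq_bigr => i _.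
  by congr (_ * _); exact: mulrC.
rewrite (std_symp_form (fun i => (v 0 *m T) 0 i) (fun j => (v 1 *m T) 0 j)).
apply: eq_bigr => k _; rewrite (wedge_dcoordE _ _ _ (an_to c' ac') Uq).
by congr (_ - _); exact: mulrC.
Qed.

End Darboux.

Theorem theorem2 (n : nat) (n_gt0 : (0 < n)%N) (p : nat) (p_pr : prime p)
    (M : analytic_manifold p_pr (2 * n)) (omega : form_family M 2)
    (omega_symplectic : symplectic_form omega) (m : M) :
  exists c : chart p_pr M (2 * n),
    [/\ local_coordinates c, chart_dom c m &
        eq_form_on (chart_dom c) omega
          (\sum_(i < n) wedge (dcoord c (x_index i)) (dcoord c (y_index i)))].
Proof. exact: darboux_chart. Qed.
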